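(* Let $\mathbf F_t$ be a rational reduced-rank $I(1)$ family with cointegration rank $c$ and parameter set $\Pi$ (as defined in the context), so that $$(1-L)\mathbf F_t=\mathbf S(L)^{-1}\mathbf C(L)\mathbf u_t,\qquad \mathbf C(L)=\boldsymbol\xi\boldsymbol\eta'+(1-L)\mathbf D+(1-L)^2\mathbf E(L).$$ Let $\mathbf k$ be a $c$-dimensional constant vector. For generic values of the parameters in $\Pi$ the following hold. (i) $\mathbf F_t$ can be determined (that is, a solution $\mathbf F_t$ of the difference equation above can be chosen) such that, with $\boldsymbol\beta=\mathbf S(1)'\boldsymbol\xi_\perp$, the process $\boldsymbol\beta'\mathbf F_t=\boldsymbol\xi_\perp'\mathbf S(1)\mathbf F_t$ is weakly stationary with rational spectral density and mean $\mathbf k$. (ii) $\mathbf F_t$ so determined has the Error Correction representation $$\mathbf A(L)\mathbf F_t=\mathbf A^*(L)(1-L)\mathbf F_t+\boldsymbol\alpha\boldsymbol\beta'\mathbf F_{t-1}=\mathbf h+\mathbf C(0)\mathbf u_t,$$ where, for some finite-degree $r\times r$ polynomial matrix $\mathbf N(L)=\mathbf I_r+\mathbf N_1L+\cdots+\mathbf N_pL^p$ with $\mathbf N(L)\mathbf M(L)=\mathbf M(0)$ and all roots of $\det\mathbf N(z)$ outside the closed unit disc, $$\mathbf A(L)=\boldsymbol\zeta^{-1}\mathbf N(L)\begin{pmatrix}\mathbf I_c&\mathbf 0\\ \mathbf 0&(1-L)\mathbf I_{r-c}\end{pmatrix}\boldsymbol\zeta\,\mathbf S(L),\qquad \mathbf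 A^*(L)=(1-L)^{-1}\left(\mathbf A(L)-\mathbf A(1)L\right)$$ are finite-degree $r\times r$ polynomial matrices (with $\mathbf A(0)=\mathbf I_r$), the $r\times c$ matrices $$\boldsymbol\alpha=\boldsymbol\zeta^{-1}\mathbf N(1)\begin{pmatrix}\mathbf I_c\\ \mathbf 0_{(r-c)\times c}\end{pmatrix},\qquad \boldsymbol\beta=\mathbf S(1)'\boldsymbol\xi_\perp$$ have full rank $c$ (and $\mathbf A(1)=\boldsymbol\alpha\boldsymbol\beta'$), and $\mathbf h=\boldsymbol\zeta^{-1}\mathbf N(1)\begin{pmatrix}\mathbf k\\ \mathbf 0_{(r-c)\times 1}\end{pmatrix}$ is an $r$-dimensional constant vector. Moreover, generically, $\boldsymbol\beta'\mathbf F_t$ is $I(0)$.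
   Context: $L$ is the lag operator; processes are indexed by $t\in\mathbb Z$ and have coordinates in $L_2(\Omega,\mathcal F,P)$ for a probability space $(\Omega,\mathcal F,P)$. $\mathbf u_t$ is a $q$-dimensional zero-mean white noise with non-singular covariance matrix. **Rational reduced-rank $I(1)$ family with cointegration rank $c$.** Let $r>q>0$ and $r>c\ge r-q$. Consider couples $(\mathbf S(L),\mathbf C(L))$ where: (1) $\mathbf C(L)=\boldsymbol\xi\boldsymbol\eta'+(1-L)\mathbf D+(1-L)^2\mathbf E(L)$, with $\boldsymbol\xi$ of size $r\times(r-c)$, $\boldsymbol\eta$ of size $q\times(r-c)$, $\mathbf D$ of size $r\times q$, and $\mathbf E(L)$ an $r\times q$ matrix polynomial of degree $s_1\ge0$; (2) $\mathbf S(L)$ is an $r\times r$ matrix polynomial of degree $s_2\ge0$ with $\mathbf S(0)=\mathbf I_r$; (3) the vector $\mathbf p$ of all $\lambda=(r-c)(r+q)+rq(1+s_1)+r^2s_2$ real coefficients of $\boldsymbol\xi,\boldsymbol\eta,\mathbf D,\mathbf E(L),\mathbf S(L)$ varies in an open set $\Pi\subset\mathbb R^\lambda$, and for every $\mathbf p\in\Pi$, $\det\mathbf S(z)=0$ implies $|z|>1$. The family consists of the processes $\mathbf F_t$ such that $(1-L)\mathbf F_t=\mathbf S(L)^{-1}\mathbf C(L)\mathbf u_t$. For given parameters the solutions $\mathbf F_t$ of this equation are $\tilde{\mathbf F}_t+\mathbf W$, where $\tilde{\mathbf F}_t$ is a particular solution and $\mathbf W$ is any $r$-dimensional random vector (constant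 in $t$) with coordinates in $L_2(\Omega,\mathcal F,P)$. **Genericity.** A statement depending on $\mathbf p\in\Pi$ holds generically (for generic values of the parameters in $\Pi$) if the subset of $\Pi$ on which it fails is nowhere dense in $\Pi$. **Matrices $\boldsymbol\xi_\perp$, $\boldsymbol\zeta$, $\mathbf M(L)$.** Generically $\boldsymbol\xi$ has full rank $r-c$; then $\boldsymbol\xi_\perp$ denotes an $r\times c$ matrix whose columns are linearly independent and orthogonal to all columns of $\boldsymbol\xi$, $\boldsymbol\zeta=\begin{pmatrix}\boldsymbol\xi_\perp'\\ \boldsymbol\xi'\end{pmatrix}$ (an invertible $r\times r$ matrix), and $$\mathbf M(L)=\begin{pmatrix}\boldsymbol\xi_\perp'\mathbf D\\ \boldsymbol\xi'\boldsymbol\xi\boldsymbol\eta'\end{pmatrix}+(1-L)\begin{pmatrix}\boldsymbol\xi_\perp'\mathbf E(L)\\ \boldsymbol\xi'\mathbf D\end{pmatrix}+(1-L)^2\begin{pmatrix}\mathbf 0_{c\times q}\\ \boldsymbol\xi'\mathbf E(L)\end{pmatrix}.$$ **$I(0)$.** A vector process is $I(0)$ if it is weakly stationary with rational spectral density $\boldsymbol\Sigma(\theta)$ and $\boldsymbol\Sigma(0)\ne\mathbf 0$.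
   Formalization: The displayed number of parameters omits the rq entries of D; the vector p of all coefficients of ξ, η, D, E(L), S(L) is taken with the correct count λ=(r-c)(r+q)+rq(2+s_1)+r^2 s_2. *)

(* Defs.v *)
From HB Require Import structures.
From mathcomp Require Import all_boot all_order all_algebra.
From mathcomp Require Import all_classical all_reals all_analysis.
From mathcomp Require Import complex.

Set Implicit Arguments.
Unset Strict Implicit.
Unset Printing Implicit Defensive.

Import Order.TTheory GRing.Theory Num.Theory.
Import numFieldNormedType.Exports.

Local Open Scope classical_set_scope.
Local Open Scope ring_scope.

(* The subset of D where Q fails has, in the subspace topology of D, a closure
   with empty interior: its closure relative to D is D `&` closure A, and the
   relatively open sets are the U `&` D with U open. *)
Definition nowhere_dense_in (X : topologicalType) (D A : set X) : Prop :=
  forall U : set X, open U ->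
    U `&` D `<=` closure (A `&` D) -> U `&` D = set0.

Definition generically (X : topologicalType) (D : set X) (Q : X -> Prop) :
    Prop :=
  nowhere_dense_in D [set x | D x /\ ~ Q x].

(* A matrix polynomial A(L) = sum_k A_k L^k is a matrix over {poly R}, the
   indeterminate standing for the lag operator L. *)
Section MatrixPolynomials.
Variable R : realType.

Definition const_mxp (m n : nat) (A : 'M[R]_(m, n)) : 'M[{poly R}]_(m, n) :=
  map_mx polyC A.

Definition eval_mxp (m n : nat) (A : 'M[{poly R}]_(m, n)) (x : R) :
    'M[R]_(m, n) :=
  map_mx (fun a : {poly R} => a.[x]) A.

Definition coef_mxp (m n : nat) (A : 'M[{poly R}]_(m, n)) (k : nat) :
    'M[R]_(m, n) :=
  map_mx (fun a : {poly R} => a`_k) A.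

Definition stable_mxp (n : nat) (A : 'M[{poly R}]_n) : Prop :=
  forall z : R[i],
    (map_poly (real_complex R) (\det A)).[z] = 0 -> 1 < `|z|.

(* The G_k are the power series coefficients of S(z)^-1; those of S(z)^-1 C(z)
   are then series_mulr G C k. *)
Definition is_inv_series (n : nat) (S : 'M[{poly R}]_n) (G : nat -> 'M[R]_n) :
    Prop :=
  forall k, \sum_(j < k.+1) coef_mxp S j *m G (k - j)%N = (k == 0%N)%:R%:M.

Definition series_mulr (m n : nat) (G : nat -> 'M[R]_m)
    (C : 'M[{poly R}]_(m, n)) (k : nat) : 'M[R]_(m, n) :=
  \sum_(j < k.+1) G j *m coef_mxp C (k - j)%N.

End MatrixPolynomials.

Section Processes.
Context (disp : measure_display) (T : measurableType disp) (R : realType).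
Variable P : probability T R.

Definition process (n : nat) : Type := int -> T -> 'cV[R]_n.

Definition coordp (n : nat) (X : process n) (t : int) (i : 'I_n) : T -> R :=
  fun w => X t w i ord0.

Definition L2_process (n : nat) (X : process n) : Prop :=
  forall t i, coordp X t i \in Lfun P 2%:E.

Definition mean_process (n : nat) (X : process n) (k : 'cV[R]_n) : Prop :=
  forall t i, 'E_P[coordp X t i]%E = (k i ord0)%:E.

Definition white_noise (n : nat) (X : process n) : Prop :=
  [/\ L2_process X, mean_process X 0
    & exists2 G : 'M[R]_n, G \in unitmx
      & forall t s i j, covariance P (coordp X t i) (coordp X s j)
                        = ((t == s)%:R * G i j)%:E].

Definition weakly_stationary (n : nat) (X : process n) : Prop :=
  [/\ L2_process X,
      exists k : 'cV[R]_n, mean_process X k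
    & forall t s h i j, covariance P (coordp X (t + h) i) (coordp X (s + h) j)
                        = covariance P (coordp X t i) (coordp X s j)].

Definition cis (x : R) : R[i] := Complex (cos x) (sin x).

(* E[(X_(t+h) - EX)(X_t - EX)'] = \int_(-pi)^pi e^(i h x) Sigma(x) dx; the
   complex integral is written through its real and imaginary parts. *)
Definition spectral_density (n : nat) (X : process n)
    (Sigma : R -> 'M[R[i]]_n) : Prop :=
  forall (t h : int) (i j : 'I_n),
    covariance P (coordp X (t + h) i) (coordp X t j)
      = (\int[lebesgue_measure]_(x in `[- pi, pi])
           complex.Re (cis (h%:~R * x) * Sigma x i j))%:E
    /\ \int[lebesgue_measure]_(x in `[- pi, pi])
         complex.Im (cis (h%:~R * x) * Sigma x i j) = 0.

(* Entries are rational functions of e^(-i x); an integrable one has no pole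
   on the unit circle once in lowest terms. *)
Definition rational_density (n : nat) (Sigma : R -> 'M[R[i]]_n) : Prop :=
  exists a b : 'M[{poly R[i]}]_n, forall x i j,
    (b i j).[cis (- x)] != 0 /\
    Sigma x i j = (a i j).[cis (- x)] / (b i j).[cis (- x)].

Definition stationary_rational (n : nat) (X : process n) : Prop :=
  weakly_stationary X /\
  exists2 Sigma, rational_density Sigma & spectral_density X Sigma.

Definition I0 (n : nat) (X : process n) : Prop :=
  weakly_stationary X /\
  exists Sigma, [/\ rational_density Sigma, spectral_density X Sigma
                  & Sigma 0 != 0].

Definition mul_process (m n : nat) (A : 'M[R]_(m, n)) (X : process n) :
    process m :=
  fun t w => A *m X t w.

Definition diff_process (n : nat) (X : process n) : process n :=
  fun t w => X t w - X (t - 1) w.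

Definition lag_filter (m n : nat) (A : 'M[{poly R}]_(m, n)) (X : process n) :
    process m :=
  fun t w => \col_i \sum_j \sum_(k < size (A i j))
    (A i j)`_k * X (t - k%:Z) w j ord0.

(* Y_t = sum_(k >= 0) B_k X_(t-k), the series converging in mean square. *)
Definition L2_filter (m n : nat) (B : nat -> 'M[R]_(m, n)) (X : process n)
    (Y : process m) : Prop :=
  forall t i,
    expectation P (fun w => (Y t w i ord0
       - (\sum_(k < N) B k *m X (t - k%:Z) w) i ord0) ^+ 2)
      @[N --> \oo] --> 0%E.

End Processes.

(* Throughout, r = c + d with d = r - c, so that the block decompositions into
   sizes c and r - c need no casts.  A parameter
   vector lists the coefficients of xi, eta, D, E(L) and S(L), in this order. *)
Definition nparam (c d q s1 s2 : nat) : nat :=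
  ((c + d) * d + (q * d + ((c + d) * q
    + (s1.+1 * ((c + d) * q) + s2 * ((c + d) * (c + d))))))%N.

Lemma nparamE (c d q s1 s2 r : nat) : r = (c + d)%N ->
  nparam c d q s1 s2
    = ((r - c) * (r + q) + r * q * (2 + s1) + r ^ 2 * s2)%N.
Proof.
move=> re; rewrite /nparam -re (_ : d = r - c)%N; last by rewrite re addKn.
rewrite mulnDr -mulnn add2n mulnS (mulnC q) (mulnC s1.+1) (mulnC s2).
by rewrite (mulnC _ r) !addnA.
Qed.

Section Family.
Variables (R : realType) (c d q s1 s2 : nat).
Implicit Type p : 'rV[R]_(nparam c d q s1 s2).

Definition xi p : 'M[R]_(c + d, d) :=
  vec_mx (lsubmx (p : 'rV_(_ + _))).

Definition eta p : 'M[R]_(q, d) :=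
  vec_mx (lsubmx (rsubmx (p : 'rV_(_ + (_ + _))))).

Definition Dmx p : 'M[R]_(c + d, q) :=
  vec_mx (lsubmx (rsubmx (rsubmx (p : 'rV_(_ + (_ + (_ + _))))))).

Definition Ecoef p (k : 'I_s1.+1) : 'M[R]_(c + d, q) :=
  vec_mx (row k (vec_mx (lsubmx (rsubmx (rsubmx (rsubmx
    (p : 'rV_(_ + (_ + (_ + (_ + _)))))))))) ).

(* Scoef p k is the coefficient of L^(k+1). *)
Definition Scoef p (k : 'I_s2) : 'M[R]_(c + d) :=
  vec_mx (row k (vec_mx (rsubmx (rsubmx (rsubmx (rsubmx
    (p : 'rV_(_ + (_ + (_ + (_ + _)))))))))) ).

Definition Epoly p : 'M[{poly R}]_(c + d, q) :=
  \sum_(k < s1.+1) 'X^k *: const_mxp (Ecoef p k).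

Definition Spoly p : 'M[{poly R}]_(c + d) :=
  1%:M + \sum_(k < s2) 'X^(k.+1) *: const_mxp (Scoef p k).

Definition Cpoly p : 'M[{poly R}]_(c + d, q) :=
  const_mxp (xi p *m (eta p)^T) + (1 - 'X) *: const_mxp (Dmx p)
    + (1 - 'X) ^+ 2 *: Epoly p.

(* The L2 processes F with (1 - L) F_t = S(L)^-1 C(L) u_t. *)
Definition solution (disp : measure_display) (T : measurableType disp)
    (P : probability T R) (u : process T R q) p (F : process T R (c + d)) :
    Prop :=
  L2_process P F /\
  exists2 G, is_inv_series (Spoly p) G
    & L2_filter P (series_mulr G (Cpoly p)) u (diff_process F).

Definition is_xi_perp p (xip : 'M[R]_(c + d, c)) : Prop :=
  \rank xip = c /\ xip^T *m xi p = 0.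

Definition zeta p (xip : 'M[R]_(c + d, c)) : 'M[R]_(c + d) :=
  col_mx xip^T (xi p)^T.

Definition Mpoly p (xip : 'M[R]_(c + d, c)) : 'M[{poly R}]_(c + d, q) :=
  col_mx (const_mxp (xip^T *m Dmx p))
         (const_mxp ((xi p)^T *m xi p *m (eta p)^T))
  + (1 - 'X) *: col_mx (const_mxp xip^T *m Epoly p)
                       (const_mxp ((xi p)^T *m Dmx p))
  + (1 - 'X) ^+ 2 *: col_mx 0 (const_mxp (xi p)^T *m Epoly p).

Definition betamx p (xip : 'M[R]_(c + d, c)) : 'M[R]_(c + d, c) :=
  (eval_mxp (Spoly p) 1)^T *m xip.

Definition Apoly p (xip : 'M[R]_(c + d, c)) (N : 'M[{poly R}]_(c + d)) :
    'M[{poly R}]_(c + d) :=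
  const_mxp (invmx (zeta p xip)) *m N
    *m block_mx 1%:M 0 0 (1 - 'X)%:M
    *m const_mxp (zeta p xip) *m Spoly p.

Definition alphamx p (xip : 'M[R]_(c + d, c)) (N : 'M[{poly R}]_(c + d)) :
    'M[R]_(c + d, c) :=
  invmx (zeta p xip) *m eval_mxp N 1 *m col_mx 1%:M 0.

Definition hvec p (xip : 'M[R]_(c + d, c)) (N : 'M[{poly R}]_(c + d))
    (k : 'cV[R]_c) : 'cV[R]_(c + d) :=
  invmx (zeta p xip) *m eval_mxp N 1 *m col_mx k 0.

(* F solves the difference equation and is determined so that beta' F_t is
   weakly stationary with rational spectral density and mean k. *)
Definition determined (disp : measure_display) (T : measurableType disp)
    (P : probability T R) (u : process T R q) p (xip : 'M[R]_(c + d, c))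
    (k : 'cV[R]_c) (F : process T R (c + d)) : Prop :=
  [/\ solution P u p F,
      stationary_rational P (mul_process (betamx p xip)^T F)
    & mean_process P (mul_process (betamx p xip)^T F) k].

End Family.

(* Main.v *)
Require Import Defs.
From HB Require Import structures.
From mathcomp Require Import all_boot all_order all_algebra.
From mathcomp Require Import all_classical all_reals all_analysis.
From mathcomp Require Import measurable_realfun.
From mathcomp Require Import perm complex ring lra.

Set Implicit Arguments.
Unset Strict Implicit.
Unset Printing Implicit Defensive.

Import Order.TTheory GRing.Theory Num.Theory.
Import numFieldNormedType.Exports.

Local Open Scope classical_set_scope.
Local Open Scope ring_scope.

(** Write [C(1) = xi eta'] and let [Psi = S(1)^-1 xi eta'] be the long-run response
    of the differences to the noise.  Since [C - S Psi] vanishes at one, it is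
    [(1 - L) Q] for a polynomial matrix [Q], so that [S^-1 C = Psi + (1 - L) H] where
    [H = S^-1 Q] has absolutely summable coefficients.  The solutions are therefore
    [Psi] times a random walk, plus the stationary process [Y = H u], plus a random
    vector constant in time.  As [beta' Psi = xi_perp' xi eta' = 0], the random walk
    does not enter [beta' F], which is [beta' Y] plus a constant in time; choosing
    this constant equal to [k] gives part (i) ([determined_exists]).  The spectral
    density of [beta' Y] is the usual product of transfer functions, a rational
    function with denominator [|det S|^2] ([filter_spectral_density]).

    Conversely the level of [beta' F] cannot be random as soon as [beta' F] has a
    rational spectral density ([stationary_gap]): the autocovariances tend to zero by
    the Riemann-Lebesgue lemma, whereas a random level would contribute its variance
    to all of them, the noise being asymptotically uncorrelated with any fixed
    variable.  Both facts are instances of Bessel's inequality ([bessel]).  Hence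
    [beta' F = beta' Y + k] almost surely for all the solutions [F] considered, which
    is what the representation and the last assertion need
    ([determined_gap]).

    For the error correction representation, [xi_perp' S(L) F] is [k] plus a finite
    filter of the noise, obtained by dividing [xi_perp' C(L)] by [1 - L], and
    [xi' S(L) (1 - L) F = xi' C(L) u]; stacked, these read
    [(k, 0)' + M(L) u] ([determined_error_correction]).  If [M(z)] has full column rank
    for all complex [z], then [M] has a polynomial left inverse, elementary row
    operations reduce it to a constant matrix, and these operations, normalized at
    zero, form [N] ([zeroless_inverse_filter]).  Applying [N] leaves [M(0) u], and
    [M(0) = zeta C(0)].

    It remains to see which conditions are generic.  They all have the form
    [f(p) <> 0], for functions [f] that are polynomial on lines, so that it is enough
    to exhibit one parameter where [f] does not vanish ([generically_polyfun]): the
    determinant of a block of [xi]; the resultant of two [q]-minors of [M], which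
    exist because [q < r], and which have no common root if it is nonzero; and an
    entry of the value at one of the numerator of the transfer function of [beta' Y],
    which makes its spectral density nonzero at frequency zero.  The last two are
    stated for the complement of [xi] given by Cramer's rule, any other one being an
    invertible multiple of it ([good_xi_perp]).  The inequality [c >= r - q] and
    [q < r] give [c > 0], so that there is an entry to look at. *)

(** * Absolutely summable solutions of a scalar recursion *)

Section ScalarSeries.
Variable F : comNzRingType.
Implicit Types (p q : {poly F}) (b e : nat -> F).

(** Coefficients of the product of [p] and the power series [sum_k b_k X^k]. *)
Definition pconv p b k := \sum_(j < k.+1) p`_j * b (k - j)%N.

(** Truncating the series reduces identities about [pconv] to the ring of
    polynomials. *)
Lemma pconv_poly p b n k : (k < n)%N ->
  pconv p b k = (p * \poly_(i < n) b i)`_k.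
Proof.
move=> kn; rewrite coefM; apply: eq_bigr => j _; rewrite coef_poly.
by rewrite (leq_ltn_trans (leq_subr _ _) kn).
Qed.

Lemma eq_pconv p b e : b =1 e -> pconv p b =1 pconv p e.
Proof. by move=> be k; apply: eq_bigr => j _; rewrite be. Qed.

Lemma pconvM p q b : pconv (p * q) b =1 pconv p (pconv q b).
Proof.
move=> k; rewrite (@pconv_poly _ _ k.+1)// -mulrA coefM.
by apply: eq_bigr => j _; rewrite -pconv_poly// ltnS leq_subr.
Qed.

Lemma pconvDl p q b k : pconv (p + q) b k = pconv p b k + pconv q b k.
Proof. by rewrite -big_split; apply: eq_bigr => j _; rewrite coefD mulrDl. Qed.

Lemma pconv_sumr (I : finType) p (b : I -> nat -> F) k :
  pconv p (fun i => \sum_l b l i) k = \sum_l pconv p (b l) k.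
Proof. by rewrite exchange_big; apply: eq_bigr => j _; rewrite mulr_sumr. Qed.

Lemma pconv_suml (I : finType) (p : I -> {poly F}) b k :
  pconv (\sum_l p l) b k = \sum_l pconv (p l) b k.
Proof.
by rewrite exchange_big; apply: eq_bigr => j _; rewrite coef_sum mulr_suml.
Qed.

Lemma pconvZr p a b k : pconv p (fun i => a * b i) k = a * pconv p b k.
Proof. by rewrite mulr_sumr; apply: eq_bigr => j _; rewrite mulrCA. Qed.

Lemma pconvZl p a b k : pconv (a *: p) b k = a * pconv p b k.
Proof. by rewrite mulr_sumr; apply: eq_bigr => j _; rewrite coefZ mulrA. Qed.

Lemma pconv1 b k : pconv 1 b k = b k.
Proof.
rewrite /pconv big_ord_recl coefC eqxx mul1r subn0 big1 ?addr0// => i _.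
by rewrite coefC mul0r.
Qed.

Lemma pconvX b k : pconv 'X b k = if k is j.+1 then b j else 0.
Proof.
rewrite /pconv big_ord_recl coefX mul0r add0r.
case: k => [|k]; first by rewrite big_ord0.
rewrite big_ord_recl coefX mul1r big1 ?addr0 ?subn1// => i _.
by rewrite coefX mul0r.
Qed.

End ScalarSeries.

Section L1.
Variable F : numFieldType.
Implicit Types (b e : nat -> F).

Definition l1 b := exists M, forall n, \sum_(k < n) `|b k| <= M.

(** Reading the recursion [b_(k-1) - r b_k = e_k] as a formula for [b_k] makes
    division by [r], where [|r| > 1], a contraction. *)
Lemma l1_XsubC r b : 1 < `|r| -> l1 (pconv ('X - r%:P) b) -> l1 b.
Proof.
move=> r1 [M hM].
have r0 : 0 < `|r| by rewrite (lt_trans _ r1).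
have step n : `|r| * (\sum_(k < n) `|b k|) <= \sum_(k < n) `|b k| + M.
  have E k : r * b k = (if k is j.+1 then b j else 0) - pconv ('X - r%:P) b k.
    rewrite -alg_polyC -scaleNr pconvDl pconvX pconvZl pconv1.
    by rewrite opprD addrA subrr add0r mulNr opprK.
  rewrite mulr_sumr (eq_bigr (fun k : 'I_n => `|r * b k|)); last first.
    by move=> k _; rewrite normrM.
  apply: le_trans (_ : \sum_(k < n) (`|(if val k is j.+1 then b j else 0)| +
     `|pconv ('X - r%:P) b k|) <= _).
    by apply: ler_sum => k _; rewrite E ler_normB.
  rewrite big_split/=; apply: lerD (hM n).
  case: n => [|n]; first by rewrite !big_ord0.
  by rewrite big_ord_recl normr0 add0r [leRHS]big_ord_recr/= lerDl.
exists (M / (`|r| - 1)) => n.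
by rewrite ler_pdivlMr ?subr_gt0// mulrBr mulr1 lerBlDr mulrC [M + _]addrC.
Qed.

Lemma l1_prod_XsubC rs b : (forall r, r \in rs -> 1 < `|r|) ->
  l1 (pconv (\prod_(r <- rs) ('X - r%:P)) b) -> l1 b.
Proof.
elim: rs b => [|r rs IH] b hr.
  rewrite big_nil => -[M hM]; exists M => n; rewrite (le_trans _ (hM n))//.
  by apply: ler_sum => k _; rewrite pconv1.
rewrite big_cons mulrC => -[M hM].
apply/(@l1_XsubC r); first by rewrite hr ?mem_head.
apply: IH => [s srs|]; first by rewrite hr// in_cons srs orbT.
exists M => n; rewrite (le_trans _ (hM n))//.
by apply: ler_sum => k _; rewrite pconvM.
Qed.

Lemma l1_eq b e : b =1 e -> l1 b -> l1 e.
Proof.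
move=> be [M hM]; exists M => n; rewrite (le_trans _ (hM n))//.
by apply: ler_sum => k _; rewrite be.
Qed.

Lemma l1Z a b : l1 b -> l1 (fun k => a * b k).
Proof.
move=> [M hM]; exists (`|a| * M) => n.
apply: le_trans (ler_wpM2l (normr_ge0 a) (hM n)).
by rewrite mulr_sumr; apply: ler_sum => k _; rewrite normrM.
Qed.

Lemma l1_sum (I : finType) (b : I -> nat -> F) : (forall i, l1 (b i)) ->
  l1 (fun k => \sum_i b i k).
Proof.
move=> hb; have [M hM] := choice hb.
exists (\sum_i M i) => n.
apply: (@le_trans _ _ (\sum_i \sum_(k < n) `|b i k|)); last first.
  by apply: ler_sum => i _; exact: hM.
by rewrite exchange_big; apply: ler_sum => k _; exact: ler_norm_sum.
Qed.

Lemma l1_coef (p : {poly F}) : l1 (fun k => p`_k).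
Proof.
exists (\sum_(k < size p) `|p`_k|) => n.
have [np|pn] := leqP n (size p).
  rewrite (big_ord_widen _ (fun k => `|p`_k|) np).
  rewrite [leRHS](bigID (fun k : 'I_(size p) => (k < n)%N))/= lerDl.
  by apply: sumr_ge0.
rewrite (big_ord_widen _ (fun k => `|p`_k|) (ltnW pn)).
rewrite (bigID (fun k : 'I_n => (k < size p)%N))/= [X in _ + X]big1 ?addr0//.
by move=> i; rewrite -leqNgt => /(nth_default 0) ->; rewrite normr0.
Qed.

End L1.

Section Stable.
Variable R : realType.

(** Over the complex numbers [d] is a product of factors [X - r] with [|r| > 1],
    which can be divided out one at a time. This is what makes the inverse of a
    stable lag polynomial a summable filter. *)
Lemma l1_stable (d : {poly R}) (b : nat -> R) : d != 0 ->
  (forall z : R[i], (map_poly (real_complex R) d).[z] = 0 -> 1 < `|z|) ->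
  l1 (pconv d b) -> l1 b.
Proof.
move=> d0 hd [M hM].
have [rs drs] := closed_field_poly_normal (map_poly (real_complex R) d).
set dc := map_poly _ d in drs hd.
have lc0 : lead_coef dc != 0 by rewrite lead_coef_eq0 map_poly_eq0.
have rs1 r : r \in rs -> 1 < `|r|.
  move=> rrs; apply: hd; rewrite drs hornerZ.
  suff /rootP -> : root (\prod_(z <- rs) ('X - z%:P)) r by rewrite mulr0.
  by rewrite root_prod_XsubC.
have [M' hM'] : l1 (fun k => real_complex R (b k)).
  apply: (l1_prod_XsubC rs1).
  apply: (@l1_eq _ (fun k => (lead_coef dc)^-1 * pconv dc (fun k => real_complex R (b k)) k)).
    by move=> k; rewrite {2}drs pconvZl mulKf.
  apply: l1Z; exists (real_complex R M) => n.
  apply: le_trans (_ : real_complex R (\sum_(k < n) `|pconv d b k|) <= _).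
    rewrite rmorph_sum; apply: ler_sum => k _.
    rewrite (_ : pconv dc _ _ = real_complex R (pconv d b k)).
      by rewrite normc_def/= expr0n addr0 sqrtr_sqr.
    by rewrite rmorph_sum; apply: eq_bigr => j _; rewrite rmorphM coef_map.
  by rewrite lecR.
exists (complex.Re M') => n; rewrite -lecR.
have rM : real_complex R (complex.Re M') = M'.
  apply: RRe_real; apply: ger0_real; apply: le_trans (hM' 0%N).
  by rewrite big_ord0.
rewrite rM; apply: le_trans (hM' n); rewrite rmorph_sum; apply: ler_sum => k _.
by rewrite normc_def/= expr0n addr0 sqrtr_sqr.
Qed.
End Stable.

(** * Convolution of a matrix polynomial with a sequence of matrices *)

Section MatrixSeries.
Variable R : realType.

(** [A(L)] times the power series [sum_k b_k L^k]; applied after a filter with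
    coefficients [b], the lag polynomial [A(L)] gives a filter with these
    coefficients. *)
Definition mconv m n p (A : 'M[{poly R}]_(m, n)) (b : nat -> 'M[R]_(n, p)) k :=
  \sum_(j < k.+1) coef_mxp A j *m b (k - j)%N.

Lemma mconvE m n p (A : 'M[{poly R}]_(m, n)) (b : nat -> 'M[R]_(n, p)) k i l :
  mconv A b k i l = \sum_o pconv (A i o) (fun t => b t o l) k.
Proof.
rewrite summxE exchange_big; apply: eq_bigr => j _; rewrite mxE.
by apply: eq_bigr => o _; rewrite mxE.
Qed.

Lemma eq_mconv m n p (A : 'M[{poly R}]_(m, n)) (b e : nat -> 'M[R]_(n, p)) :
  b =1 e -> mconv A b =1 mconv A e.
Proof. by move=> be k; apply: eq_bigr => j _; rewrite be. Qed.

Lemma mconvM m n o p (A : 'M[{poly R}]_(m, n)) (B : 'M[{poly R}]_(n, o))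
    (b : nat -> 'M[R]_(o, p)) k :
  mconv (A *m B) b k = mconv A (mconv B b) k.
Proof.
apply/matrixP => i l; rewrite !mconvE.
under eq_bigr => t _ do rewrite mxE pconv_suml.
rewrite exchange_big; apply: eq_bigr => t _ /=.
rewrite (eq_pconv _ (e := fun k => \sum_s pconv (B t s) (fun k => b k s l) k)).
  by rewrite pconv_sumr; apply: eq_bigr => s _; rewrite pconvM.
by move=> h; rewrite mconvE.
Qed.

Lemma mconvDr m n p (A : 'M[{poly R}]_(m, n)) (b e : nat -> 'M[R]_(n, p)) k :
  mconv A (fun t => b t + e t) k = mconv A b k + mconv A e k.
Proof. by rewrite -big_split; apply: eq_bigr => j _; rewrite mulmxDr. Qed.

Lemma mconvDl m n p (A B : 'M[{poly R}]_(m, n)) (b : nat -> 'M[R]_(n, p)) k :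
  mconv (A + B) b k = mconv A b k + mconv B b k.
Proof.
rewrite -big_split; apply: eq_bigr => j _ /=; rewrite -mulmxDl; congr (_ *m _).
by apply/matrixP => i l; rewrite !mxE coefD.
Qed.

Lemma mconv_const m n p (A : 'M[R]_(m, n)) (b : nat -> 'M[R]_(n, p)) k :
  mconv (const_mxp A) b k = A *m b k.
Proof.
rewrite /mconv big_ord_recl subn0 big1 ?addr0; last first.
  move=> j _; rewrite (_ : coef_mxp _ _ = 0) ?mul0mx//.
  by apply/matrixP => i l; rewrite !mxE coefC.
by congr (_ *m _); apply/matrixP => i l; rewrite !mxE coefC.
Qed.

Lemma mconv_coef m n p (A : 'M[{poly R}]_(m, n)) (B : 'M[{poly R}]_(n, p)) k :
  mconv A (coef_mxp B) k = coef_mxp (A *m B) k.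
Proof.
apply/matrixP => i l; rewrite mconvE !mxE coef_sum; apply: eq_bigr => o _.
by rewrite coefM; apply: eq_bigr => j _; rewrite mxE.
Qed.

(** A polynomial matrix with identity constant term is invertible as a power
    series, so that one can divide by it coefficient by coefficient. *)
Lemma mconv_inj n p (A : 'M[{poly R}]_n) (b e : nat -> 'M[R]_(n, p)) :
  coef_mxp A 0 = 1%:M -> mconv A b =1 mconv A e -> b =1 e.
Proof.
move=> A0 be k; elim/ltn_ind: k => k IH.
move: (be k); rewrite /mconv !big_ord_recl A0 !mul1mx subn0.
rewrite [X in _ + X = _](_ : _ =
  \sum_(j < k) coef_mxp A (lift ord0 j) *m e (k - (lift ord0 j))%N).
  exact: addIr.
apply: eq_bigr => j _; rewrite IH//= /bump/= add1n ltn_subrL/=.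
by case: (k) j => [[]|].
Qed.

Lemma mconv_solve n p (A : 'M[{poly R}]_n) (e : nat -> 'M[R]_(n, p)) :
  coef_mxp A 0 = 1%:M -> exists b, mconv A b =1 e.
Proof.
move=> A0.
(* [approx m] holds the first [m] coefficients of the quotient. *)
pose approx := fix approx m : nat -> 'M[R]_(n, p) :=
  if m is m'.+1 then
    fun k => if (k < m')%N then approx m' k
             else e m' - \sum_(j < m') coef_mxp A j.+1 *m approx m' (m' - j.+1)%N
  else fun=> 0.
pose b k := approx k.+1 k.
have ab m k : (k < m)%N -> approx m k = b k.
  elim: m => [//|m IH]; rewrite ltnS leq_eqVlt => /predU1P[-> //|km] /=.
  by rewrite km IH.
exists b => k; rewrite /mconv big_ord_recl A0 mul1mx subn0 {1}/b /= ltnn.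
rewrite -addrA [X in _ + X](_ : _ = 0) ?addr0// addrC; apply/eqP.
rewrite subr_eq0; apply/eqP/eq_bigr => j _; congr (_ *m _).
by rewrite /= /bump/= add1n ab// ltn_subrL/=; case: (k) j => [[]|].
Qed.

(** The left factor acts on rows and the right factor on columns, so the two
    products commute. *)
Lemma mconv_series_mulr n p (A : 'M[{poly R}]_n) (G : nat -> 'M[R]_n)
    (C : 'M[{poly R}]_(n, p)) k :
  mconv A (series_mulr G C) k = series_mulr (mconv A G) C k.
Proof.
have E (H : nat -> 'M[R]_n) t i l :
    series_mulr H C t i l = \sum_o pconv (C o l) (fun k => H k i o) t.
  rewrite summxE /pconv [RHS]exchange_big/= [RHS](reindex_inj rev_ord_inj)/=.
  apply: eq_bigr => j _; rewrite mxE; apply: eq_bigr => o _.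
  by rewrite mxE mulrC subSS subKn// -ltnS.
apply/matrixP => i l; rewrite mconvE E.
under eq_bigr => t _.
  rewrite (eq_pconv _ (e := fun k => \sum_o pconv (C o l) (fun k => G k t o) k)).
    rewrite pconv_sumr.
    under eq_bigr => s _ do rewrite -pconvM mulrC pconvM.
  over.
  by move=> h; rewrite E.
rewrite exchange_big; apply: eq_bigr => o _ /=.
rewrite [RHS](eq_pconv _ (e := fun k => \sum_t pconv (A i t) (fun k => G k t o) k)).
  by rewrite pconv_sumr.
by move=> h; rewrite mconvE.
Qed.

Lemma inv_seriesP n p (S : 'M[{poly R}]_n) (G : nat -> 'M[R]_n)
    (C : 'M[{poly R}]_(n, p)) :
  is_inv_series S G -> mconv S (series_mulr G C) =1 coef_mxp C.
Proof.
move=> SG k; rewrite mconv_series_mulr /series_mulr big_ord_recl big1; last first.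
  by move=> j _; rewrite -[mconv _ _ _]/(\sum_(j < _) _) SG/= -scalemx1 scale0r mul0mx.
by rewrite /mconv SG mul1mx addr0 subn0.
Qed.

Lemma l1_mconv_const m n p (A : 'M[R]_(m, n)) (b : nat -> 'M[R]_(n, p)) i l :
  (forall i l, l1 (fun k => b k i l)) -> l1 (fun k => (A *m b k) i l).
Proof.
move=> hb; apply: (@l1_eq _ (fun k => \sum_j A i j * b k j l)).
  by move=> k; rewrite mxE.
by apply: l1_sum => j; apply: l1Z.
Qed.

(** Multiplying [S H = Q] by the adjugate of [S] reduces to the scalar
    denominator [det S]. *)
Lemma adj_mconv n p (S : 'M[{poly R}]_n) (Q : 'M[{poly R}]_(n, p))
    (H : nat -> 'M[R]_(n, p)) :
  mconv S H =1 coef_mxp Q ->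
  forall i l, pconv (\det S) (fun k => H k i l) =1 (fun k => ((\adj S *m Q) i l)`_k).
Proof.
move=> SH i l k; have := mconv_coef (\adj S) Q k; rewrite -(eq_mconv _ SH) -mconvM mul_adj_mx.
move=> /matrixP/(_ i l); rewrite mconvE (bigD1 i)//= big1 ?addr0.
  by rewrite !mxE eqxx mulr1n => ->.
move=> j ji; rewrite mxE eq_sym (negbTE ji) /pconv big1// => t _.
by rewrite coef0 mul0r.
Qed.

End MatrixSeries.

(** * Semi-inner products and Bessel's inequality *)

(** Bessel's inequality is used for square-integrable variables, where almost
    surely zero ones have length zero, and for continuous functions on a period.
    Positivity without definiteness covers both; [S] is the set on which the
    product is bilinear. *)
Record semi_inner (R : realType) (V : lmodType R) (S : V -> Prop)
    (ip : V -> V -> R) : Prop := SemiInner {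
  si0 : S 0;
  siD : forall f g, S f -> S g -> S (f + g);
  siZ : forall a f, S f -> S (a *: f);
  siC : forall f g, ip f g = ip g f;
  siDl : forall f g h, S f -> S g -> S h -> ip (f + g) h = ip f h + ip g h;
  siZl : forall a f g, S f -> S g -> ip (a *: f) g = a * ip f g;
  si_ge0 : forall f, S f -> 0 <= ip f f
}.

Section SemiInner.
Variables (R : realType) (V : lmodType R) (S : V -> Prop) (ip : V -> V -> R).
Hypothesis H : semi_inner S ip.
Let S0 := si0 H.
Let SD := siD H.
Let SZ := siZ H.
Let ipC := siC H.
Let ipDl := siDl H.
Let ipZl := siZl H.
Let ip_ge0 := si_ge0 H.

Lemma S_sum (I : Type) (r : seq I) (f : I -> V) :
  (forall i, S (f i)) -> S (\sum_(i <- r) f i).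
Proof. by move=> Sf; apply: (big_ind S). Qed.

Lemma SN f : S f -> S (- f).
Proof. by rewrite -scaleN1r; exact: SZ. Qed.

Lemma SB f g : S f -> S g -> S (f - g).
Proof. by move=> Sf Sg; apply: SD => //; exact: SN. Qed.

Lemma ip0l g : S g -> ip 0 g = 0.
Proof. by move=> Sg; rewrite -(scale0r 0) ipZl// mul0r. Qed.

Lemma ipDr f g h : S f -> S g -> S h -> ip h (f + g) = ip h f + ip h g.
Proof. by move=> *; rewrite ipC ipDl// !(ipC h). Qed.

Lemma ipZr a f g : S f -> S g -> ip f (a *: g) = a * ip f g.
Proof. by move=> *; rewrite ipC ipZl// ipC. Qed.

Lemma ipNl f g : S f -> S g -> ip (- f) g = - ip f g.
Proof. by move=> *; rewrite -scaleN1r ipZl// mulN1r. Qed.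

Lemma ipBl f g h : S f -> S g -> S h -> ip (f - g) h = ip f h - ip g h.
Proof. by move=> *; rewrite ipDl ?ipNl//; exact: SN. Qed.

Lemma ipBr f g h : S f -> S g -> S h -> ip h (f - g) = ip h f - ip h g.
Proof. by move=> *; rewrite ipC ipBl// !(ipC h). Qed.

Lemma ip_suml (I : Type) (r : seq I) (f : I -> V) g :
  (forall i, S (f i)) -> S g -> ip (\sum_(i <- r) f i) g = \sum_(i <- r) ip (f i) g.
Proof.
move=> Sf Sg; elim: r => [|i r IH]; first by rewrite !big_nil ip0l.
by rewrite !big_cons ipDl ?IH//; exact: S_sum.
Qed.

Lemma ip_sumr (I : Type) (r : seq I) (f : I -> V) g :
  (forall i, S (f i)) -> S g -> ip g (\sum_(i <- r) f i) = \sum_(i <- r) ip g (f i).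
Proof.
by move=> Sf Sg; rewrite ipC ip_suml//; apply: eq_bigr => i _; rewrite ipC.
Qed.

Lemma ip_cauchy_schwarz f g : S f -> S g -> ip f g ^+ 2 <= ip f f * ip g g.
Proof.
move=> Sf Sg.
(* The square of [a f - b g], with [(a, b) = (<g, g>, <f, g>)]; if [<g, g> = 0],
   with [a = 1] and [b] large enough to contradict [<f, g> <> 0]. *)
have key a b : 0 <= a ^+ 2 * ip f f - 2 * a * b * ip f g + b ^+ 2 * ip g g.
  have Saf := SZ a Sf; have Sbg := SZ b Sg.
  have := ip_ge0 (SB Saf Sbg).
  rewrite ipBl ?ipBr ?ipZl ?ipZr ?ipZl ?ipZr//; try exact: SB.
  by rewrite (ipC g f); lra.
have [gg0|gg0] := eqVneq (ip g g) 0; last first.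
  have gg : 0 < ip g g by rewrite lt0r gg0 ip_ge0.
  have := key (ip g g) (ip f g); rewrite -(pmulr_lge0 _ gg).
  set a := ip g g in gg *; set b := ip f g; set c := ip f f => HH.
  have : 0 <= a * (c * a - b ^+ 2) by nra.
  by rewrite pmulr_rge0// subr_ge0.
rewrite gg0 mulr0.
have [->|fg0] := eqVneq (ip f g) 0; first by rewrite expr0n.
have := key 1 ((ip f f + 1) / (2 * ip f g)); rewrite gg0 mulr0 addr0.
have -> : 2 * 1 * ((ip f f + 1) / (2 * ip f g)) * ip f g = ip f f + 1 by field.
by lra.
Qed.

Definition seminorm f := Num.sqrt (ip f f).

Lemma ip_le f g : S f -> S g -> `|ip f g| <= seminorm f * seminorm g.
Proof.
move=> Sf Sg; rewrite -sqrtrM ?ip_ge0// -sqrtr_sqr ler_sqrt ?ip_cauchy_schwarz//.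
by rewrite mulr_ge0 ?ip_ge0.
Qed.

Lemma ipn_ge0 f : 0 <= seminorm f. Proof. exact: sqrtr_ge0. Qed.

Lemma sqr_ipn f : S f -> seminorm f ^+ 2 = ip f f.
Proof. by move=> Sf; rewrite sqr_sqrtr ?ip_ge0. Qed.

Lemma ipn0 : seminorm 0 = 0.
Proof. by rewrite /seminorm ip0l// sqrtr0. Qed.

Lemma ipnZ a f : S f -> seminorm (a *: f) = `|a| * seminorm f.
Proof.
move=> Sf; rewrite /seminorm ipZl ?ipZr//; last exact: SZ.
by rewrite mulrA -expr2 sqrtrM ?sqr_ge0// sqrtr_sqr.
Qed.

Lemma ipnN f : S f -> seminorm (- f) = seminorm f.
Proof. by move=> Sf; rewrite -scaleN1r ipnZ// normrN1 mul1r. Qed.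

Lemma ipnD f g : S f -> S g -> seminorm (f + g) <= seminorm f + seminorm g.
Proof.
move=> Sf Sg; rewrite -ler_sqr ?nnegrE ?addr_ge0 ?ipn_ge0//.
rewrite sqr_ipn ?sqrrD ?sqr_ipn//; last exact: SD.
have := ip_le Sf Sg; rewrite ler_norml => /andP[_].
by rewrite ipDl ?ipDr// ?(ipC g f); [lra|exact: SD].
Qed.

Lemma ipn_sum (I : Type) (r : seq I) (f : I -> V) :
  (forall i, S (f i)) -> seminorm (\sum_(i <- r) f i) <= \sum_(i <- r) seminorm (f i).
Proof.
move=> Sf; elim: r => [|i r IH]; first by rewrite !big_nil ipn0.
by rewrite !big_cons (le_trans (ipnD _ _))// ?lerD2l//; exact: S_sum.
Qed.

(** Compare [v] with the combination of the [e i] with coefficients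
    [ip v (e i) / (K + 1)]; dividing by [K + 1] and not by [K] allows [K = 0],
    when the [e i] have length zero. *)
Lemma bessel (e : nat -> V) (K : R) v n : S v -> (forall i, S (e i)) ->
  (forall i j, ip (e i) (e j) = (i == j)%:R * K) ->
  \sum_(i < n) ip v (e i) ^+ 2 <= (K + 1) * ip v v.
Proof.
move=> Sv Se eK.
have K0 : 0 <= K by have := ip_ge0 (Se 0%N); rewrite eK eqxx mul1r.
set A := \sum_(i < n) _.
have A0 : 0 <= A by apply: sumr_ge0 => i _; exact: sqr_ge0.
pose s := (K + 1)^-1.
pose w := \sum_(i < n) (s * ip v (e i)) *: e i.
have Sw : S w by apply: S_sum => i; exact: SZ.
have wv : ip v w = s * A.
  rewrite ip_sumr//; last by move=> i; exact: SZ.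
  by rewrite mulr_sumr; apply: eq_bigr => i _; rewrite ipZr// expr2 mulrA.
have ww : ip w w = s ^+ 2 * K * A.
  rewrite ip_suml//; last by move=> i; exact: SZ.
  rewrite mulr_sumr; apply: eq_bigr => i _; rewrite ipZl//.
  rewrite ip_sumr//; last by move=> j; exact: SZ.
  rewrite (bigD1 i)//= big1 ?addr0 => [|j ji].
    by rewrite ipZr// eK eqxx mul1r expr2; ring.
  rewrite ipZr// eK [_ == _](_ : _ = false) ?mul0r ?mulr0//.
  by apply: negbTE; rewrite eq_sym.
have := ip_ge0 (SB Sv Sw); rewrite ipBl ?ipBr//; last exact: SB.
rewrite (ipC w v) wv ww => HH.
have sK : s * (K + 1) = 1 by rewrite mulVf// gt_eqF// ltr_wpDl.
have s0 : 0 < s by rewrite invr_gt0 ltr_wpDl.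
have sA : s * A <= ip v v.
  have sA0 : 0 <= s * A * s by rewrite !mulr_ge0// ltW.
  have E : s ^+ 2 * K * A = s * A - s * A * s.
    rewrite (_ : s ^+ 2 * K * A = s * A * (s * (K + 1) - s)); last by ring.
    by rewrite sK; ring.
  by move: HH; rewrite E; lra.
by rewrite mulrC -ler_pdivrMr ?ltr_wpDl// mulrC.
Qed.

End SemiInner.

(** * Mean-square geometry of square-integrable variables *)

Section BoundedSums.
Variable R : realType.

Lemma cvg_bounded_sum (a : nat -> R) M : (forall k, 0 <= a k) ->
  (forall n, \sum_(k < n) a k <= M) -> cvgn (series a).
Proof.
move=> a0 aM; apply: nondecreasing_is_cvgn.
  by apply/nondecreasing_seqP => n; rewrite /series/= !big_mkord big_ord_recr/= lerDl.
by exists M => _ [n _ <-]; rewrite seriesEord; exact: aM.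
Qed.

Lemma cvg0_bounded_sum (a : nat -> R) M : (forall k, 0 <= a k) ->
  (forall n, \sum_(k < n) a k <= M) -> a n @[n --> \oo] --> 0.
Proof. by move=> a0 /(cvg_bounded_sum a0)/cvg_series_cvg_0. Qed.

Lemma cvg0_bounded_sqsum (a : nat -> R) M :
  (forall n, \sum_(k < n) a k ^+ 2 <= M) -> a n @[n --> \oo] --> 0.
Proof.
move=> /(cvg0_bounded_sum (fun k => sqr_ge0 (a k))) h.
apply: norm_cvg0; rewrite -(@sqrtr0 R).
rewrite (_ : (fun n => `|a n|) = (fun n => Num.sqrt (a n ^+ 2))); last first.
  by apply/funext => n; rewrite sqrtr_sqr.
by apply: continuous_cvg => //; exact: sqrt_continuous.
Qed.

End BoundedSums.

Section L2.
Context (disp : measure_display) (T : measurableType disp) (R : realType).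
Variable P : probability T R.
Implicit Types f g : T -> R.

Definition L2 f : Prop := f \in Lfun P 2%:E.

Lemma L2_measurable f : L2 f -> measurable_fun setT f.
Proof. by move=> /sub_Lfun_mfun; rewrite inE. Qed.

Lemma L2P f : L2 f <-> measurable_fun setT f /\ (expectation P (fun w => f w ^+ 2)%R < +oo)%E.
Proof.
split=> [f2|[mf fle]].
  split; first exact: L2_measurable.
  have mf2 : measurable_fun setT (fun w => f w ^+ 2).
    by apply: measurable_funX; exact: L2_measurable.
  have /integrableP[_] := Lfun2_integrable_sqr f2; apply: le_lt_trans.
  rewrite unlock; apply: ge0_le_integral => //=.
  - by move=> w _; rewrite lee_fin sqr_ge0.
  - exact/measurable_EFinP.
  - by apply: measurableT_comp => //; apply: measurableT_comp.
  - by move=> w _; rewrite lee_fin ler_norm.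
rewrite /L2 inE; apply/andP; split; first by rewrite inE.
rewrite inE /= /finite_norm unlock.
apply: poweR_lty; move: fle; rewrite unlock; apply: le_lt_trans.
rewrite le_eqVlt; apply/orP; left; apply/eqP.
by apply: eq_integral => w _; rewrite /= powR_mulrn// real_normK// num_real.
Qed.

Lemma L2_0 : L2 0.
Proof. by rewrite /L2 rpred0// lee1n. Qed.

Lemma L2D f g : L2 f -> L2 g -> L2 (f + g).
Proof. by move=> ? ?; rewrite /L2 rpredD ?lee1n. Qed.

Lemma L2Z a f : L2 f -> L2 (a *: f).
Proof. by move=> ?; rewrite /L2 rpredZ ?lee1n. Qed.

Lemma L2_cst a : L2 (cst a).
Proof. exact: Lfun_cst. Qed.

Lemma L2_sub1 f : L2 f -> f \in Lfun P 1.
Proof. by apply: Lfun_subset12; rewrite fin_num_measure. Qed.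

Definition ip f g := fine (expectation P (f \* g)).

Lemma ipE f g : L2 f -> L2 g -> expectation P (f \* g) = (ip f g)%:E.
Proof. by move=> *; rewrite fineK// expectation_fin_num// Lfun2_mul_Lfun1. Qed.

Lemma ipC f g : ip f g = ip g f.
Proof. by congr fine; congr expectation; apply/funext => w /=; rewrite mulrC. Qed.

Lemma ipDl f g h : L2 f -> L2 g -> L2 h -> ip (f + g) h = ip f h + ip g h.
Proof.
move=> f2 g2 h2; apply: EFin_inj; rewrite EFinD -!ipE//; last exact: L2D.
rewrite -expectationD ?Lfun2_mul_Lfun1//; congr expectation.
by apply/funext => w /=; rewrite mulrDl.
Qed.

Lemma ipZl a f g : L2 f -> L2 g -> ip (a *: f) g = a * ip f g.
Proof.
move=> f2 g2; apply: EFin_inj; rewrite EFinM -!ipE//; last exact: L2Z.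
rewrite -expectationZl ?Lfun2_mul_Lfun1//; congr expectation.
by apply/funext => w /=; rewrite -[(a *: f) w]/(a * f w); ring.
Qed.

Lemma ip_ge0 f : L2 f -> 0 <= ip f f.
Proof.
by move=> _; apply: fine_ge0; apply: expectation_ge0 => w; exact: sqr_ge0.
Qed.

Lemma L2_semi_inner : semi_inner L2 ip.
Proof. by split; [exact: L2_0|exact: L2D|exact: L2Z|exact: ipC|exact: ipDl|exact: ipZl|exact: ip_ge0]. Qed.
Local Notation L2i := L2_semi_inner.

Local Notation ipn := (seminorm ip).

Lemma L2_sum (I : Type) (r : seq I) (f : I -> T -> R) :
  (forall i, L2 (f i)) -> L2 (\sum_(i <- r) f i).
Proof. exact: (S_sum L2i). Qed.

Lemma L2N f : L2 f -> L2 (- f).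
Proof. exact: (SN L2i). Qed.

Lemma L2B f g : L2 f -> L2 g -> L2 (f - g).
Proof. exact: (SB L2i). Qed.

Lemma sqr_ipnE f : L2 f -> expectation P (fun w => f w ^+ 2) = (ipn f ^+ 2)%:E.
Proof.
by move=> f2; rewrite (sqr_ipn L2i)// -ipE.
Qed.

Lemma ipn_cst1 : ipn (cst 1) = 1.
Proof.
rewrite /seminorm (_ : ip _ _ = 1) ?sqrtr1//; apply: EFin_inj.
rewrite -ipE; try exact: L2_cst.
rewrite (_ : _ \* _ = cst 1) ?expectation_cst//.
by apply/funext => w /=; rewrite mulr1.
Qed.

Lemma ip1E f : L2 f -> expectation P f = (ip f (cst 1))%:E.
Proof.
move=> f2; rewrite -ipE//; last exact: L2_cst.
by congr expectation; apply/funext => w /=; rewrite mulr1.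
Qed.

Lemma covE f g : L2 f -> L2 g ->
  covariance P f g = (ip f g - ip f (cst 1) * ip g (cst 1))%:E.
Proof.
move=> f2 g2; rewrite (covarianceE (L2_sub1 f2) (L2_sub1 g2))//; last exact: Lfun2_mul_Lfun1.
by rewrite (ip1E f2) (ip1E g2) -[(f * g)%R]/(f \* g) ipE// -EFinM -EFinB.
Qed.

Lemma ipn0_ae f : L2 f -> ipn f = 0 -> \forall w \ae P, f w = 0.
Proof.
move=> f2 f0; have mf := L2_measurable f2.
have : (\int[P]_w `|(f w ^+ 2)%:E| = 0)%E.
  have := sqr_ipnE f2; rewrite f0 expr0n/= unlock => E0; rewrite -[RHS]E0.
  by apply: eq_integral => w _; rewrite /= ger0_norm// sqr_ge0.
have mf2 : measurable_fun setT (fun w => (f w ^+ 2)%:E).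
  by apply/measurable_EFinP; exact: measurable_funX.
move/(ae_eq_integral_abs _ measurableT mf2).
by apply: filterS => w /(_ I)/= [] /eqP; rewrite sqrf_eq0 => /eqP.
Qed.

Lemma ipn_ae f g : L2 f -> L2 g -> (\forall w \ae P, f w = g w) -> ipn (f - g) = 0.
Proof.
move=> f2 g2 fg; suff : (ipn (f - g) ^+ 2)%:E = 0%E :> \bar R.
  by case=> /eqP; rewrite sqrf_eq0 => /eqP.
rewrite -sqr_ipnE; last exact: L2B.
rewrite unlock (ae_eq_integral (cst 0%E)) ?integral0//.
  apply/measurable_EFinP/measurable_funX; exact: (L2_measurable (L2B f2 g2)).
by apply: filterS fg => w fgw _; rewrite /= -[(f - g) w]/(f w - g w) fgw subrr expr0n.
Qed.

(** Completeness of L2, for absolutely convergent series. The series of absolute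
    values has a finite integral, hence converges almost surely; Fatou's lemma
    turns the pointwise sum into a sum in mean square. *)
Lemma L2_series (v : nat -> T -> R) M : (forall k, L2 (v k)) ->
  (forall n, \sum_(k < n) ipn (v k) <= M) ->
  exists2 Y, L2 Y & ipn (Y - \sum_(k < n) v k) @[n --> \oo] --> 0.
Proof.
move=> v2 vM.
pose G (w : T) : \bar R := (\sum_(k <oo) `|v k w|%:E)%E.
have mv k : measurable_fun setT (v k) by exact: L2_measurable.
have mG : measurable_fun setT G.
  apply: (@ge0_emeasurable_sum _ _ _ _ (fun k w => `|v k w|%:E) xpredT) => // k _.
  by apply/measurable_EFinP; exact: measurableT_comp.
have av2 k : L2 (fun w => `|v k w|).
  apply/L2P; split; first exact: measurableT_comp.
  have -> : (fun w => `|v k w| ^+ 2) = (fun w => v k w ^+ 2).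
    by apply/funext => w; rewrite real_normK// num_real.
  by have /L2P[] := v2 k.
have iG : (\int[P]_w G w < +oo)%E.
  rewrite /G integral_nneseries//; last first.
    by move=> k; apply/measurable_EFinP; exact: measurableT_comp.
  apply: (@le_lt_trans _ _ M%:E); last exact: ltry.
  apply: lime_le; first by apply: is_cvg_nneseries => k _ _; exact: integral_ge0.
  apply: nearW => n; apply: le_trans (_ : (\sum_(k < n) ipn (v k))%:E <= _)%E; last by rewrite lee_fin.
  rewrite big_mkord -sumEFin; apply: lee_sum => k _.
  have -> : (\int[P]_w `|v k w|%:E)%E = expectation P (fun w => `|v k w|).
    by rewrite unlock.
  rewrite ip1E// lee_fin (le_trans (ler_norm _))//.
  rewrite (le_trans (ip_le L2i _ _))//; first exact: L2_cst.
  rewrite ipn_cst1 mulr1 /seminorm (_ : ip _ _ = ip (v k) (v k))//.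
  congr fine; congr expectation; apply/funext => w /=.
  by rewrite -normrM ger0_norm// -expr2 sqr_ge0.
pose A := [set w | G w < +oo]%E.
have G0 w : (0 <= G w)%E by apply: nneseries_ge0 => k _ _; rewrite lee_fin.
have mA : measurable A.
  by have := emeasurable_fun_infty_o measurableT mG +oo%E; rewrite setTI.
have aeA : \forall w \ae P, A w.
  have /integrable_ae : P.-integrable setT G.
    apply/integrableP; split => //.
    by rewrite (eq_integral G) => [|w _]; [exact: iG|rewrite gee0_abs].
  move=> /(_ measurableT); apply: filterS => w /(_ I).
  by rewrite ge0_fin_numE.
(* The partial sums are set to zero on the null set where the series of absolute
   values diverges, so that they converge at every outcome. *)
pose s n w := \sum_(k < n) v k w.
pose f n w := s n w * \1_A w.
have cf w : cvgn (fun n => f n w).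
  have [Aw|nAw] := pselect (A w); last first.
    have -> : (fun n => f n w) = cst 0.
      by apply/funext => n; rewrite /f indicE memNset// mulr0.
    exact: is_cvg_cst.
  rewrite (_ : (fun n => f n w) = series (fun k => v k w)); last first.
    by apply/funext => n; rewrite /f indicE mem_set// mulr1 /series/= big_mkord.
  apply: normed_cvg; apply: (@cvg_bounded_sum _ _ (fine (G w))) => n /=; first exact: normr_ge0.
  rewrite -lee_fin fineK ?ge0_fin_numE// -sumEFin.
  rewrite -(big_mkord xpredT (fun k => `|v k w|%:E)).
  by apply: nneseries_lim_ge => k _ _; rewrite lee_fin.
pose Y w := limn (fun n => f n w).
have mf n : measurable_fun setT (f n).
  apply: measurable_funM; last exact: measurable_indic.
  rewrite (_ : s n = \sum_(k < n) v k); first exact/L2_measurable/L2_sum.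
  by apply/funext => w; rewrite fct_sumE.
have mY : measurable_fun setT Y by apply: (measurable_fun_cvg mf) => w _; exact: cf.
have sN n : s n = \sum_(k < n) v k by apply/funext => w; rewrite fct_sumE.
have s2 n : L2 (s n) by rewrite sN; exact: L2_sum.
have sn (n m : nat) : (n <= m)%N -> ipn (s m - s n) <= \sum_(n <= k < m) ipn (v k).
  move=> nm; rewrite !sN.
  have -> : \sum_(k < m) v k = \sum_(k < n) v k + \sum_(n <= k < m) v k.
    by rewrite -!(big_mkord xpredT v) -big_cat_nat.
  rewrite addrAC subrr add0r.
  by rewrite (le_trans (ipn_sum L2i _ _)).
have /cvg_ex[/= L cL] : cvgn (series (fun k => ipn (v k))).
  apply: (@cvg_bounded_sum _ _ M) => // k; exact: ipn_ge0.
pose t n := L - series (fun k => ipn (v k)) n.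
have nd : nondecreasing_seq (series (fun k => ipn (v k))).
  by apply/nondecreasing_seqP => n; rewrite /series/= big_nat_recr//= lerDl ipn_ge0.
have tn n m : (n <= m)%N -> \sum_(n <= k < m) ipn (v k) <= t n.
  move=> nm; rewrite /t lerBrDr /series/= addrC -big_cat_nat//=.
  by have := nondecreasing_cvgn_le nd (cvgP _ cL) m; rewrite (cvg_lim _ cL).
have t0 n : 0 <= t n by apply: le_trans (tn n n _) => //; rewrite big_geq.
have EY n : (expectation P (fun w => (Y w - s n w) ^+ 2)%R <= (t n ^+ 2)%:E)%E.
  have -> : expectation P (fun w => (Y w - s n w) ^+ 2) =
      (\int[P]_w limn_einf (fun m => ((f m w - f n w) ^+ 2)%:E))%E.
    rewrite unlock; transitivity (\int[P]_w ((Y w - f n w) ^+ 2)%:E)%E.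
      apply: ae_eq_integral => //.
      - apply/measurable_EFinP; apply: measurable_funX; apply: measurable_funB => //.
        exact: L2_measurable.
      - by apply/measurable_EFinP; apply: measurable_funX; exact: measurable_funB.
      by apply: filterS aeA => w Aw _; rewrite /f indicE mem_set// mulr1.
    apply: eq_integral => w _; apply/esym.
    apply: (cvg_limn_einf_sup _).1; apply: cvg_EFin; first exact: nearW.
    by apply: cvgM; (apply: cvgB; [exact: cf|exact: cvg_cst]).
  apply: (le_trans (fatou P measurableT _ _)).
  - by move=> m; apply/measurable_EFinP; apply: measurable_funX; exact: measurable_funB.
  - by move=> m w _; rewrite lee_fin sqr_ge0.
  apply: (le_trans (limn_einf_sup _)).
  rewrite limn_esup_lim; apply: lime_le; first exact: is_cvg_esups.
  (* It remains to bound the integrals of Fatou's lemma by the tail of the sum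
     of the norms, for all large m. *)
  near=> m0; apply: ge_ereal_sup => _ [m /= m0m <-].
  have nm : (n <= m)%N by apply: leq_trans m0m; near: m0; exact: nbhs_infty_ge.
  apply: (@le_trans _ _ (expectation P (fun w => (s m - s n) w ^+ 2))).
    rewrite unlock; apply: ge0_le_integral => //.
    - by move=> w _; rewrite lee_fin sqr_ge0.
    - by apply/measurable_EFinP; apply: measurable_funX; exact: measurable_funB.
    - by apply/measurable_EFinP; apply: measurable_funX; exact/L2_measurable/L2B.
    - move=> w _; rewrite lee_fin /f -mulrBl exprMn indicE.
      by case: (_ \in _); rewrite ?expr1n ?mulr1// expr0n mulr0 sqr_ge0.
  rewrite sqr_ipnE; last exact: L2B.
  by rewrite lee_fin ler_sqr ?nnegrE ?ipn_ge0// (le_trans (sn _ _ nm))// tn.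
have Y2 : L2 Y.
  apply/L2P; split => //; apply: le_lt_trans (ltry (t 0%N ^+ 2)).
  apply: le_trans (EY 0%N); rewrite le_eqVlt; apply/orP; left; apply/eqP.
  by congr expectation; apply/funext => w; rewrite /s big_ord0 subr0.
exists Y => //.
have tto0 : t n @[n --> \oo] --> 0.
  by rewrite -(subrr L); apply: cvgB => //; exact: cvg_cst.
apply: (squeeze_cvgr _ (cvg_cst 0) tto0); apply: nearW => n.
rewrite ipn_ge0 -ler_sqr ?nnegrE ?ipn_ge0//= -lee_fin -sqr_ipnE.
  by rewrite -sN; exact: EY.
by rewrite -sN; exact: L2B.
Unshelve. all: by end_near.
Qed.

End L2.

(** * Lag polynomials and mean-square filters *)

Section ScalarLag.
Variable R : realType.
Implicit Types (p q : {poly R}) (x y : int -> R) (t : int).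

(** The scalar case of [lag_filter], at a single outcome. *)
Definition slag p x t := \sum_(k < size p) p`_k * x (t - k%:Z).

Lemma slagE n p x t : (size p <= n)%N ->
  slag p x t = \sum_(k < n) p`_k * x (t - k%:Z).
Proof.
move=> pn; rewrite /slag (big_ord_widen n (fun k => p`_k * x (t - k%:Z)))//.
rewrite [RHS](bigID (fun k : 'I_n => (k < size p)%N))/= [X in _ + X]big1 ?addr0//.
by move=> k; rewrite -leqNgt => /(nth_default 0)->; rewrite mul0r.
Qed.

Lemma slagD p q x t : slag (p + q) x t = slag p x t + slag q x t.
Proof.
have le1 := leq_maxl (size p) (size q); have le2 := leq_maxr (size p) (size q).
rewrite (slagE _ _ (size_polyD p q)) (slagE _ _ le1) (slagE _ _ le2) -big_split.
by apply: eq_bigr => k _; rewrite coefD mulrDl.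
Qed.

Lemma slagZ a p x t : slag (a *: p) x t = a * slag p x t.
Proof.
rewrite (slagE _ _ (size_scale_leq a p)) mulr_sumr.
by apply: eq_bigr => k _; rewrite coefZ mulrA.
Qed.

Lemma slag0 x t : slag 0 x t = 0.
Proof. by rewrite /slag size_poly0 big_ord0. Qed.

Lemma slag_sum (I : finType) (p : I -> {poly R}) x t :
  slag (\sum_i p i) x t = \sum_i slag (p i) x t.
Proof.
by apply: (big_morph (fun p => slag p x t)) => [q r|]; rewrite ?slagD ?slag0.
Qed.

Lemma slagC a x t : slag a%:P x t = a * x t.
Proof.
by rewrite (slagE _ _ (size_polyC_leq1 a)) big_ord1 coefC eqxx subr0.
Qed.

Lemma slag1 x t : slag 1 x t = x t.
Proof. by rewrite -[1]/(1%:P) slagC mul1r. Qed.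

Lemma slagMX p x t : slag (p * 'X) x t = slag p x (t - 1).
Proof.
have le : (size (p * 'X)%R <= (size p).+1)%N.
  by have [->|p0] := eqVneq p 0; rewrite ?mul0r ?size_poly0// size_mulX.
rewrite (slagE _ _ le) big_ord_recl coefMX/= mul0r add0r.
apply: eq_bigr => k _; rewrite coefMX/=; congr (_ * x _).
by rewrite /bump/= add1n -addn1 PoszD opprD [- _ - 1]addrC addrA.
Qed.

Lemma slag_sumr (I : finType) p (x : I -> int -> R) t :
  slag p (fun s => \sum_i x i s) t = \sum_i slag p (x i) t.
Proof.
by rewrite exchange_big; apply: eq_bigr => k _; rewrite mulr_sumr.
Qed.

Lemma slagM p q x t : slag (p * q) x t = slag p (slag q x) t.
Proof.
elim/poly_ind: p t => [|p c IH] t; first by rewrite mul0r !slag0.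
rewrite mulrDl !slagD mul_polyC slagZ slagC; congr (_ + _).
by rewrite mulrAC !slagMX IH.
Qed.

End ScalarLag.

Section Lag.
Context (disp : measure_display) (T : measurableType disp) (R : realType).

Lemma lag_filterE m n (A : 'M[{poly R}]_(m, n)) (X : process T R n) t w i :
  lag_filter A X t w i ord0 = \sum_j slag (A i j) (fun s => X s w j ord0) t.
Proof. by rewrite mxE. Qed.

(** Lag polynomials form a commutative ring of operators, over which filters
    compose as matrices. *)
Lemma lag_filterM m n o (A : 'M[{poly R}]_(m, n)) (B : 'M[{poly R}]_(n, o))
    (X : process T R o) :
  lag_filter (A *m B) X = lag_filter A (lag_filter B X).
Proof.
apply/funext => t; apply/funext => w; apply/colP => i; rewrite !lag_filterE.
under eq_bigr do rewrite mxE slag_sum.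
rewrite exchange_big; apply: eq_bigr => o' _ /=.
under [in RHS]eq_fun => s do rewrite mxE.
rewrite -[X in slag _ X]/(fun s => \sum_j slag (B o' j) (fun s => X s w j ord0) s).
by rewrite slag_sumr; apply: eq_bigr => l _; rewrite slagM.
Qed.

Lemma lag_filterD m n (A B : 'M[{poly R}]_(m, n)) (X : process T R n) t w :
  lag_filter (A + B) X t w = lag_filter A X t w + lag_filter B X t w.
Proof.
apply/colP => i; rewrite lag_filterE [RHS]mxE !lag_filterE -big_split.
by apply: eq_bigr => j _; rewrite mxE slagD.
Qed.

Lemma lag_filter_const m n (A : 'M[R]_(m, n)) (X : process T R n) t w :
  lag_filter (const_mxp A) X t w = A *m X t w.
Proof.
apply/colP => i; rewrite lag_filterE mxE.
by apply: eq_bigr => j _; rewrite mxE slagC.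
Qed.

Lemma lag_filter_X n (X : process T R n) t w :
  lag_filter ('X)%:M X t w = X (t - 1) w.
Proof.
apply/colP => i; rewrite lag_filterE (bigD1 i)//= big1 => [|j ji]; last first.
  by rewrite mxE eq_sym (negbTE ji) slag0.
by rewrite mxE eqxx -['X]mul1r addr0 slagMX slagC mul1r.
Qed.

Lemma lag_filter_diff n (X : process T R n) :
  lag_filter (1 - 'X)%:M X = diff_process X.
Proof.
apply/funext => t; apply/funext => w; apply/colP => i.
rewrite lag_filterE (bigD1 i)//= big1 => [|j ji]; last first.
  by rewrite mxE eq_sym (negbTE ji) slag0.
rewrite mxE eqxx addr0 slagD -scaleN1r slagZ -['X]mul1r slagMX !slag1.
by rewrite mulN1r /diff_process !mxE.
Qed.

(** A common bound on the degrees of the entries makes a filter a sum of matrix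
    multiples of lagged processes. *)
Lemma lag_filter_coef m n (A : 'M[{poly R}]_(m, n)) :
  exists2 N, forall k, (N <= k)%N -> coef_mxp A k = 0 &
  forall (X : process T R n) t w,
  lag_filter A X t w = \sum_(k < N) coef_mxp A k *m X (t - k%:Z) w.
Proof.
have ij i j : (size (A i j) <= \max_i \max_j size (A i j))%N.
  apply: (@leq_trans (\max_j size (A i j))).
    exact: (@leq_bigmax _ (fun j => size (A i j)) j).
  exact: (@leq_bigmax _ (fun i => \max_j size (A i j))%N i).
exists (\max_i \max_j size (A i j))%N => [k Nk|X t w].
  by apply/matrixP => i j; rewrite !mxE nth_default// (leq_trans (ij i j)).
apply/colP => i; rewrite lag_filterE summxE.
rewrite (eq_bigr _ (fun j _ => slagE _ _ (ij i j))).
rewrite exchange_big; apply: eq_bigr => k _; rewrite mxE.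
by apply: eq_bigr => j _; rewrite mxE.
Qed.

End Lag.

Section NullSequences.
Variable R : realType.
Implicit Types a b : nat -> R.

Lemma cvg0_le a b : (forall n, 0 <= a n <= b n) ->
  b n @[n --> \oo] --> 0 -> a n @[n --> \oo] --> 0.
Proof. by move=> ab b0; apply: squeeze_cvgr (cvg_cst 0) b0; exact: nearW. Qed.

Lemma cvg0D a b : a n @[n --> \oo] --> 0 -> b n @[n --> \oo] --> 0 ->
  a n + b n @[n --> \oo] --> 0.
Proof. by move=> ha hb; rewrite -(addr0 0); exact: cvgD. Qed.

Lemma cvg0_sum (I : Type) (r : seq I) (a : I -> nat -> R) :
  (forall i, a i n @[n --> \oo] --> 0) -> \sum_(i <- r) a i n @[n --> \oo] --> 0.
Proof.
move=> h; elim: r => [|i r IH].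
  by under eq_fun do rewrite big_nil; exact: cvg_cst.
under eq_fun do rewrite big_cons.
exact: (cvg0D (h i) IH).
Qed.

Lemma cvg0Z c a : a n @[n --> \oo] --> 0 -> c * a n @[n --> \oo] --> 0.
Proof. by move=> h; rewrite -(mulr0 c); apply: cvgM h; exact: cvg_cst. Qed.

End NullSequences.

Section Filter.
Context (disp : measure_display) (T : measurableType disp) (R : realType).
Variable P : probability T R.

Local Notation process := (process T R).
Local Notation ipn := (seminorm (ip P)).
Local Notation L2i := (L2_semi_inner P).

(** Written as a combination of random variables, so that the seminorm applies
    to it. *)
Definition partial_filter m n (B : nat -> 'M[R]_(m, n)) (X : process n) t i N :
    T -> R :=
  \sum_(k < N) \sum_j B k i j *: coordp X (t - k%:Z) j.

Lemma L2_partial_filter m n (B : nat -> 'M[R]_(m, n)) (X : process n) t i N :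
  L2_process P X -> L2 P (partial_filter B X t i N).
Proof. by move=> X2; apply: L2_sum => k; apply: L2_sum => j; exact/L2Z/X2. Qed.

Lemma partial_filterE m n (B : nat -> 'M[R]_(m, n)) (X : process n) t i N w :
  partial_filter B X t i N w = (\sum_(k < N) B k *m X (t - k%:Z) w) i ord0.
Proof.
rewrite /partial_filter fct_sumE summxE; apply: eq_bigr => k _.
by rewrite fct_sumE mxE.
Qed.

(** Replaces the expectation of a square by the seminorm, for which the triangle
    inequality holds. *)
Lemma L2_filterP m n (B : nat -> 'M[R]_(m, n)) (X : process n) (Y : process m) :
  L2_process P X -> L2_process P Y ->
  L2_filter P B X Y <->
  forall t i, ipn (coordp Y t i - partial_filter B X t i N) @[N --> \oo] --> 0.
Proof.
move=> X2 Y2.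
have E t i N : expectation P (fun w => (Y t w i ord0
       - (\sum_(k < N) B k *m X (t - k%:Z) w) i ord0) ^+ 2) =
    (ipn (coordp Y t i - partial_filter B X t i N) ^+ 2)%:E.
  rewrite -sqr_ipnE; last by apply: L2B; [exact: Y2|exact: L2_partial_filter].
  by congr expectation; apply/funext => w; rewrite -partial_filterE.
split=> h t i.
  have := h t i; under eq_fun do rewrite E.
  move=> /fine_cvg/= => c.
  rewrite (_ : (fun N => _) = (fun N => Num.sqrt (ipn (coordp Y t i - partial_filter B X t i N) ^+ 2))).
    rewrite -(@sqrtr0 R).
    by apply: continuous_cvg => //; exact: sqrt_continuous.
  by apply/funext => N; rewrite sqrtr_sqr ger0_norm// ipn_ge0.
under eq_fun do rewrite E.
apply: cvg_EFin; first exact: nearW.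
by rewrite -(mulr0 0); apply: cvgM; exact: h.
Qed.

Lemma L2_filter_ext m n (B B' : nat -> 'M[R]_(m, n)) (X : process n) (Y Y' : process m) :
  B =1 B' -> Y = Y' -> L2_filter P B X Y -> L2_filter P B' X Y'.
Proof. by move=> /funext -> ->. Qed.

Lemma L2_filterD m n (B B' : nat -> 'M[R]_(m, n)) (X : process n) (Y Y' : process m) :
  L2_process P X -> L2_process P Y -> L2_process P Y' ->
  L2_filter P B X Y -> L2_filter P B' X Y' ->
  L2_filter P (fun k => B k + B' k) X (fun t w => Y t w + Y' t w).
Proof.
move=> X2 Y2 Y'2.
have D2 : L2_process P (fun t w => Y t w + Y' t w).
  move=> t i; rewrite (_ : coordp _ t i = coordp Y t i + coordp Y' t i).
    by apply: L2D; [exact: Y2|exact: Y'2].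
  by apply/funext => w; rewrite /coordp mxE.
move=> /(L2_filterP _ X2 Y2) h /(L2_filterP _ X2 Y'2) h'; apply/L2_filterP => // t i.
apply: cvg0_le (cvg0D (h t i) (h' t i)) => N.
rewrite ipn_ge0/= (_ : _ - _ = (coordp Y t i - partial_filter B X t i N) +
  (coordp Y' t i - partial_filter B' X t i N)).
  by apply: (ipnD L2i); apply: L2B; first [exact: L2_partial_filter|exact: Y2|exact: Y'2].
rewrite addrACA -opprD; congr (_ - _).
  by apply/funext => w; rewrite /coordp mxE.
rewrite -big_split; apply: eq_bigr => k _; rewrite -big_split; apply: eq_bigr => j _.
by rewrite mxE scalerDl.
Qed.

Lemma L2_mul_process m n (A : 'M[R]_(m, n)) (X : process n) :
  L2_process P X -> L2_process P (mul_process A X).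
Proof.
move=> X2 t i; rewrite (_ : coordp _ t i = \sum_j A i j *: coordp X t j).
  by apply: L2_sum => j; exact/L2Z/X2.
by apply/funext => w; rewrite /coordp mxE fct_sumE.
Qed.

Lemma L2_filter_mul m n o (A : 'M[R]_(o, m)) (B : nat -> 'M[R]_(m, n))
    (X : process n) (Y : process m) :
  L2_process P X -> L2_process P Y -> L2_filter P B X Y ->
  L2_filter P (fun k => A *m B k) X (mul_process A Y).
Proof.
move=> X2 Y2 /(L2_filterP _ X2 Y2) h.
apply/L2_filterP => // [|t i]; first exact: L2_mul_process.
have := cvg0_sum (index_enum 'I_m) (fun j => cvg0Z `|A i j| (h t j)).
apply: cvg0_le => N; rewrite ipn_ge0/=.
have D2 j : L2 P (coordp Y t j - partial_filter B X t j N).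
  by apply: L2B; [exact: Y2|exact: L2_partial_filter].
rewrite (_ : _ - _ = \sum_j A i j *: (coordp Y t j - partial_filter B X t j N)).
  apply: le_trans (ipn_sum L2i _ _) _; first by move=> j; exact: L2Z.
  by apply: ler_sum => j _; rewrite (ipnZ L2i).
apply/funext => w; rewrite -[LHS]/(coordp _ t i w - partial_filter _ _ _ _ _ w).
rewrite partial_filterE /coordp mxE fct_sumE.
rewrite [in RHS](eq_bigr (fun j => A i j * (Y t w j ord0 - partial_filter B X t j N w)))//.
under [in RHS]eq_bigr do rewrite partial_filterE mulrBr.
rewrite sumrB; congr (_ - _).
under eq_bigr do rewrite -mulmxA.
by rewrite -mulmx_sumr mxE.
Qed.

Definition shift_seq m n (B : nat -> 'M[R]_(m, n)) j k : 'M[R]_(m, n) :=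
  if (j <= k)%N then B (k - j)%N else 0.

Lemma L2_filter_shift m n (B : nat -> 'M[R]_(m, n)) (X : process n) (Y : process m) j :
  L2_process P X -> L2_process P Y -> L2_filter P B X Y ->
  L2_filter P (shift_seq B j) X (fun t => Y (t - j%:Z)).
Proof.
move=> X2 Y2 /(L2_filterP _ X2 Y2) h.
apply/L2_filterP => // [? ?|t i]; first exact: Y2.
rewrite -(cvg_shiftn j); apply: cvg0_le (h (t - j%:Z) i) => N.
rewrite ipn_ge0/= le_eqVlt; apply/orP; left; apply/eqP; congr (ipn (_ - _)).
rewrite /partial_filter addnC big_split_ord/= big1 ?add0r => [|k _]; last first.
  apply: big1 => l _.
  by rewrite /shift_seq leqNgt ltn_ord/= mxE scale0r.
apply: eq_bigr => k _; apply: eq_bigr => l _.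
rewrite /shift_seq leq_addr addKn; congr (_ *: coordp X _ l).
by rewrite PoszD opprD addrA.
Qed.

Lemma L2_filter0 m n (X : process n) :
  L2_process P X -> L2_filter P (fun=> 0) X (fun _ _ => 0 : 'cV[R]_m).
Proof.
move=> X2; apply/L2_filterP => // [t i|t i].
  rewrite (_ : coordp _ _ _ = cst 0); first exact: L2_cst.
  by apply/funext => w; rewrite /coordp mxE.
rewrite (_ : (fun N => _) = cst 0); first exact: cvg_cst.
apply/funext => N; rewrite (_ : _ - _ = 0) ?(ipn0 L2i)//.
apply/funext => w; rewrite -[LHS]/(coordp _ t i w - partial_filter _ _ _ _ _ w).
rewrite partial_filterE /coordp big1 ?subrr// => k _.
by rewrite mul0mx.
Qed.

Lemma L2_filter_sum (I : finType) m n (B : I -> nat -> 'M[R]_(m, n)) (X : process n)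
    (Y : I -> process m) :
  L2_process P X -> (forall l, L2_process P (Y l)) -> (forall l, L2_filter P (B l) X (Y l)) ->
  L2_process P (fun t w => \sum_l Y l t w) /\
  L2_filter P (fun k => \sum_l B l k) X (fun t w => \sum_l Y l t w).
Proof.
move=> X2 Y2 BY.
elim: (index_enum I) => [|l r [IH1 IH2]].
  split.
    move=> t i; rewrite (_ : coordp _ _ _ = cst 0); first exact: L2_cst.
    by apply/funext => w; rewrite /coordp big_nil mxE.
  apply: (L2_filter_ext _ _ (@L2_filter0 m n X X2)) => [k|]; first by rewrite big_nil.
  by apply/funext => t; apply/funext => w; rewrite big_nil.
split.
  move=> t i; rewrite (_ : coordp _ _ _ = coordp (Y l) t i +
      coordp (fun t w => \sum_(l <- r) Y l t w) t i).
    by apply: L2D; [exact: Y2|exact: IH1].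
  by apply/funext => w; rewrite /coordp big_cons mxE.
apply: (L2_filter_ext _ _ (L2_filterD X2 (Y2 l) IH1 (BY l) IH2)) => [k|].
  by rewrite big_cons.
by apply/funext => t; apply/funext => w; rewrite big_cons.
Qed.

(** Filtering a filtered process convolves the coefficients: a lag polynomial is
    a finite sum of shifts followed by multiplications by constants. *)
Lemma L2_filter_lag m n o (A : 'M[{poly R}]_(o, m)) (B : nat -> 'M[R]_(m, n))
    (X : process n) (Y : process m) :
  L2_process P X -> L2_process P Y -> L2_filter P B X Y ->
  L2_process P (lag_filter A Y) /\ L2_filter P (mconv A B) X (lag_filter A Y).
Proof.
move=> X2 Y2 BY; have [N A0 AE] := lag_filter_coef T A.
have Y2k (k : 'I_N) : L2_process P (fun t => Y (t - k%:Z)) by move=> t i; exact: Y2.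
have [] := L2_filter_sum X2 (fun k : 'I_N => L2_mul_process (coef_mxp A k) (Y2k k))
  (fun k : 'I_N => L2_filter_mul (coef_mxp A k) X2 (Y2k k) (L2_filter_shift k X2 Y2 BY)).
have -> : (fun t w => \sum_(k < N) mul_process (coef_mxp A k) (fun t => Y (t - k%:Z)) t w)
    = lag_filter A Y.
  by apply/funext => t; apply/funext => w; rewrite AE.
move=> L L'; split => //; apply: (L2_filter_ext _ (erefl _) L') => // k.
rewrite /mconv (big_ord_widen_cond (maxn N k.+1) xpredT (fun j => coef_mxp A j *m B (k - j)%N)) ?leq_maxr//.
rewrite (big_ord_widen (maxn N k.+1) (fun j => coef_mxp A j *m shift_seq B j k)) ?leq_maxl//.
rewrite big_mkcond [RHS]big_mkcond; apply: eq_bigr => j _ /=.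
rewrite /shift_seq ltnS; have [jk|jk] := leqP j k; last by rewrite mulmx0 if_same.
by case: leqP => // Nj; rewrite A0// mul0mx.
Qed.

End Filter.

(** * Uniqueness and existence of mean-square filters *)

Lemma cvg_of_norm (R : realType) (a b : nat -> R) l :
  (forall n, `|a n - l| <= b n) -> b n @[n --> \oo] --> 0 -> a n @[n --> \oo] --> l.
Proof.
move=> ab b0; apply/subr_cvg0/norm_cvg0P; apply: (cvg0_le (b := b)) => // n.
by rewrite normr_ge0 ab.
Qed.

Section Filter2.
Context (disp : measure_display) (T : measurableType disp) (R : realType).
Variable P : probability T R.

Local Notation process := (process T R).
Local Notation ipn := (seminorm (ip P)).
Local Notation L2i := (L2_semi_inner P).

Lemma ip_cvg (f : nat -> T -> R) l g : (forall n, L2 P (f n)) -> L2 P l -> L2 P g ->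
  ipn (l - f n) @[n --> \oo] --> 0 -> ip P (f n) g @[n --> \oo] --> ip P l g.
Proof.
move=> Sf Sl Sg h; apply: cvg_of_norm (cvg0Z (ipn g) h) => n.
rewrite distrC -(ipBl L2i)// (le_trans (ip_le L2i _ _)) 1?mulrC//.
exact: L2B.
Qed.

Lemma ip_cvg2 (f g : nat -> T -> R) l m : (forall n, L2 P (f n)) -> (forall n, L2 P (g n)) ->
  L2 P l -> L2 P m ->
  ipn (l - f n) @[n --> \oo] --> 0 -> ipn (m - g n) @[n --> \oo] --> 0 ->
  ip P (f n) (g n) @[n --> \oo] --> ip P l m.
Proof.
move=> f2 g2 l2 m2 hf hg.
have hfg : ipn (l - f n) * ipn (m - g n) @[n --> \oo] --> 0.
  by rewrite -(mulr0 0); exact: cvgM.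
apply: cvg_of_norm (cvg0D (cvg0Z (ipn m) hf) (cvg0D (cvg0Z (ipn l) hg) hfg)) => n.
have lf2 : L2 P (l - f n) by exact: L2B.
have mg2 : L2 P (m - g n) by exact: L2B.
have -> : ip P (f n) (g n) - ip P l m =
    ip P (l - f n) (m - g n) - (ip P (l - f n) m + ip P l (m - g n)).
  by rewrite !(ipBl L2i)// !(ipBr L2i)//; ring.
rewrite (le_trans (ler_normB _ _))// addrC addrA lerD ?(ip_le L2i)//.
rewrite (le_trans (ler_normD _ _))// lerD//; last exact: (ip_le L2i).
by rewrite mulrC (ip_le L2i).
Qed.

(** Two mean-square limits of the same sequence agree almost surely. *)
Lemma L2_filter_uniq m n (B : nat -> 'M[R]_(m, n)) (X : process n) (Y Y' : process m) :
  L2_process P X -> L2_process P Y -> L2_process P Y' ->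
  L2_filter P B X Y -> L2_filter P B X Y' ->
  forall t, \forall w \ae P, Y t w = Y' t w.
Proof.
move=> X2 Y2 Y'2 /(L2_filterP _ X2 Y2) h /(L2_filterP _ X2 Y'2) h' t.
have d2 i : L2 P (coordp Y t i - coordp Y' t i) by apply: L2B; [exact: Y2|exact: Y'2].
suff : forall i, \forall w \ae P, coordp Y t i w = coordp Y' t i w.
  move=> /filter_forall; apply: filterS => w YY; apply/colP => i; exact: YY.
move=> i; suff : ipn (coordp Y t i - coordp Y' t i) = 0.
  move=> /(ipn0_ae (d2 i)); apply: filterS => w /eqP; rewrite subr_eq0.
  by move=> /eqP.
apply/eqP; rewrite eq_le ipn_ge0 andbT.
apply: (cvgr_to_ge (cvg0D (h t i) (h' t i))); apply: nearW => N.
rewrite (_ : coordp Y t i - _ = (coordp Y t i - partial_filter B X t i N) -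
   (coordp Y' t i - partial_filter B X t i N)); last first.
  by rewrite opprB addrA subrK.
have D2 Z : L2_process P Z -> L2 P (coordp Z t i - partial_filter B X t i N).
  by move=> Z2; apply: L2B; [exact: Z2|exact: L2_partial_filter].
rewrite (le_trans (ipnD L2i (D2 _ Y2) (L2N (D2 _ Y'2))))//.
by rewrite (ipnN L2i)//; exact: D2.
Qed.

Lemma L2_filter_id n (X : process n) : L2_process P X ->
  L2_filter P (coef_mxp 1%:M) X X.
Proof.
move=> X2; apply/L2_filterP => // t i; rewrite -(cvg_shiftn 1).
rewrite (_ : (fun N => _) = cst 0); first exact: cvg_cst.
apply/funext => N; rewrite [X in ipn X](_ : _ = 0) ?(ipn0 L2i)//.
apply/eqP; rewrite subr_eq0; apply/eqP/funext => w; rewrite partial_filterE.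
rewrite addn1 big_ord_recl big1 => [|k _].
  by rewrite addr0 subr0 (_ : coef_mxp _ _ = 1%:M) ?mul1mx//; apply/matrixP => a b;
    rewrite !mxE coefMn coefC.
rewrite (_ : coef_mxp _ _ = 0) ?mul0mx//; apply/matrixP => a b.
by rewrite !mxE coefMn coefC mul0rn.
Qed.

Lemma L2_filter_coef m n (A : 'M[{poly R}]_(m, n)) (X : process n) :
  L2_process P X -> L2_process P (lag_filter A X) /\
  L2_filter P (coef_mxp A) X (lag_filter A X).
Proof.
move=> X2; have [L h] := L2_filter_lag A X2 X2 (L2_filter_id X2).
split=> //; apply: (L2_filter_ext _ (erefl _) h) => k.
by rewrite mconv_coef mulmx1.
Qed.

Lemma partial_filterS m n (B : nat -> 'M[R]_(m, n)) (X : process n) t i N :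
  partial_filter B X t i N.+1 =
  partial_filter B X t i N + \sum_j B N i j *: coordp X (t - N%:Z) j.
Proof. by rewrite /partial_filter big_ord_recr. Qed.

Section Bounded.
Variables (m n : nat) (B : nat -> 'M[R]_(m, n)) (X : process n) (K : R).
Hypothesis X2 : L2_process P X.
Hypothesis XK : forall t i, ipn (coordp X t i) <= K.
Hypothesis B1 : forall i j, l1 (fun k => B k i j).

Let b i k := \sum_j `|B k i j| * K.

Let K0 (i : 'I_n) : 0 <= K.
Proof. by rewrite (le_trans _ (XK 0 i))// ipn_ge0. Qed.

Let ipn_term t i k : ipn (\sum_j B k i j *: coordp X (t - k%:Z) j) <= b i k.
Proof.
apply: le_trans (ipn_sum L2i _ _) _ => [j|]; first exact/L2Z/X2.
by apply: ler_sum => j _; rewrite (ipnZ L2i) ?ler_wpM2l//; exact: X2.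
Qed.

Let b0 i k : 0 <= b i k.
Proof. by apply: sumr_ge0 => j _; rewrite mulr_ge0// (K0 j). Qed.

Let bM i : exists M, forall N, \sum_(k < N) b i k <= M.
Proof.
have [M hM] := choice (B1 i); exists (\sum_j M j * K) => N.
rewrite exchange_big; apply: ler_sum => j _.
by rewrite -mulr_suml ler_wpM2r ?(K0 j).
Qed.

(** Summable coefficients and bounded second moments give an absolutely
    convergent series in L2. *)
Lemma L2_filter_exists : exists2 Y : process m, L2_process P Y & L2_filter P B X Y.
Proof.
have : forall ti : int * 'I_m, exists Y, L2 P Y /\
    ipn (Y - partial_filter B X ti.1 ti.2 N) @[N --> \oo] --> 0.
  move=> [t i] /=; have [M hM] := bM i.
  have [k|N|Y Y2 hY] := @L2_series _ _ _ P
    (fun k => \sum_j B k i j *: coordp X (t - k%:Z) j) M; last by exists Y.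
    by apply: L2_sum => j; exact/L2Z/X2.
  by apply: le_trans (hM N); apply: ler_sum => k _; exact: ipn_term.
move=> /choice[Y hY]; pose Z : process m := fun t w => \col_i Y (t, i) w.
have ZE t i : coordp Z t i = Y (t, i) by apply/funext => w; rewrite /coordp mxE.
have Z2 : L2_process P Z by move=> t i; rewrite ZE; exact: (hY (t, i)).1.
exists Z => //; apply/L2_filterP => // t i; rewrite ZE; exact: (hY (t, i)).2.
Qed.

(** The error is bounded by the tail of the sums of coefficients, whatever the
    time: the covariances of the filter at remote times can be handled with a
    fixed truncation. *)
Lemma L2_filter_tail (Y : process m) i : L2_process P Y -> L2_filter P B X Y ->
  exists2 e : nat -> R, e N @[N --> \oo] --> 0 &
    forall t N, ipn (coordp Y t i - partial_filter B X t i N) <= e N.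
Proof.
move=> Y2 /(L2_filterP _ X2 Y2) h; have [M hM] := bM i.
have /cvg_ex[/= L cL] := cvg_bounded_sum (b0 i) hM.
exists (fun N => L - series (b i) N) => [|t N].
  by rewrite -(subrr L); apply: cvgB => //; exact: cvg_cst.
have nd : nondecreasing_seq (series (b i)).
  by apply/nondecreasing_seqP => k; rewrite /series/= big_nat_recr//= lerDl.
have d2 k : L2 P (coordp Y t i - partial_filter B X t i k).
  by apply: L2B; [exact: Y2|exact: L2_partial_filter].
have step k : ipn (coordp Y t i - partial_filter B X t i N) <=
    ipn (coordp Y t i - partial_filter B X t i (N + k)) +
    (series (b i) (N + k)%N - series (b i) N).
  elim: k => [|k IH]; first by rewrite addn0 subrr addr0.
  apply: (le_trans IH); rewrite addnS [series (b i) _.+1]/series/= big_nat_recr//=.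
  rewrite -/(series (b i) _) addrAC [X in _ <= _ + X]addrC [leRHS]addrA lerD2r.
  rewrite [X in ipn X <= _](_ : _ = (coordp Y t i - partial_filter B X t i (N + k).+1) +
    \sum_j B (N + k)%N i j *: coordp X (t - (N + k)%N%:Z) j); last first.
    by rewrite partial_filterS opprD addrA subrK.
  rewrite (le_trans (ipnD L2i _ _))// ?lerD2l//.
  by apply: L2_sum => j; exact/L2Z/X2.
rewrite -[leRHS]add0r.
have c : ipn (coordp Y t i - partial_filter B X t i k) + (L - series (b i) N)
    @[k --> \oo] --> 0 + (L - series (b i) N).
  by apply: cvgD; [exact: h|exact: cvg_cst].
apply: (cvgr_to_ge c).
exists N => // k /= Nk; rewrite -(subnKC Nk) (le_trans (step (k - N)%N))// lerD2l lerB//.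
by have := nondecreasing_cvgn_le nd (cvgP _ cL) (N + (k - N))%N; rewrite (cvg_lim _ cL).
Qed.

End Bounded.

End Filter2.

(** * Filters of white noise *)

Section WhiteNoise.
Context (disp : measure_display) (T : measurableType disp) (R : realType).
Variable P : probability T R.

Local Notation process := (process T R).
Local Notation ipn := (seminorm (ip P)).
Local Notation L2i := (L2_semi_inner P).

Lemma mean_ip n (X : process n) k : L2_process P X -> mean_process P X k ->
  forall t i, ip P (coordp X t i) (cst 1) = k i ord0.
Proof.
by move=> X2 Xk t i; apply: EFin_inj; rewrite -ip1E ?Xk//; exact: X2.
Qed.

Variables (q : nat) (u : process q) (G : 'M[R]_q).
Hypothesis u2 : L2_process P u.
Hypothesis u0 : mean_process P u 0.
Hypothesis G_unit : G \in unitmx.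
Hypothesis uG : forall t s i j,
  covariance P (coordp u t i) (coordp u s j) = ((t == s)%:R * G i j)%:E.

Lemma white_noise_ip t s i j :
  ip P (coordp u t i) (coordp u s j) = (t == s)%:R * G i j.
Proof.
apply: EFin_inj; rewrite -uG covE; try exact: u2.
by rewrite !(mean_ip u2 u0) mxE mul0r subr0.
Qed.

Lemma white_noise_bounded : exists K, forall t i, ipn (coordp u t i) <= K.
Proof.
exists (\sum_i Num.sqrt (G i i)) => t i.
rewrite /seminorm white_noise_ip eqxx mul1r (bigD1 i)//= lerDl.
by apply: sumr_ge0 => j _; exact: sqrtr_ge0.
Qed.

(** The covariance matrix of the noise, being a nonsingular Gram matrix, is
    positive definite. *)
Lemma white_noise_posdef (x : 'rV[R]_q) : (x *m G *m x^T) 0 0 = 0 -> x = 0.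
Proof.
move=> xGx.
pose f : T -> R := \sum_i x 0 i *: coordp u 0 i.
have f2 : L2 P f by apply: L2_sum => i; exact/L2Z/u2.
have fE j : ip P f (coordp u 0 j) = (x *m G) 0 j.
  rewrite (ip_suml L2i) ?mxE//; [|by move=> i; exact/L2Z/u2|exact: u2].
  apply: eq_bigr => i _; rewrite ipZl ?white_noise_ip ?eqxx ?mul1r//; exact: u2.
have ff : ip P f f = 0.
  rewrite -[RHS]xGx [RHS]mxE {2}/f (ip_sumr L2i)//; last by move=> i; exact/L2Z/u2.
  apply: eq_bigr => j _; rewrite (ipZr L2i)//; last exact: u2.
  by rewrite fE [x^T _ _]mxE mulrC.
have xG : x *m G = 0.
  apply/rowP => j; rewrite -fE mxE; apply/eqP; rewrite -sqrf_eq0.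
  rewrite eq_le sqr_ge0 andbT.
  by have := ip_cauchy_schwarz L2i f2 (u2 0 j); rewrite ff mul0r.
by rewrite -(mulmxK G_unit x) xG mul0mx.
Qed.

Lemma L2_filter_mean0 m (B : nat -> 'M[R]_(m, q)) (Z : process m) :
  L2_process P Z -> L2_filter P B u Z -> mean_process P Z 0.
Proof.
move=> Z2 /(L2_filterP _ u2 Z2) h t i; rewrite ip1E; last exact: Z2.
rewrite mxE; congr (_%:E).
have c := ip_cvg (fun N => L2_partial_filter B t i N u2) (Z2 t i) (L2_cst P 1) (h t i).
apply: (cvg_unique _ c); first exact: Rhausdorff.
rewrite (_ : (fun N => _) = cst 0); first exact: cvg_cst.
apply/funext => N; rewrite (ip_suml L2i)//; last exact: L2_cst.
  rewrite big1// => k _; rewrite (ip_suml L2i)//; last exact: L2_cst.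
    rewrite big1// => j _; rewrite ipZl//; [|exact: u2|exact: L2_cst].
    by rewrite (mean_ip u2 u0) mxE mulr0.
  by move=> j; exact/L2Z/u2.
by move=> k; apply: L2_sum => j; exact/L2Z/u2.
Qed.

(** The values of one coordinate of the noise at different times are orthogonal
    and of constant length, so by Bessel's inequality their products with a
    fixed variable are square summable. *)
Lemma noise_decorrelates V i (k : nat) : L2 P V ->
  ip P (coordp u (n%:Z - k%:Z) i) V @[n --> \oo] --> 0.
Proof.
move=> V2.
pose e n := coordp u (n%:Z - k%:Z) i.
have e2 n : L2 P (e n) by exact: u2.
have ee n m : ip P (e n) (e m) = (n == m)%:R * G i i.
  by rewrite white_noise_ip (inj_eq (addIr _)) eqz_nat.
have h : ip P V (e n) @[n --> \oo] --> 0.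
  by apply: (cvg0_bounded_sqsum (M := (G i i + 1) * ip P V V)) => n; exact: (bessel L2i).
by under eq_fun => n do rewrite ipC -/(e n).
Qed.

(** A finite part of the filter decorrelates from [V] as the noise does, and the
    rest is small uniformly in time. *)
Lemma filter_decorrelates m (B : nat -> 'M[R]_(m, q)) (Z : process m) V i :
  (forall i j, l1 (fun k => B k i j)) ->
  L2_process P Z -> L2_filter P B u Z -> L2 P V ->
  ip P (coordp Z n%:Z i) V @[n --> \oo] --> 0.
Proof.
move=> B1 Z2 BZ V2; have [K uK] := white_noise_bounded.
have [e e0 he] := L2_filter_tail u2 uK B1 i Z2 BZ.
have hN N : ip P (partial_filter B u n%:Z i N) V @[n --> \oo] --> 0.
  have E n : ip P (partial_filter B u n%:Z i N) V =
      \sum_(k < N) \sum_j B k i j * ip P (coordp u (n%:Z - k%:Z) j) V.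
    rewrite (ip_suml L2i)//; last by move=> k; apply: L2_sum => j; exact/L2Z/u2.
    apply: eq_bigr => k _; rewrite (ip_suml L2i)//; last by move=> j; exact/L2Z/u2.
    by apply: eq_bigr => j _; rewrite ipZl//; exact: u2.
  under eq_fun => n do rewrite E.
  apply: cvg0_sum => k; apply: cvg0_sum => j; apply: cvg0Z.
  exact: noise_decorrelates.
apply/cvgr0Pnorm_le => eps eps0.
have V0 : 0 <= ipn V by exact: ipn_ge0.
have e1 : 0 < eps / 2 / (ipn V + 1) by rewrite !divr_gt0// ltr_wpDl.
have [N _ HN] := (cvgr0Pnorm_le _).1 e0 _ e1.
near=> n.
have -> : coordp Z n%:Z i = (coordp Z n%:Z i - partial_filter B u n%:Z i N) +
   partial_filter B u n%:Z i N by rewrite subrK.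
have p2 : L2 P (partial_filter B u n i N) by exact: L2_partial_filter.
have d2 : L2 P (coordp Z n i - partial_filter B u n i N) by apply: L2B => //; exact: Z2.
rewrite ipDl// (le_trans (ler_normD _ _))// (splitr eps) lerD//; last first.
  near: n; apply: (cvgr0_norm_le _ (hN N)); exact: divr_gt0.
rewrite (le_trans (ip_le L2i _ _))//.
have := HN N (leqnn N); have := he n N.
rewrite ler_pdivlMr ?ltr_wpDl// => h1 h2.
apply: le_trans h2; apply: ler_pM; rewrite ?ipn_ge0//.
  by rewrite (le_trans h1)// ler_norm.
by rewrite lerDl.
Unshelve. all: by end_near.
Qed.

(** Autocovariances are limits of those of the truncated filters, which the
    covariances of the noise make explicit. *)
Lemma filter_ip_cvg m (B : nat -> 'M[R]_(m, q)) (Z : process m) t s i j :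
  L2_process P Z -> L2_filter P B u Z ->
  \sum_(k < N) \sum_(l < N) \sum_a \sum_b
     B k i a * B l j b * ((t - k%:Z == s - l%:Z)%:R * G a b) @[N --> \oo] -->
  ip P (coordp Z t i) (coordp Z s j).
Proof.
move=> Z2 /(L2_filterP _ u2 Z2) h.
have c := ip_cvg2 (fun N => L2_partial_filter B t i N u2)
  (fun N => L2_partial_filter B s j N u2) (Z2 t i) (Z2 s j) (h t i) (h s j).
rewrite (_ : (fun N => _) = (fun N => ip P (partial_filter B u t i N)
    (partial_filter B u s j N))) //; apply/funext => N; apply/esym.
have S2 t' i' k : L2 P (\sum_a B k i' a *: coordp u (t' - k%:Z) a).
  by apply: L2_sum => a; exact/L2Z/u2.
have T2 t' i' (k : nat) a : L2 P (B k i' a *: coordp u (t' - k%:Z) a) by exact/L2Z/u2.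
rewrite (ip_suml L2i)//; last exact: L2_partial_filter.
apply: eq_bigr => k _; rewrite (ip_sumr L2i)//; apply: eq_bigr => l _.
rewrite (ip_suml L2i)//; apply: eq_bigr => a _.
rewrite (ip_sumr L2i)//; apply: eq_bigr => b _.
rewrite ipZl//; last exact: u2.
rewrite (ipZr L2i _ (u2 _ _) (u2 _ _)).
rewrite white_noise_ip.
by rewrite !mulrA.
Qed.

End WhiteNoise.

(** * Integrals of trigonometric functions over a period *)

Section Circle.
Variable R : realType.
Implicit Types f g : R -> R.

Local Notation leb := (@lebesgue_measure R).

Definition circle_int f : R := \int[leb]_(x in `[- pi, pi]) f x.

Local Notation II := circle_int.

Lemma circle_integrable f : continuous f ->
  leb.-integrable `[- pi, pi] (EFin \o f).
Proof.
move=> cf; apply: continuous_compact_integrable; first exact: segment_compact.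
exact: continuous_subspaceT.
Qed.

Lemma circle_intD f g : continuous f -> continuous g ->
  II (fun x => f x + g x) = II f + II g.
Proof. by move=> cf cg; rewrite /II RintegralD//; exact: circle_integrable. Qed.

Lemma circle_intZ a f : continuous f -> II (fun x => a * f x) = a * II f.
Proof. by move=> cf; rewrite /II RintegralZl//; exact: circle_integrable. Qed.

Lemma continuous_sum (I : Type) (r : seq I) (f : I -> R -> R) :
  (forall i, continuous (f i)) -> continuous (fun x => \sum_(i <- r) f i x).
Proof.
move=> cf; elim: r => [|i r IH].
  by rewrite (_ : (fun x => _) = cst 0); [exact: cst_continuous|apply/funext => x; rewrite big_nil].
rewrite (_ : (fun x => _) = (fun x => f i x + \sum_(i <- r) f i x)).
  by move=> x; apply: cvgD; [exact: cf|exact: IH].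
by apply/funext => x; rewrite big_cons.
Qed.

Lemma circle_int_sum (I : Type) (r : seq I) (f : I -> R -> R) :
  (forall i, continuous (f i)) ->
  II (fun x => \sum_(i <- r) f i x) = \sum_(i <- r) II (f i).
Proof.
move=> cf; elim: r => [|i r IH].
  rewrite big_nil /II (@eq_Rintegral _ _ _ _ _ (cst 0)).
    by rewrite /Rintegral integral0.
  by move=> x _; rewrite big_nil.
rewrite big_cons -IH -circle_intD//; last exact: continuous_sum.
by apply: eq_Rintegral => x _; rewrite big_cons.
Qed.

Lemma circle_int_ge0 f : (forall x, 0 <= f x) -> 0 <= II f.
Proof. by move=> f0; apply: Rintegral_ge0 => x _. Qed.

Lemma circle_int_cst a : II (cst a) = 2 * pi * a.
Proof.
rewrite /II Rintegral_cst//= lebesgue_measure_itv/= lte_fin ifT; last first.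
  by have := pi_gt0 R; lra.
by rewrite -EFinB /=; lra.
Qed.

Lemma circle_int_le f M : continuous f -> (forall x, `|f x| <= M) ->
  `|II f| <= 2 * pi * M.
Proof.
move=> cf fM; rewrite -circle_int_cst.
apply: (le_trans (le_normr_Rintegral _ _)) => //; first exact: circle_integrable.
apply: le_Rintegral => //.
- apply: circle_integrable => x; apply: (continuous_comp (cf x)).
  exact: norm_continuous.
- by apply: circle_integrable; exact: cst_continuous.
Qed.

Lemma sin_intr_pi (n : int) : sin (n%:~R * pi) = 0 :> R.
Proof.
have H (k : nat) : sin (k%:R * pi) = 0 :> R.
  elim: k => [|k IH]; first by rewrite mul0r sin0.
  by rewrite -addn1 natrD mulrDl mul1r sinDpi IH oppr0.
case: n => n; first exact: H.
by rewrite NegzE mulrNz mulNr sinN H oppr0.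
Qed.

Lemma continuous_scale (a : R) : continuous (fun x : R => a * x).
Proof. by move=> x; apply: cvgM; [exact: cvg_cst|exact: cvg_id]. Qed.

Lemma continuous_cosM (a : R) : continuous (fun x : R => cos (a * x)).
Proof. by move=> x; apply: continuous_comp; [exact: continuous_scale|exact: continuous_cos]. Qed.

Lemma continuous_sinM (a : R) : continuous (fun x : R => sin (a * x)).
Proof. by move=> x; apply: continuous_comp; [exact: continuous_scale|exact: continuous_sin]. Qed.

Lemma circle_int_FTC (F f : R -> R) : continuous f ->
  (forall x : R, is_derive x 1 F (f x)) -> II f = F pi - F (- pi).
Proof.
move=> cf dF; rewrite /II /Rintegral.
have cF : continuous F.
  by move=> x; apply: differentiable_continuous; apply/derivable1_diffP; have [] := dF x.
rewrite (@continuous_FTC2 _ f F)//.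
- by have := pi_gt0 R; lra.
- exact: continuous_subspaceT.
- split=> [x _||]; first by have [] := dF x.
  + by apply: cvg_at_right_filter; exact: cF.
  + by apply: cvg_at_left_filter; exact: cF.
- by move=> x _; rewrite derive1E; apply: derive_val.
Qed.

Lemma circle_int_cos (n : int) :
  II (fun x => cos (n%:~R * x)) = (n == 0)%:R * (2 * pi).
Proof.
have [->|n0] := eqVneq n 0.
  rewrite mul1r -[RHS]mulr1 -circle_int_cst; apply: eq_Rintegral => x _.
  by rewrite mul0r cos0.
have n0' : n%:~R != 0 :> R by rewrite intr_eq0.
have dF (x : R) : is_derive x 1 (fun x : R => n%:~R^-1 * sin (n%:~R * x)) (cos (n%:~R * x)).
  apply: is_derive_eq.
  by rewrite /GRing.scale/= mulr1 mulrCA mulVf// mulr1.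
rewrite mul0r (circle_int_FTC (@continuous_cosM n%:~R) dF).
by rewrite mulrN sinN sin_intr_pi oppr0 mulr0 subrr.
Qed.

Lemma circle_int_sin (n : int) : II (fun x => sin (n%:~R * x)) = 0.
Proof.
have [->|n0] := eqVneq n 0.
  rewrite -[RHS](mulr0 (2 * pi)) -circle_int_cst; apply: eq_Rintegral => x _.
  by rewrite mul0r sin0.
have n0' : n%:~R != 0 :> R by rewrite intr_eq0.
have dF (x : R) : is_derive x 1 (fun x : R => - n%:~R^-1 * cos (n%:~R * x)) (sin (n%:~R * x)).
  apply: is_derive_eq.
  by rewrite /GRing.scale/= mulr1 mulNr mulNr mulrN opprK mulrCA mulVf// mulr1.
rewrite (circle_int_FTC (@continuous_sinM n%:~R) dF).
by rewrite mulrN cosN subrr.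
Qed.

End Circle.

(** * The Riemann-Lebesgue lemma for autocovariances *)

Section RiemannLebesgue.
Variable R : realType.
Implicit Types f g : R -> R.

Local Notation II := (@circle_int R).

Lemma continuous_mul f g : continuous f -> continuous g -> continuous (fun x => f x * g x).
Proof. by move=> cf cg x; apply: cvgM; [exact: cf|exact: cg]. Qed.

(** Makes Bessel's inequality available for Fourier coefficients. *)
Lemma circle_semi_inner :
  semi_inner (fun f : R -> R => continuous f) (fun f g => II (fun x => f x * g x)).
Proof.
split.
- exact: cst_continuous.
- by move=> f g cf cg x; apply: cvgD; [exact: cf|exact: cg].
- by move=> a f cf x; apply: cvgM; [exact: cvg_cst|exact: cf].
- by move=> f g; apply: eq_Rintegral => x _; rewrite mulrC.
- move=> f g h cf cg ch; rewrite -circle_intD; [|exact: continuous_mul..].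
  by apply: eq_Rintegral => x _; rewrite -mulrDl.
- move=> a f g cf cg; rewrite -circle_intZ; last exact: continuous_mul.
  by apply: eq_Rintegral => x _; rewrite mulrA.
- by move=> f _; apply: circle_int_ge0 => x; rewrite -expr2 sqr_ge0.
Qed.

Lemma bessel_cvg0 (e : nat -> R -> R) K f : continuous f ->
  (forall n, continuous (e n)) ->
  (forall i j, II (fun x => e i x * e j x) = (i == j)%:R * K) ->
  II (fun x => e n x * f x) @[n --> \oo] --> 0.
Proof.
move=> cf ce eK.
apply: (cvg0_bounded_sqsum (M := (K + 1) * II (fun x => f x * f x))) => n.
apply: le_trans (bessel circle_semi_inner n cf ce eK).
rewrite le_eqVlt; apply/orP; left; apply/eqP; apply: eq_bigr => i _.
by congr (_ ^+ 2); apply: eq_Rintegral => x _; rewrite mulrC.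
Qed.

Lemma circle_int_cos_combine (a b : R) (m n : int) :
  II (fun x => a * cos (m%:~R * x) + b * cos (n%:~R * x)) =
  (a * (m == 0)%:R + b * (n == 0)%:R) * (2 * pi).
Proof.
rewrite circle_intD; last 2 first.
- by apply: continuous_mul; [exact: cst_continuous|exact: continuous_cosM].
- by apply: continuous_mul; [exact: cst_continuous|exact: continuous_cosM].
by rewrite !circle_intZ ?circle_int_cos; try exact: continuous_cosM; ring.
Qed.

(** The cosines of positive integer frequency are orthogonal with common squared
    length [pi]. *)
Lemma riemann_lebesgue_cos f : continuous f ->
  II (fun x => cos (n%:~R * x) * f x) @[n --> \oo] --> 0.
Proof.
move=> cf; rewrite -(cvg_shiftn 1) /=.
(* The shift by one excludes the constant function, whose length is
   different. *)
apply: (@bessel_cvg0 (fun n x => cos ((n + 1)%N%:~R * x)) pi) => // [n|i j].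
  exact: continuous_cosM.
pose p : int := Posz (i + 1) - Posz (j + 1); pose s : int := Posz (i + 1) + Posz (j + 1).
transitivity (II (fun x => 2^-1 * cos (p%:~R * x) + 2^-1 * cos (s%:~R * x))).
  apply: eq_Rintegral => x _.
  rewrite /p /s intrB intrD mulrBl mulrDl cosB cosD.
  by set a := cos _; set b := cos _; set y := sin _; set z := sin _; field.
rewrite circle_int_cos_combine /p /s subr_eq0 eqz_nat eqn_add2r.
by rewrite -PoszD eqz_nat addn1 addSn/= (_ : false%:R = 0 :> R)//; field.
Qed.

Lemma riemann_lebesgue_sin f : continuous f ->
  II (fun x => sin (n%:~R * x) * f x) @[n --> \oo] --> 0.
Proof.
move=> cf; rewrite -(cvg_shiftn 1) /=.
apply: (@bessel_cvg0 (fun n x => sin ((n + 1)%N%:~R * x)) pi) => // [n|i j].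
  exact: continuous_sinM.
pose p : int := Posz (i + 1) - Posz (j + 1); pose s : int := Posz (i + 1) + Posz (j + 1).
transitivity (II (fun x => 2^-1 * cos (p%:~R * x) + (- 2^-1) * cos (s%:~R * x))).
  apply: eq_Rintegral => x _.
  rewrite /p /s intrB intrD mulrBl mulrDl cosB cosD.
  by set a := cos _; set b := cos _; set y := sin _; set z := sin _; field.
rewrite circle_int_cos_combine /p /s subr_eq0 eqz_nat eqn_add2r.
by rewrite -PoszD eqz_nat addn1 addSn/= (_ : false%:R = 0 :> R)//; field.
Qed.

End RiemannLebesgue.

Section ComplexCircle.
Variable R : realType.
Local Notation C := R[i].
Local Notation Re := (@complex.Re R).
Local Notation Im := (@complex.Im R).
Local Notation nc := (@ComplexField.Normc.normc R).
Implicit Types f g : R -> C.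

(** Stated for the two parts because the integrals that define a spectral
    density are. *)
Definition ccontinuous f := continuous (Re \o f) /\ continuous (Im \o f).

Lemma ccontinuous_cst (c : C) : ccontinuous (fun=> c).
Proof. by split; exact: cst_continuous. Qed.

Lemma ccontinuousD f g : ccontinuous f -> ccontinuous g ->
  ccontinuous (fun x => f x + g x).
Proof.
move=> [f1 f2] [g1 g2]; split => x.
  rewrite (_ : _ \o _ = (fun x => Re (f x) + Re (g x))).
    by apply: cvgD; [exact: f1|exact: g1].
  by apply/funext => y /=; case: (f y) (g y) => ? ? [].
rewrite (_ : _ \o _ = (fun x => Im (f x) + Im (g x))).
  by apply: cvgD; [exact: f2|exact: g2].
by apply/funext => y /=; case: (f y) (g y) => ? ? [].
Qed.

Lemma ccontinuousM f g : ccontinuous f -> ccontinuous g ->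
  ccontinuous (fun x => f x * g x).
Proof.
move=> [f1 f2] [g1 g2]; split => x.
  rewrite (_ : _ \o _ = (fun x => Re (f x) * Re (g x) - Im (f x) * Im (g x))).
    by apply: cvgB; apply: cvgM; (exact: f1 || exact: f2 || exact: g1 || exact: g2).
  by apply/funext => y /=; case: (f y) (g y) => ? ? [].
rewrite (_ : _ \o _ = (fun x => Re (f x) * Im (g x) + Im (f x) * Re (g x))).
  by apply: cvgD; apply: cvgM; (exact: f1 || exact: f2 || exact: g1 || exact: g2).
by apply/funext => y /=; case: (f y) (g y) => ? ? [].
Qed.

Lemma ccontinuousV f : ccontinuous f -> (forall x, f x != 0) ->
  ccontinuous (fun x => (f x)^-1).
Proof.
move=> [f1 f2] f0.
have n0 x : Re (f x) ^+ 2 + Im (f x) ^+ 2 != 0.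
  have := f0 x; case: (f x) => a b; rewrite eq_complex/= negb_and => ab.
  by rewrite paddr_eq0 ?sqr_ge0// !sqrf_eq0 negb_and.
have cn : continuous (fun x => (Re (f x) ^+ 2 + Im (f x) ^+ 2)^-1).
  move=> x; apply: cvgV => //; apply: cvgD; apply: cvgM; (exact: f1 || exact: f2).
split => x.
  rewrite (_ : _ \o _ = (fun x => Re (f x) * (Re (f x) ^+ 2 + Im (f x) ^+ 2)^-1)).
    by apply: cvgM; [exact: f1|exact: cn].
  by apply/funext => y /=; case: (f y).
rewrite (_ : _ \o _ = (fun x => - Im (f x) * (Re (f x) ^+ 2 + Im (f x) ^+ 2)^-1)).
  by apply: cvgM; [apply: cvgN; exact: f2|exact: cn].
by apply/funext => y /=; case: (f y) => a b /=; rewrite mulNr.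
Qed.

Lemma ccontinuous_cis (a : R) : ccontinuous (fun x => cis (a * x)).
Proof. by split; [exact: continuous_cosM|exact: continuous_sinM]. Qed.

Lemma ccontinuous_horner (p : {poly C}) f : ccontinuous f ->
  ccontinuous (fun x => p.[f x]).
Proof.
move=> cf; elim/poly_ind: p => [|p c IH].
  rewrite (_ : (fun x => _) = (fun=> 0)); first exact: ccontinuous_cst.
  by apply/funext => x; rewrite horner0.
rewrite (_ : (fun x => _) = (fun x => p.[f x] * f x + c)); last first.
  by apply/funext => x; rewrite hornerMXaddC.
by apply: ccontinuousD; [exact: ccontinuousM|exact: ccontinuous_cst].
Qed.

Lemma ccontinuous_sum (I : Type) (r : seq I) (f : I -> R -> C) :
  (forall i, ccontinuous (f i)) -> ccontinuous (fun x => \sum_(i <- r) f i x).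
Proof.
move=> cf; elim: r => [|i r IH].
  rewrite (_ : (fun x => _) = (fun=> 0)); first exact: ccontinuous_cst.
  by apply/funext => x; rewrite big_nil.
rewrite (_ : (fun x => _) = (fun x => f i x + \sum_(l <- r) f l x)).
  exact: ccontinuousD.
by apply/funext => x; rewrite big_cons.
Qed.

Lemma cisD (x y : R) : cis (x + y) = cis x * cis y.
Proof.
by rewrite /cis cosD sinD; apply/eqP; rewrite eq_complex/= eqxx/=; apply/eqP; ring.
Qed.

Lemma cis0 : cis 0 = 1 :> C.
Proof. by rewrite /cis cos0 sin0. Qed.

Lemma normc_cis (x : R) : nc (cis x) = 1.
Proof. by rewrite /= cos2Dsin2 sqrtr1. Qed.

Lemma cis_neq0 (x : R) : cis x != 0 :> C.
Proof.
apply/eqP => c0; have := normc_cis x; rewrite c0 ComplexField.Normc.normc0.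
by move/eqP; rewrite eq_sym oner_eq0.
Qed.

Lemma cisN (x : R) : cis (- x) = (cis x)^-1 :> C.
Proof.
by apply: (mulIf (cis_neq0 x)); rewrite -cisD addNr cis0 mulVf ?cis_neq0.
Qed.

Lemma cisX (x : R) k : cis x ^+ k = cis (k%:R * x) :> C.
Proof.
elim: k => [|k IH]; first by rewrite mul0r cis0.
by rewrite exprS IH -cisD -natr1 mulrDl mul1r addrC.
Qed.

Lemma rational_density_ccontinuous n (Sigma : R -> 'M[C]_n) i j :
  rational_density Sigma -> ccontinuous (fun x => Sigma x i j).
Proof.
move=> [a [b ab]].
rewrite (_ : (fun x => _) = (fun x => (a i j).[cis (- x)] * ((b i j).[cis (- x)])^-1)); last first.
  by apply/funext => x; rewrite (ab x i j).2.
have cN : ccontinuous (fun x : R => cis (- x)).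
  have := ccontinuous_cis (-1); congr ccontinuous.
  by apply/funext => x; rewrite mulN1r.
apply: ccontinuousM; first exact: ccontinuous_horner.
apply: ccontinuousV; first exact: ccontinuous_horner.
by move=> x; have [] := ab x i j.
Qed.

(** A rational density is continuous, and the autocovariances are its Fourier
    coefficients. *)
Lemma spectral_decorrelates (disp : measure_display) (T : measurableType disp)
    (P : probability T R) n (X : process T R n) (Sigma : R -> 'M[C]_n) s i :
  rational_density Sigma -> spectral_density P X Sigma ->
  fine (covariance P (coordp X (s + k%:Z) i) (coordp X s i)) @[k --> \oo] --> 0.
Proof.
move=> rS sS; have [cR cI] := rational_density_ccontinuous i i rS.
rewrite (_ : (fun k => _) = (fun k : nat =>
    circle_int (fun x => cos (k%:~R * x) * Re (Sigma x i i)) +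
    (-1) * circle_int (fun x => sin (k%:~R * x) * Im (Sigma x i i)))).
  apply: cvg0D; first exact: riemann_lebesgue_cos.
  by apply: cvg0Z; exact: riemann_lebesgue_sin.
apply/funext => k; have [-> _] := sS s k%:Z i i.
rewrite [LHS]/= -circle_intZ; last first.
  by apply: continuous_mul => //; exact: continuous_sinM.
rewrite -circle_intD; last 2 first.
- by apply: continuous_mul => //; exact: continuous_cosM.
- apply: continuous_mul; first exact: cst_continuous.
  by apply: continuous_mul => //; exact: continuous_sinM.
apply: eq_Rintegral => x _.
by case: (Sigma x i i) => a b /=; rewrite mulN1r.
Qed.

End ComplexCircle.

(** * Transfer functions on the unit circle *)

Section Transfer.
Variable R : realType.
Local Notation C := R[i].
Local Notation nc := (@ComplexField.Normc.normc R).
Local Notation toC := (real_complex R).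
Local Notation polyCx := (map_poly (real_complex R)).
Implicit Types (b : nat -> R) (w z : C) (d p : {poly R}).

Lemma normc_toC (a : R) : nc (toC a) = `|a|.
Proof. by rewrite /= expr0n addr0 sqrtr_sqr. Qed.

Lemma normc_ge0 z : 0 <= nc z.
Proof. by case: z => a b; exact: sqrtr_ge0. Qed.

Lemma normcX w k : nc w = 1 -> nc (w ^+ k) = 1.
Proof.
move=> w1; elim: k => [|k IH]; first by rewrite expr0 ComplexField.Normc.normc1.
by rewrite exprS ComplexField.Normc.normcM w1 IH mul1r.
Qed.

Lemma normc_sum (I : Type) (r : seq I) (f : I -> C) :
  nc (\sum_(i <- r) f i) <= \sum_(i <- r) nc (f i).
Proof.
elim: r => [|i r IH]; first by rewrite !big_nil ComplexField.Normc.normc0.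
by rewrite !big_cons (le_trans (le_normcD _ _))// lerD2l.
Qed.

Lemma normcB w z : nc (w - z) <= nc w + nc z.
Proof. by rewrite (le_trans (le_normcD _ _))// normcN. Qed.

Definition partial_transfer b w N := \sum_(k < N) toC (b k) * w ^+ k.

Lemma partial_transferS b w N :
  partial_transfer b w N.+1 = partial_transfer b w N + toC (b N) * w ^+ N.
Proof. by rewrite /partial_transfer big_ord_recr. Qed.

Lemma l1_cvg0 b : l1 b -> `|b n| @[n --> \oo] --> 0.
Proof. by move=> [M hM]; exact: (cvg0_bounded_sum _ hM). Qed.

Lemma pconvMX d b k : pconv (d * 'X) b k = if k is j.+1 then pconv d b j else 0.
Proof. by rewrite mulrC pconvM pconvX. Qed.

(** By induction on [d]: multiplication by [X] delays the coefficients by one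
    step, which shifts the partial sum up to a boundary term tending to zero. *)
Lemma pconv_transfer d b w : l1 b -> nc w = 1 ->
  nc (partial_transfer (pconv d b) w N - (polyCx d).[w] * partial_transfer b w N)
    @[N --> \oo] --> 0.
Proof.
move=> b1 w1; elim/poly_ind: d => [|d c IH].
  rewrite (_ : (fun N => _) = cst 0); first exact: cvg_cst.
  apply/funext => N; rewrite rmorph0 horner0 mul0r subr0 /partial_transfer.
  rewrite big1 ?ComplexField.Normc.normc0// => k _.
  by rewrite /pconv big1 ?rmorph0 ?mul0r// => j _; rewrite coef0 mul0r.
rewrite -(cvg_shiftn 1)/=.
apply: cvg0_le (cvg0D IH (cvg0Z (nc (polyCx d).[w]) (l1_cvg0 b1))) => N.
rewrite normc_ge0/= addn1.
rewrite [X in nc X <= _](_ : _ = w * (partial_transfer (pconv d b) w N -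
   (polyCx d).[w] * partial_transfer b w N) - (polyCx d).[w] * toC (b N) * w ^+ N.+1).
  rewrite (le_trans (normcB _ _))// !ComplexField.Normc.normcM w1 mul1r lerD2l.
  by rewrite normcX// mulr1 normc_toC.
have -> : partial_transfer (pconv (d * 'X + c%:P) b) w N.+1 =
   w * partial_transfer (pconv d b) w N + toC c * partial_transfer b w N.+1.
  rewrite /partial_transfer !mulr_sumr.
  under eq_bigr => k _.
    rewrite pconvDl pconvMX -[c%:P]mulr1 mul_polyC pconvZl pconv1 rmorphD rmorphM mulrDl -mulrA.
    over.
  rewrite big_split/=; congr (_ + _).
  rewrite big_ord_recl rmorph0 mul0r add0r; apply: eq_bigr => k _ /=.
  by rewrite /bump/= add1n exprS mulrCA.
rewrite partial_transferS rmorphD rmorphM/= map_polyX map_polyC/= hornerMXaddC exprS.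
by ring.
Qed.

(** The sum at [w] of the power series [b] such that [d b = p]. *)
Definition transfer p d w := (polyCx p).[w] / (polyCx d).[w].

(** On the unit circle the terms are dominated by those of a convergent series,
    so the convergence is uniform in [w]. *)
Lemma transfer_tail p d b : l1 b -> pconv d b =1 (fun k => p`_k) ->
  exists2 e : nat -> R, e N @[N --> \oo] --> 0 &
    forall w N, nc w = 1 -> (polyCx d).[w] != 0 ->
      nc (partial_transfer b w N - transfer p d w) <= e N.
Proof.
move=> b1 db; have [M hM] := b1.
have /cvg_ex[/= L cL] := cvg_bounded_sum (fun k => normr_ge0 (b k)) hM.
pose s := series (fun k => `|b k|).
exists (fun N => L - s N) => [|w N w1 dw].
  by rewrite -(subrr L); apply: cvgB => //; exact: cvg_cst.
have nd : nondecreasing_seq s.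
  by apply/nondecreasing_seqP => k; rewrite /s /series/= big_nat_recr//= lerDl.
have lim0 : nc (partial_transfer b w n - transfer p d w) @[n --> \oo] --> 0.
  rewrite -(cvg_shiftn (size p))/=.
  have := cvg0Z (nc (polyCx d).[w])^-1 (pconv_transfer d b1 w1).
  rewrite -(cvg_shiftn (size p))/=; apply: cvg0_le => n.
  rewrite normc_ge0/= -ComplexField.Normc.normcV -ComplexField.Normc.normcM.
  rewrite le_eqVlt; apply/orP; left; apply/eqP; rewrite -normcN opprB; congr nc.
  rewrite mulrBr mulKf// /transfer mulrC; congr (_ * _ - _).
  rewrite horner_coef size_map_poly addnC.
  rewrite /partial_transfer big_split_ord/= [X in _ = _ + X]big1 ?addr0.
    by apply: eq_bigr => k _; rewrite db coef_map.
  by move=> k _; rewrite db nth_default ?leq_addr// rmorph0 mul0r.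
have step k : nc (partial_transfer b w N - transfer p d w) <=
    nc (partial_transfer b w (N + k) - transfer p d w) + (s (N + k)%N - s N).
  elim: k => [|k IH]; first by rewrite addn0 subrr addr0.
  apply: (le_trans IH); rewrite addnS [s _.+1]/s/series/= big_nat_recr//=.
  rewrite -/(series _ _) -/s addrAC [X in _ <= _ + X]addrC [leRHS]addrA lerD2r.
  rewrite partial_transferS.
  rewrite [X in nc X <= _](_ : _ = (partial_transfer b w (N + k) +
    toC (b (N + k)%N) * w ^+ (N + k) - transfer p d w) - toC (b (N + k)%N) * w ^+ (N + k)).
    rewrite (le_trans (normcB _ _))// lerD2l ComplexField.Normc.normcM normcX// mulr1.
    by rewrite normc_toC.
  by ring.
rewrite -[leRHS]add0r.
have c : nc (partial_transfer b w k - transfer p d w) + (L - s N) @[k --> \oo] --> 0 + (L - s N).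
  by apply: cvgD; [exact: lim0|exact: cvg_cst].
apply: (cvgr_to_ge c); exists N => // k /= Nk.
rewrite -(subnKC Nk) (le_trans (step (k - N)%N))// lerD2l lerB//.
by have := nondecreasing_cvgn_le nd (cvgP _ cL) (N + (k - N))%N; rewrite (cvg_lim _ cL).
Qed.

End Transfer.

(** * Spectral density of a filtered white noise *)

Section Spectral.
Context (disp : measure_display) (T : measurableType disp) (R : realType).
Variable P : probability T R.
Local Notation process := (process T R).
Local Notation C := R[i].
Local Notation nc := (@ComplexField.Normc.normc R).
Local Notation toC := (real_complex R).
Local Notation polyCx := (map_poly (real_complex R)).

Variables (q : nat) (u : process q) (G : 'M[R]_q).
Hypothesis u2 : L2_process P u.
Hypothesis u0 : mean_process P u 0.
Hypothesis G_unit : G \in unitmx.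
Hypothesis uG : forall t s i j,
  covariance P (coordp u t i) (coordp u s j) = ((t == s)%:R * G i j)%:E.

Variables (m : nat) (B : nat -> 'M[R]_(m, q)) (d : {poly R}) (Q : 'M[{poly R}]_(m, q)).
Hypothesis B1 : forall i a, l1 (fun k => B k i a).
Hypothesis dB : forall i a, pconv d (fun k => B k i a) =1 (fun k => (Q i a)`_k).
Hypothesis d_circle : forall x : R, (polyCx d).[cis x] != 0.

Let tr i a w := transfer (Q i a) d w.

(** On the unit circle the conjugate of a real transfer function at [cis (- x)] is
    its value at [cis x]. *)
Definition filter_density (x : R) : 'M[C]_m := \matrix_(i, j)
  (toC (2 * pi)^-1 * \sum_a \sum_b toC (G a b) * (tr i a (cis (- x)) * tr j b (cis x))).

(** Turns a polynomial in [w^-1] into one in [w], up to a power of [w]: the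
    density of a filter involves [cis x] and [cis (- x)], while rational
    densities are quotients of polynomials in [cis (- x)]. *)
Lemma horner_inv_clear (p : {poly C}) n w : (size p <= n)%N -> w != 0 ->
  (\sum_(k < size p) p`_k *: 'X^(n - k)).[w] = p.[w^-1] * w ^+ n.
Proof.
move=> pn w0; rewrite horner_sum horner_coef mulr_suml; apply: eq_bigr => k _.
rewrite hornerZ hornerXn -mulrA; congr (_ * _).
have kn : (k <= n)%N by rewrite (leq_trans _ pn)// ltnW.
by rewrite -{2}(subnK kn) exprD mulrCA -exprMn mulVf// expr1n mulr1.
Qed.

Lemma filter_density_rational : rational_density filter_density.
Proof.
pose n := (size (polyCx d) + \sum_j \sum_b size (polyCx (Q j b)))%N.
pose inv (p : {poly C}) := \sum_(k < size p) p`_k *: 'X^(n - k).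
have inv_d w : w != 0 -> (inv (polyCx d)).[w] = (polyCx d).[w^-1] * w ^+ n.
  by apply: horner_inv_clear; rewrite leq_addr.
have inv_Q j b w : w != 0 -> (inv (polyCx (Q j b))).[w] = (polyCx (Q j b)).[w^-1] * w ^+ n.
  apply: horner_inv_clear; rewrite /n (bigD1 j)//= (bigD1 b)//=.
  by rewrite addnC -!addnA leq_addr.
exists (\matrix_(i, j) \sum_a \sum_b (toC (G a b))%:P * (polyCx (Q i a) * inv (polyCx (Q j b)))).
exists (\matrix_(i, j) ((toC (2 * pi))%:P * (polyCx d * inv (polyCx d)))) => x i j.
have w0 := cis_neq0 (- x); have wx : cis x = (cis (- x))^-1 :> C.
  by rewrite -cisN opprK.
have d1 := d_circle (- x); have d2 := d_circle x.
have pi0 : toC (2 * pi) != 0.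
  by rewrite fmorph_eq0 mulf_neq0 ?pnatr_eq0// gt_eqF// pi_gt0.
have wn : cis (- x) ^+ n != 0 :> C by rewrite expf_neq0.
rewrite !mxE; split.
  rewrite hornerM hornerC hornerM inv_d// -wx mulf_neq0// mulf_neq0//.
  by rewrite mulf_neq0.
rewrite hornerM hornerC hornerM inv_d// -wx horner_sum mulr_suml.
have -> : toC (2 * pi)^-1 = (toC (2 * pi))^-1 by exact: fmorphV.
rewrite mulr_sumr.
apply: eq_bigr => a _; rewrite horner_sum mulr_suml mulr_sumr; apply: eq_bigr => b _.
rewrite hornerM hornerC hornerM inv_Q// -wx /tr /transfer.
move: (toC (2 * pi)) pi0 => c c0.
by field; rewrite c0 d1 d2 wn.
Qed.

(** At frequency zero the density is a positive multiple of [Q(1) G Q(1)'], and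
    [G] is positive definite. *)
Lemma filter_density_neq0 : eval_mxp Q 1 != 0 -> filter_density 0 != 0.
Proof.
move=> Q1; have /existsP[i +] : [exists i, row i (eval_mxp Q 1) != 0].
  apply: contraNT Q1; rewrite negb_exists => /forallP Qi.
  by apply/eqP/row_matrixP => i; rewrite row0; apply/eqP; have := Qi i; rewrite negbK.
set x := row i _ => x0; apply: contra_neq x0 => S0.
apply: (white_noise_posdef u2 u0 G_unit uG).
have := congr1 (fun M : 'M[C]_m => M i i) S0; rewrite !mxE oppr0 cis0 => /eqP.
have d1 : (polyCx d).[1] != 0 by have := d_circle 0; rewrite cis0.
have pi0 : toC (2 * pi)^-1 != 0.
  by rewrite fmorph_eq0 invr_eq0 mulf_neq0 ?pnatr_eq0// gt_eqF// pi_gt0.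
rewrite mulf_eq0 (negbTE pi0)/= => /eqP S.
have ev (p : {poly R}) : (polyCx p).[1] = toC p.[1] by rewrite -horner_map rmorph1.
apply: (fmorph_inj toC); rewrite rmorph0.
rewrite -[RHS](mul0r ((polyCx d).[1] * (polyCx d).[1])) -S mulr_suml.
rewrite rmorph_sum; under eq_bigr do rewrite [(x *m G) _ _]mxE mulr_suml rmorph_sum.
rewrite exchange_big; apply: eq_bigr => a _; rewrite mulr_suml.
apply: eq_bigr => b _; rewrite /tr /transfer !ev !mxE !rmorphM/=.
by move: d1; rewrite ev; move: (toC d.[1]) (toC _) (toC _) (toC _) => *; field.
Qed.

(** Meant for [phi] the real or the imaginary part: it bounds both at once by
    the modulus. *)
Lemma pairing_integral_cvg (phi : C -> R) (f : nat -> R -> C) (g : R -> C) (e : nat -> R) :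
  (forall z w, phi (z - w) = phi z - phi w) -> (forall z, `|phi z| <= nc z) ->
  (forall N, continuous (phi \o f N)) -> continuous (phi \o g) ->
  (forall N x, nc (f N x - g x) <= e N) -> e N @[N --> \oo] --> 0 ->
  circle_int (phi \o f N) @[N --> \oo] --> circle_int (phi \o g).
Proof.
move=> phiB phin cf cg fg e0.
apply: cvg_of_norm (cvg0Z (2 * pi) e0) => N.
have cN : continuous (fun x => -1 * (phi \o g) x).
  by apply: continuous_mul => //; exact: cst_continuous.
rewrite -mulN1r -circle_intZ// -circle_intD//; apply: circle_int_le => [x|x].
  by apply: cvgD; [exact: cf|exact: cN].
by rewrite /= mulN1r -phiB (le_trans (phin _)).
Qed.

Definition partial_density N (x : R) i j : C :=
  toC (2 * pi)^-1 * \sum_a \sum_b toC (G a b) *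
    (partial_transfer (fun k => B k i a) (cis (- x)) N *
     partial_transfer (fun k => B k j b) (cis x) N).

(** A trigonometric polynomial, whose integral against [phi] picks out single
    frequencies. *)
Lemma partial_densityE N (h : int) (x : R) i j :
  cis (h%:~R * x) * partial_density N x i j =
  \sum_(k < N) \sum_(l < N) \sum_a \sum_b
    toC ((2 * pi)^-1 * (B k i a * B l j b * G a b)) *
      cis ((h - k%:Z + l%:Z)%:~R * x).
Proof.
rewrite /partial_density mulrA mulr_sumr.
under eq_bigr => a _.
  rewrite mulr_sumr.
  under eq_bigr => b _.
    rewrite /partial_transfer mulr_suml mulr_sumr mulr_sumr.
    under eq_bigr => k _.
      rewrite mulr_sumr mulr_sumr mulr_sumr.
      under eq_bigr => l _.
        rewrite (_ : _ * _ = toC ((2 * pi)^-1 * (B k i a * B l j b * G a b)) *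
          cis ((h - k%:Z + l%:Z)%:~R * x)); last first.
          rewrite !cisX intrD intrB !(mulrDl _ _ x) !cisD mulNr mulrN !rmorphM/=.
          by ring.
        over.
      over.
    over.
  rewrite exchange_big/=.
  under eq_bigr => k _ do rewrite exchange_big/=.
  over.
rewrite exchange_big/=; apply: eq_bigr => k _.
by rewrite exchange_big.
Qed.

(** The two transfer functions converge uniformly, hence so does their
    product. *)
Lemma partial_density_cvg i j : exists2 e : nat -> R, e N @[N --> \oo] --> 0 &
  forall N (x : R), nc (partial_density N x i j - filter_density x i j) <= e N.
Proof.
have e1 a := transfer_tail (B1 i a) (dB i a).
have e2 b := transfer_tail (B1 j b) (dB j b).
have [e e0 he] : exists2 e : 'I_q -> nat -> R, (forall a, e a N @[N --> \oo] --> 0) &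
   forall a N (x : R), nc (partial_transfer (fun k => B k i a) (cis x) N - tr i a (cis x)) <= e a N.
  have /choice[f hf] : forall a, exists f : nat -> R, f N @[N --> \oo] --> 0 /\
     forall N (x : R), nc (partial_transfer (fun k => B k i a) (cis x) N - tr i a (cis x)) <= f N.
    move=> a; have [f f0 hf] := e1 a; exists f; split => // N x.
    by apply: hf; rewrite ?normc_cis ?d_circle.
  by exists f => a; have [] := hf a.
have [f f0 hf] : exists2 e : 'I_q -> nat -> R, (forall a, e a N @[N --> \oo] --> 0) &
   forall a N (x : R), nc (partial_transfer (fun k => B k j a) (cis x) N - tr j a (cis x)) <= e a N.
  have /choice[f hf] : forall a, exists f : nat -> R, f N @[N --> \oo] --> 0 /\
     forall N (x : R), nc (partial_transfer (fun k => B k j a) (cis x) N - tr j a (cis x)) <= f N.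
    move=> a; have [f f0 hf] := e2 a; exists f; split => // N x.
    by apply: hf; rewrite ?normc_cis ?d_circle.
  by exists f => a; have [] := hf a.
have tr_bound (i' : 'I_m) a (x : R) (g : nat -> R) :
   (forall N (x : R), nc (partial_transfer (fun k => B k i' a) (cis x) N - tr i' a (cis x)) <= g N) ->
   nc (tr i' a (cis x)) <= g 0%N.
  by move=> hg; have := hg 0%N x; rewrite /partial_transfer big_ord0 sub0r normcN.
exists (fun N => (2 * pi)^-1 * \sum_a \sum_b `|G a b| *
   (e a N * f b N + (f b 0%N * e a N + e a 0%N * f b N))).
  apply: cvg0Z; apply: cvg0_sum => a; apply: cvg0_sum => b; apply: cvg0Z.
  apply: cvg0D; last by apply: cvg0D; apply: cvg0Z; [exact: e0|exact: f0].
  by rewrite -(mulr0 0); apply: cvgM; [exact: e0|exact: f0].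
move=> N x; rewrite /partial_density mxE -mulrBr ComplexField.Normc.normcM normc_toC.
rewrite ger0_norm; last by rewrite invr_ge0 mulr_ge0// pi_ge0.
apply: ler_wpM2l; first by rewrite invr_ge0 mulr_ge0// pi_ge0.
rewrite -sumrB (le_trans (normc_sum _ _))//; apply: ler_sum => a _.
rewrite -sumrB (le_trans (normc_sum _ _))//; apply: ler_sum => b _.
rewrite -mulrBr ComplexField.Normc.normcM normc_toC ler_wpM2l//.
set t := partial_transfer _ _ _; set s := partial_transfer _ _ _.
set t' := tr _ _ _; set s' := tr _ _ _.
have -> : t * s - t' * s' = (t - t') * (s - s') + (s' * (t - t') + t' * (s - s')) by ring.
have ht : nc (t - t') <= e a N by exact: he.
have hs : nc (s - s') <= f b N by exact: hf.
have ht' : nc t' <= e a 0%N by apply: tr_bound; exact: he.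
have hs' : nc s' <= f b 0%N by apply: tr_bound; exact: hf.
rewrite (le_trans (le_normcD _ _))// lerD//.
  by rewrite ComplexField.Normc.normcM ler_pM ?normc_ge0.
rewrite (le_trans (le_normcD _ _))// lerD// ComplexField.Normc.normcM.
  by rewrite ler_pM ?normc_ge0.
by rewrite ler_pM ?normc_ge0.
Qed.

Variable Z : process m.
Hypothesis Z2 : L2_process P Z.
Hypothesis BZ : L2_filter P B u Z.

Lemma ccontinuous_filter_density i j : ccontinuous (fun x => filter_density x i j).
Proof. exact/rational_density_ccontinuous/filter_density_rational. Qed.

Lemma ccontinuous_partial N h i j :
  ccontinuous (fun x : R => cis (h%:~R * x) * partial_density N x i j).
Proof.
rewrite (_ : (fun x => _) = (fun x => \sum_(k < N) \sum_(l < N) \sum_a \sum_b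
    toC ((2 * pi)^-1 * (B k i a * B l j b * G a b)) *
      cis ((h - k%:Z + l%:Z)%:~R * x))).
  do 4 (apply: ccontinuous_sum => ?).
  by apply: ccontinuousM; [exact: ccontinuous_cst|exact: ccontinuous_cis].
by apply/funext => x; rewrite partial_densityE.
Qed.

(** Integrating the truncated density term by term gives the autocovariances of
    the truncated filter. Both converge: the covariances by continuity of the
    inner product, the integrals because the densities converge uniformly. *)
Lemma filter_spectral_density : spectral_density P Z filter_density.
Proof.
move=> t h i j.
have [e e0 he] := partial_density_cvg i j.
have bound N x : nc (cis (h%:~R * x) * partial_density N x i j -
    cis (h%:~R * x) * filter_density x i j) <= e N.
  by rewrite -mulrBr ComplexField.Normc.normcM normc_cis mul1r.
have cF : ccontinuous (fun x : R => cis (h%:~R * x) * filter_density x i j).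
  by apply: ccontinuousM; [exact: ccontinuous_cis|exact: ccontinuous_filter_density].
(* To be used twice: for the real part, where [v] is [2 pi] times the indicator
   of 0, and for the imaginary part, where [v] is zero. *)
have part (phi : C -> R) (v : int -> R) :
    (forall z w, phi (z + w) = phi z + phi w) ->
    (forall (r : R) z, phi (toC r * z) = r * phi z) ->
    (forall z, `|phi z| <= nc z) -> (forall f, ccontinuous f -> continuous (phi \o f)) ->
    (forall n : int, circle_int (fun x => phi (cis (n%:~R * x))) = v n) ->
    \sum_(k < N) \sum_(l < N) \sum_a \sum_b (2 * pi)^-1 * (B k i a * B l j b * G a b) *
      v (h - k%:Z + l%:Z) @[N --> \oo] -->
    circle_int (phi \o (fun x => cis (h%:~R * x) * filter_density x i j)).
  move=> phiD phiZ phin phic phiv.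
  have phi0 : phi 0 = 0 by rewrite -(mulr0 (toC 0)) phiZ mul0r.
  have phiB z w : phi (z - w) = phi z - phi w.
    have <- : toC (-1) * w = - w by rewrite rmorphN rmorph1 mulN1r.
    by rewrite phiD phiZ mulN1r.
  have := pairing_integral_cvg phiB phin
    (fun N => phic _ (ccontinuous_partial N h i j)) (phic _ cF) bound e0.
  rewrite (_ : (fun N => circle_int _) = (fun N => \sum_(k < N) \sum_(l < N) \sum_a \sum_b
    (2 * pi)^-1 * (B k i a * B l j b * G a b) * v (h - k%:Z + l%:Z)))//.
  apply/funext => N.
  have cc (n : int) : continuous (fun x : R => phi (cis (n%:~R * x))).
    by apply: (phic (fun x : R => cis (n%:~R * x))); exact: ccontinuous_cis.
  transitivity (circle_int (fun x => \sum_(k < N) \sum_(l < N) \sum_a \sum_b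
    ((2 * pi)^-1 * (B k i a * B l j b * G a b)) * phi (cis ((h - k%:Z + l%:Z)%:~R * x)))).
    apply: eq_Rintegral => x _ /=; rewrite partial_densityE.
    do 4 (rewrite (big_morph phi phiD phi0); apply: eq_bigr => ? _).
    exact: phiZ.
  have cZ (r : R) n : continuous (fun x : R => r * phi (cis (n%:~R * x))).
    by apply: continuous_mul => //; exact: cst_continuous.
  rewrite circle_int_sum => [|k]; last by do 3 (apply: continuous_sum => ?).
  apply: eq_bigr => k _; rewrite circle_int_sum => [|l]; last by do 2 (apply: continuous_sum => ?).
  apply: eq_bigr => l _; rewrite circle_int_sum => [|a]; last by apply: continuous_sum => ?.
  apply: eq_bigr => a _; rewrite circle_int_sum//.
  by apply: eq_bigr => b _; rewrite circle_intZ// phiv.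
have pi0 : 2 * pi != 0 :> R by rewrite mulf_neq0 ?pnatr_eq0// gt_eqF// pi_gt0.
split.
  rewrite covE; try exact: Z2.
  have Z0 := L2_filter_mean0 u2 u0 Z2 BZ.
  rewrite !(mean_ip Z2 Z0) mxE mul0r subr0; congr (_%:E).
  have c1 := filter_ip_cvg u2 u0 uG (t := t + h) (s := t) (i := i) (j := j) Z2 BZ.
  apply: (cvg_unique _ c1); first exact: Rhausdorff.
  rewrite (_ : (fun N => \sum_(k < N) _) = (fun N => \sum_(k < N) \sum_(l < N) \sum_a \sum_b
     (2 * pi)^-1 * (B k i a * B l j b * G a b) * ((h - k%:Z + l%:Z == 0)%:R * (2 * pi)))).
    apply: (part (@complex.Re R) (fun n => (n == 0)%:R * (2 * pi))).
    - by move=> [? ?] [].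
    - by move=> r [? ?] /=; rewrite mul0r subr0.
    - by move=> z; rewrite -lecR; exact: normc_ge_Re.
    - by move=> f [].
    - by move=> n; rewrite -circle_int_cos.
  apply/funext => N; apply: eq_bigr => k _; apply: eq_bigr => l _.
  apply: eq_bigr => a _; apply: eq_bigr => b _.
  rewrite (_ : (t + h - k%:Z == t - l%:Z) = (h - k%:Z + l%:Z == 0)).
    by move: (2 * pi) pi0 => c c0; field.
  by rewrite -subr_eq0; congr (_ == _); ring.
have normc_ge_Im z : `|complex.Im z| <= nc z.
  case: z => a b /=; rewrite -sqrtr_sqr ler_sqrt ?addr_ge0 ?sqr_ge0//.
  by rewrite lerDr sqr_ge0.
apply: (cvg_unique _ (part (@complex.Im R) (fun=> 0) _ _ _ _ _)).
- exact: Rhausdorff.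
- by move=> [? ?] [].
- by move=> r [? ?] /=; rewrite mul0r addr0.
- exact: normc_ge_Im.
- by move=> f [].
- by move=> n; rewrite -(circle_int_sin R n).
rewrite (_ : (fun N => _) = cst 0); first exact: cvg_cst.
apply/funext => N; do 4 (apply: big1 => ? _).
by rewrite mulr0.
Qed.

End Spectral.

(** * Polynomial functions and genericity *)

Section PolynomialFunctions.
Variables (R : realType) (n : nat).
Local Notation V := 'rV[R]_n.

(** Being polynomial along every line reduces the study of the zero set to
    polynomials in one variable. *)
Definition polyfun (f : V -> R) :=
  continuous f /\ forall a b, exists g : {poly R}, forall t, f (a + t *: b) = g.[t].

Lemma polyfun_cst c : polyfun (fun=> c).
Proof.
by split; [exact: cst_continuous|move=> a b; exists c%:P => t; rewrite hornerC].
Qed.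

Lemma polyfun_coord i : polyfun (fun p : V => p 0 i).
Proof.
split; first exact: coord_continuous.
move=> a b; exists ((a 0 i)%:P + (b 0 i)%:P * 'X) => t.
by rewrite !mxE hornerD hornerC hornerM hornerC hornerX mulrC.
Qed.

Lemma polyfunD f g : polyfun f -> polyfun g -> polyfun (fun p => f p + g p).
Proof.
move=> [cf pf] [cg pg]; split; first by move=> p; apply: continuousD; [exact: cf|exact: cg].
move=> a b; have [u hu] := pf a b; have [v hv] := pg a b.
by exists (u + v) => t; rewrite hornerD hu hv.
Qed.

Lemma polyfunM f g : polyfun f -> polyfun g -> polyfun (fun p => f p * g p).
Proof.
move=> [cf pf] [cg pg]; split; first by move=> p; apply: continuousM; [exact: cf|exact: cg].
move=> a b; have [u hu] := pf a b; have [v hv] := pg a b.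
by exists (u * v) => t; rewrite hornerM hu hv.
Qed.

Lemma eq_polyfun f g : f =1 g -> polyfun f -> polyfun g.
Proof. by move=> /funext ->. Qed.

Lemma polyfunN f : polyfun f -> polyfun (fun p => - f p).
Proof.
move=> pf; apply: eq_polyfun (polyfunM (polyfun_cst (-1)) pf) => p.
by rewrite mulN1r.
Qed.

Lemma polyfun_sum (I : Type) (r : seq I) (Q : pred I) (f : I -> V -> R) :
  (forall i, polyfun (f i)) -> polyfun (fun p => \sum_(i <- r | Q i) f i p).
Proof.
move=> pf; elim: r => [|i r IH].
  by apply: eq_polyfun (polyfun_cst 0) => p; rewrite big_nil.
have [Qi|Qi] := boolP (Q i).
  by apply: eq_polyfun (polyfunD (pf i) IH) => p; rewrite big_cons Qi.
by apply: eq_polyfun IH => p; rewrite big_cons (negbTE Qi).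
Qed.

Lemma polyfun_prod (I : Type) (r : seq I) (f : I -> V -> R) :
  (forall i, polyfun (f i)) -> polyfun (fun p => \prod_(i <- r) f i p).
Proof.
move=> pf; elim: r => [|i r IH].
  by apply: eq_polyfun (polyfun_cst 1) => p; rewrite big_nil.
by apply: eq_polyfun (polyfunM (pf i) IH) => p; rewrite big_cons.
Qed.

Definition mx_polyfun m k (A : V -> 'M[R]_(m, k)) :=
  forall i j, polyfun (fun p => A p i j).

Lemma mx_polyfunM m k l (A : V -> 'M[R]_(m, k)) (B : V -> 'M[R]_(k, l)) :
  mx_polyfun A -> mx_polyfun B -> mx_polyfun (fun p => A p *m B p).
Proof.
move=> pA pB i j; apply: (@eq_polyfun (fun p => \sum_o A p i o * B p o j)).
  by move=> p; rewrite mxE.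
by apply: polyfun_sum => o; exact: polyfunM.
Qed.

Lemma polyfun_det m (A : V -> 'M[R]_m) : mx_polyfun A -> polyfun (fun p => \det (A p)).
Proof.
move=> pA; apply: polyfun_sum => s; apply: polyfunM; first exact: polyfun_cst.
by apply: polyfun_prod => i; exact: pA.
Qed.

Lemma mx_polyfun_adj m (A : V -> 'M[R]_m) :
  mx_polyfun A -> mx_polyfun (fun p => \adj (A p)).
Proof.
move=> pA i j; apply: (@eq_polyfun (fun p => cofactor (A p) j i)).
  by move=> p; rewrite mxE.
apply: polyfunM; first exact: polyfun_cst.
apply: polyfun_det => k l; apply: (@eq_polyfun (fun p => A p (lift j k) (lift i l))).
  by move=> p; rewrite !mxE.
exact: pA.
Qed.

Definition poly_polyfun (f : V -> {poly R}) := forall k, polyfun (fun p => (f p)`_k).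

Lemma eq_poly_polyfun f g : f =1 g -> poly_polyfun f -> poly_polyfun g.
Proof. by move=> /funext ->. Qed.

Lemma poly_polyfun_cst g : poly_polyfun (fun=> g).
Proof. by move=> k; exact: polyfun_cst. Qed.

Lemma poly_polyfunC f : polyfun f -> poly_polyfun (fun p => (f p)%:P).
Proof.
move=> pf k; apply: (@eq_polyfun (fun p => if k == 0%N then f p else 0)).
  by move=> p; rewrite coefC.
by case: (k == 0%N) => //; exact: polyfun_cst.
Qed.

Lemma poly_polyfunD f g : poly_polyfun f -> poly_polyfun g ->
  poly_polyfun (fun p => f p + g p).
Proof.
move=> pf pg k; apply: eq_polyfun (polyfunD (pf k) (pg k)) => p.
by rewrite coefD.
Qed.

Lemma poly_polyfunM f g : poly_polyfun f -> poly_polyfun g ->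
  poly_polyfun (fun p => f p * g p).
Proof.
move=> pf pg k.
apply: (@eq_polyfun (fun p => \sum_(i < k.+1) (f p)`_i * (g p)`_(k - i))).
  by move=> p; rewrite coefM.
by apply: polyfun_sum => i; exact: polyfunM.
Qed.

Lemma poly_polyfun_sum (I : Type) (r : seq I) (f : I -> V -> {poly R}) :
  (forall i, poly_polyfun (f i)) -> poly_polyfun (fun p => \sum_(i <- r) f i p).
Proof.
move=> pf k; apply: (@eq_polyfun (fun p => \sum_(i <- r) (f i p)`_k)).
  by move=> p; rewrite coef_sum.
by apply: polyfun_sum => i; exact: pf.
Qed.

Lemma poly_polyfun_prod (I : Type) (r : seq I) (f : I -> V -> {poly R}) :
  (forall i, poly_polyfun (f i)) -> poly_polyfun (fun p => \prod_(i <- r) f i p).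
Proof.
move=> pf; elim: r => [|i r IH].
  by apply: (@eq_poly_polyfun (fun=> 1)) (poly_polyfun_cst 1) => p; rewrite big_nil.
by apply: eq_poly_polyfun (poly_polyfunM (pf i) IH) => p; rewrite big_cons.
Qed.

Lemma poly_polyfun_det m (A : V -> 'M[{poly R}]_m) :
  (forall i j, poly_polyfun (fun p => A p i j)) -> poly_polyfun (fun p => \det (A p)).
Proof.
move=> pA; apply: poly_polyfun_sum => s.
apply: poly_polyfunM; first exact: poly_polyfun_cst.
by apply: poly_polyfun_prod => i; exact: pA.
Qed.

(** The zero set of a polynomial function that does not vanish identically is
    closed, and has empty interior because on the line through a point of the
    open set and a point where the function is nonzero there are finitely many
    zeros. *)
Lemma generically_polyfun (D : set V) (Q : V -> Prop) f p0 :
  open D -> polyfun f -> f p0 != 0 -> (forall p, D p -> f p != 0 -> Q p) ->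
  generically D Q.
Proof.
move=> oD [cf pf] fp0 fQ U oU UD; rewrite -subset0 => p [Up Dp].
have [g hg] := pf p (p0 - p).
have g0 : g != 0.
  apply: contra_neq fp0 => g0.
  by have := hg 1; rewrite g0 horner0 scale1r addrCA subrr addr0.
have oUD : open (U `&` D) by exact: openI.
have : \forall t \near (0 : R), (U `&` D) (p + t *: (p0 - p)).
  have c : {for (0 : R), continuous (fun t : R => p + t *: (p0 - p))}.
    by apply: continuousD; [exact: cst_continuous|exact: scalel_continuous].
  apply: (c (U `&` D)); rewrite scale0r addr0.
  exact: open_nbhs_nbhs.
move=> /nbhs_ballP[e /= e0 he].
(* More points of the segment inside the open set than [g] has roots. *)
pose ts := [seq e / (k.+2)%:R | k <- iota 0 (size g)].
have ts_uniq : uniq ts.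
  rewrite map_inj_uniq ?iota_uniq// => i j /(mulfI (lt0r_neq0 e0))/invr_inj/eqP.
  by rewrite eqr_nat => /eqP[].
have /allPn[t tts tg] : ~~ all (root g) ts.
  apply/negP => /(max_poly_roots g0)/(_ ts_uniq).
  by rewrite size_map size_iota ltnn.
have [Ut Dt] : (U `&` D) (p + t *: (p0 - p)).
  apply: he; rewrite /ball/= sub0r normrN; move: tts => /mapP[k _ ->].
  rewrite ger0_norm ?divr_ge0 ?ltW// ltr_pdivrMr ?ltr0n// ltr_pMr// ltr1n//.
have nb : nbhs (p + t *: (p0 - p)) (D `&` [set x | f x != 0]).
  apply: open_nbhs_nbhs; split; last by split => //=; rewrite hg.
  apply: openI => //.
  have -> : [set x | f x != 0] = f @^-1` [set~ 0] by apply/seteqP; split => y /= /eqP.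
  by move/continuousP : cf; apply; apply: closed_openC; exact: closed_eq.
have [x [[[Dx nQx] _] [_ fx]]] := UD _ (conj Ut Dt) _ nb.
by apply: nQx; exact: fQ.
Qed.

(** Along the line through [p0] and [p1] both functions are nonzero polynomials,
    and so is their product. *)
Lemma polyfun_neq0_common f g p0 p1 :
  polyfun f -> polyfun g -> f p0 != 0 -> g p1 != 0 -> exists p, f p * g p != 0.
Proof.
move=> [_ pf] [_ pg] f0 g1.
have [u hu] := pf p0 (p1 - p0); have [v hv] := pg p0 (p1 - p0).
have uv0 : u * v != 0.
  rewrite mulf_neq0//.
    by apply: contra_neq f0 => u0; have := hu 0; rewrite u0 horner0 scale0r addr0.
  apply: contra_neq g1 => v0; have := hv 1.
  by rewrite v0 horner0 scale1r addrCA subrr addr0.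
have /allPn[t _ tuv] : ~~ all (root (u * v)) [seq k%:R | k <- iota 0 (size (u * v))].
  apply/negP => /(max_poly_roots uv0).
  rewrite map_inj_uniq ?iota_uniq => [/(_ isT)|i j /eqP]; last by rewrite eqr_nat => /eqP.
  by rewrite size_map size_iota ltnn.
by exists (p0 + t *: (p1 - p0)); rewrite hu hv -hornerM.
Qed.

End PolynomialFunctions.

(** * Unimodular reduction of polynomial matrices *)

Section Unimodular.
Variable F : fieldType.
Local Notation P := {poly F}.

(** Euclidean elimination: among the unimodular multiples of the column whose top
    entry is nonzero, one of least degree has a top entry dividing the others. *)
Lemma unimodular_column n (v : 'M[P]_(1 + n, 1)) :
  exists2 W : 'M[P]_(1 + n), W \in unitmx & dsubmx (W *m v) = 0.
Proof.
have [->|v0] := eqVneq v 0.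
  by exists 1%:M; rewrite ?unitmx1// mulmx0 linear0.
pose good k := `[< exists W : 'M[P]_(1 + n), [/\ W \in unitmx, (W *m v) 0 0 != 0 &
  size ((W *m v) 0 0) = k] >].
have swap (A : 'M[P]_(1 + n, 1)) i : (perm_mx (tperm 0 i) *m A) 0 0 = A i 0.
  by rewrite -row_permE mxE tpermL.
have ex_good : exists k, good k.
  have [i vi] : exists i, v i 0 != 0.
    apply/existsP; apply: contraNT v0; rewrite negb_exists => /forallP vi.
    by apply/eqP/matrixP => i j; rewrite ord1 mxE; apply/eqP; have := vi i; rewrite negbK.
  exists (size (v i 0)); apply/asboolP; exists (perm_mx (tperm 0 i)).
  by split; rewrite ?unitmx_perm// swap.
(* A nonzero remainder in the division by the top entry could be swapped into
   its place, against the minimality of the degree. *)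
case: (ex_minnP ex_good) => k /asboolP[W [Wu Wv0 Wk]] kmin.
have [w wE] : exists w, W *m v = w by exists (W *m v).
rewrite wE in Wv0 Wk.
pose g := w 0 0.
pose Q : 'M[P]_(n, 1) := map_mx (fun x => x %/ g) (dsubmx w).
pose E : 'M[P]_(1 + n) := block_mx 1%:M 0 (- Q) 1%:M.
have Eu : E \in unitmx by rewrite unitmxE det_lblock !det1 mulr1 unitr1.
have uw : usubmx w = g%:M.
  by apply/matrixP => i j; rewrite !ord1 !mxE eqxx mulr1n; congr (w _ _); apply/val_inj.
pose rem : 'M[P]_(n, 1) := map_mx (fun x => x %% g) (dsubmx w).
have Ew : E *m w = col_mx g%:M rem.
  rewrite -[w in LHS]vsubmxK mul_block_col !mul1mx mul0mx addr0 uw; congr col_mx.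
  rewrite mulNmx; apply/matrixP => i j; rewrite !ord1 !mxE big_ord1 !mxE eqxx mulr1n.
  by rewrite [X in - _ + X](divp_eq _ g) addKr.
exists (E *m W); first by rewrite unitmx_mul Eu.
rewrite -mulmxA wE Ew col_mxKd; apply/matrixP => i j; rewrite ord1 [RHS]mxE.
apply/eqP; apply: contraT => r0.
have gi : (size (rem i ord0) < k)%N.
  by rewrite mxE -Wk ltn_modp.
have := kmin (size (rem i 0)).
rewrite leqNgt gi => h; apply: h.
apply/asboolP; exists (perm_mx (tperm 0 (rshift 1 i)) *m (E *m W)).
rewrite !unitmx_mul unitmx_perm Eu Wu -!mulmxA swap wE Ew col_mxEd.
by split.
Qed.

(** By induction on the columns. Elimination leaves a single entry in the first
    column, and the left inverse makes it a unit; the left inverse also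
    restricts to one of the lower right block. *)
Lemma unimodular_pid q m (M : 'M[P]_(m, q)) (B : 'M[P]_(q, m)) :
  B *m M = 1%:M -> exists2 W : 'M[P]_m, W \in unitmx & W *m M = pid_mx q.
Proof.
elim: q m M B => [|q IH] m M B BM.
  by exists 1%:M; rewrite ?unitmx1// mul1mx; apply/matrixP => i [].
case: m M B BM => [|m] M B BM.
  have := congr1 (fun A : 'M[P]_(q.+1) => A 0 0) BM; rewrite !mxE big_ord0 eqxx => /eqP.
  by rewrite eq_sym oner_eq0.
have [W Wu Wd] := unimodular_column (lsubmx (M : 'M[P]_(1 + m, 1 + q))).
pose g := ((W *m lsubmx (M : 'M[P]_(1 + m, 1 + q))) 0 0).
have Wl : W *m lsubmx (M : 'M[P]_(1 + m, 1 + q)) = col_mx g%:M 0.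
  rewrite -[LHS]vsubmxK Wd /g; congr col_mx; move: (W *m _) => w.
  by apply/matrixP => i j; rewrite !ord1 !mxE eqxx mulr1n; congr (w _ _); apply/val_inj.
pose B0 : 'M[P]_(1 + q, 1 + m) := B *m invmx W.
have BWM : B0 *m (W *m M) = 1%:M.
  by rewrite mulmxA -(mulmxA B) mulVmx// mulmx1.
clearbody B0; pose c := B0 0 0.
have cg : c * g = 1.
  have : (B0 *m (W *m lsubmx (M : 'M[P]_(1 + m, 1 + q)))) 0 0 = 1.
    by rewrite !mulmx_lsub BWM !mxE.
  rewrite Wl mxE big_split_ord/= big_ord1 col_mxEu mxE eqxx mulr1n big1 ?addr0.
    by move=> <-; congr (B0 _ _ * _); apply/val_inj.
  by move=> i _; rewrite col_mxEd mxE mulr0.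
pose Dg : 'M[P]_(1 + m) := block_mx c%:M 0 0 1%:M.
have Du : Dg \in unitmx.
  rewrite unitmxE det_ublock det1 mulr1 det_scalar1.
  by apply/unitrP; exists g; rewrite mulrC cg.
pose W1 := Dg *m W.
have W1u : W1 \in unitmx by rewrite unitmx_mul Du.
pose r := ursubmx (W1 *m M : 'M[P]_(1 + m, 1 + q)).
pose M' := drsubmx (W1 *m M : 'M[P]_(1 + m, 1 + q)).
have W1M : W1 *m M = block_mx 1%:M r 0 M' :> 'M[P]_(1 + m, 1 + q).
  have L : lsubmx (W1 *m M : 'M[P]_(1 + m, 1 + q)) = col_mx 1%:M 0.
    rewrite -mulmx_lsub -mulmxA Wl mul_block_col !mul0mx mulmx0 !addr0 mul_scalar_mx.
    by rewrite scale_scalar_mx cg.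
  apply: etrans (esym (submxK (W1 *m M : 'M[P]_(1 + m, 1 + q)))) _.
  rewrite /r /M'; move: (W1 *m M : 'M[P]_(1 + m, 1 + q)) L => A L.
  congr block_mx.
    by rewrite -(col_mxKu (1%:M : 'M[P]_1) (0 : 'M[P]_(m, 1))) -L; apply/matrixP => i j; rewrite !mxE.
  by rewrite -(col_mxKd (1%:M : 'M[P]_1) (0 : 'M[P]_(m, 1))) -L; apply/matrixP => i j; rewrite !mxE.
pose B1 : 'M[P]_(1 + q, 1 + m) := B *m invmx W1.
have B1M : B1 *m block_mx 1%:M r 0 M' = 1%:M.
  by rewrite -W1M mulmxA -(mulmxA B) mulVmx// mulmx1.
pose b := drsubmx B1.
have bM : b *m M' = 1%:M.
  move: B1M; rewrite -[B1]submxK mulmx_block !mulmx1 !mulmx0 !addr0.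
  by rewrite (@scalar_mx_block _ 1 q) => /eq_block_mx[_ _ ->]; rewrite mul0mx add0r.
have [W' W'u W'M] := IH _ M' b bM.
(* The left inverse [b] of the lower block serves to clear the first row. *)
pose W2 : 'M[P]_(1 + m) := block_mx 1%:M (- r *m b) 0 W'.
have W2u : W2 \in unitmx by rewrite unitmxE det_ublock det1 mul1r -unitmxE.
exists (W2 *m W1); first by rewrite unitmx_mul W2u.
rewrite -mulmxA W1M.
have -> : (pid_mx q.+1 : 'M[P]_(m.+1, q.+1)) =
    (block_mx 1%:M 0 0 (pid_mx q) : 'M[P]_(1 + m, 1 + q)).
  apply/matrixP => k l; case: (@split_ordP 1 m k) => k' ->; case: (@split_ordP 1 q l) => l' ->; rewrite ?ord1.
  - by rewrite (@block_mxEul _ 1 m 1 q) !mxE.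
  - by rewrite (@block_mxEur _ 1 m 1 q) !mxE.
  - by rewrite (@block_mxEdl _ 1 m 1 q) !mxE.
  - by rewrite (@block_mxEdr _ 1 m 1 q) !mxE/= !add1n eqSS ltnS.
have E : W2 *m block_mx 1%:M r 0 M' = block_mx 1%:M 0 0 (pid_mx q).
  rewrite mulmx_block !mul1mx !mul0mx !mulmx0 !add0r !addr0.
  by rewrite -mulmxA bM mulmx1 subrr W'M.
exact: E.
Qed.

End Unimodular.

(** * Evaluation, factorization and derivatives of matrix polynomials *)

Section PolyMatrix.
Variable R : realType.

Lemma eval_mxpM k l o (A : 'M[{poly R}]_(k, l)) (C : 'M[{poly R}]_(l, o)) x :
  eval_mxp (A *m C) x = eval_mxp A x *m eval_mxp C x.
Proof.
apply/matrixP => i j; rewrite !mxE horner_sum; apply: eq_bigr => t _.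
by rewrite hornerM !mxE.
Qed.

Lemma eval_mxp_const k l (A : 'M[R]_(k, l)) x : eval_mxp (const_mxp A) x = A.
Proof. by apply/matrixP => i j; rewrite !mxE hornerC. Qed.

Lemma eval_mxpD k l (A C : 'M[{poly R}]_(k, l)) x :
  eval_mxp (A + C) x = eval_mxp A x + eval_mxp C x.
Proof. by apply/matrixP => i j; rewrite !mxE hornerD. Qed.

Lemma eval_mxpN k l (A : 'M[{poly R}]_(k, l)) x : eval_mxp (- A) x = - eval_mxp A x.
Proof. by apply/matrixP => i j; rewrite !mxE hornerN. Qed.

Lemma eval_mxpZ k l a (A : 'M[{poly R}]_(k, l)) x :
  eval_mxp (a *: A) x = a.[x] *: eval_mxp A x.
Proof. by apply/matrixP => i j; rewrite !mxE hornerM. Qed.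

Lemma eval_mxp_det k (A : 'M[{poly R}]_k) x : \det (eval_mxp A x) = (\det A).[x].
Proof. by rewrite -[RHS]/(horner_eval x _) -det_map_mx; congr (\det _). Qed.

Lemma eval_mxp_adj k (A : 'M[{poly R}]_k) x : eval_mxp (\adj A) x = \adj (eval_mxp A x).
Proof. exact: (map_mx_adj (horner_eval x) A). Qed.

Lemma coef_mxp_eval0 k l (A : 'M[{poly R}]_(k, l)) : coef_mxp A 0 = eval_mxp A 0.
Proof. by apply/matrixP => i j; rewrite !mxE horner_coef0. Qed.

Lemma const_mxpM k l o (A : 'M[R]_(k, l)) (C : 'M[R]_(l, o)) :
  const_mxp (A *m C) = const_mxp A *m const_mxp C.
Proof. exact: map_mxM. Qed.

Lemma mxp_factor k l (A : 'M[{poly R}]_(k, l)) : eval_mxp A 1 = 0 ->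
  exists Q, A = (1 - 'X) *: Q.
Proof.
move=> A1; exists (map_mx (fun a => - (a %/ ('X - 1%:P))) A).
apply/matrixP => i j; rewrite !mxE mulrN -mulNr opprB mulrC divpK//.
by rewrite dvdp_XsubCl; apply/rootP; have /matrixP/(_ i j) := A1; rewrite !mxE.
Qed.

Definition deriv_at1 k l (A : 'M[{poly R}]_(k, l)) : 'M[R]_(k, l) :=
  map_mx (fun a : {poly R} => a^`().[1]) A.

Lemma deriv_at1_factor k l (Q : 'M[{poly R}]_(k, l)) :
  deriv_at1 ((1 - 'X) *: Q) = - eval_mxp Q 1.
Proof.
apply/matrixP => i j; rewrite !mxE derivM derivB derivC derivX !hornerE.
by ring.
Qed.

Lemma deriv_at1D k l (A B : 'M[{poly R}]_(k, l)) :
  deriv_at1 (A + B) = deriv_at1 A + deriv_at1 B.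
Proof. by apply/matrixP => i j; rewrite !mxE derivD hornerD. Qed.

Lemma deriv_at1N k l (A : 'M[{poly R}]_(k, l)) : deriv_at1 (- A) = - deriv_at1 A.
Proof. by apply/matrixP => i j; rewrite !mxE derivN hornerN. Qed.

Lemma deriv_at1_const k l (A : 'M[R]_(k, l)) : deriv_at1 (const_mxp A) = 0.
Proof. by apply/matrixP => i j; rewrite !mxE derivC horner0. Qed.

Lemma deriv_at1_mulC k l o (A : 'M[{poly R}]_(k, l)) (B : 'M[R]_(l, o)) :
  deriv_at1 (A *m const_mxp B) = deriv_at1 A *m B.
Proof.
apply/matrixP => i j; rewrite !mxE raddf_sum horner_sum; apply: eq_bigr => t _.
by rewrite /= !mxE derivM derivC mulr0 addr0 !hornerE.
Qed.

Lemma stable_det1 k (S : 'M[{poly R}]_k) : stable_mxp S -> eval_mxp S 1 \in unitmx.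
Proof.
move=> Sst; rewrite unitmxE eval_mxp_det unitfE; apply/eqP => S1.
have := Sst 1.
have -> : (map_poly (real_complex R) (\det S)).[1] = real_complex R (\det S).[1].
  by rewrite -horner_map rmorph1.
rewrite S1 rmorph0.
by move=> /(_ erefl); rewrite normr1 ltxx.
Qed.

End PolyMatrix.

(** * Resultants in formal degrees and finite inverse filters *)

(** Every term of the Leibniz formula has one factor from each row. *)
Lemma size_det_le (R : realType) m (A : 'M[{poly R}]_m) (e : 'I_m -> nat) :
  (forall i j, size (A i j) <= (e i).+1)%N -> (size (\det A) <= (\sum_i e i).+1)%N.
Proof.
move=> sA; apply: leq_trans (size_sum _ _ _) _; apply/bigmax_leqP => s _.
have -> : (-1) ^+ s = ((-1) ^+ s)%:P :> {poly R} by rewrite rmorphXn rmorphN rmorph1.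
rewrite mul_polyC; apply: leq_trans (size_scale_leq _ _) _.
apply: (big_ind2 (fun (p : {poly R}) n => (size p <= n.+1)%N)) => //.
  by rewrite size_poly1.
move=> p n q k pn qk; apply: leq_trans (size_polyMleq _ _) _.
by rewrite -subn1 leq_subLR add1n -addSn -addnS leq_add.
Qed.

Section Sylvester.
Variable F : fieldType.
Implicit Types f g : {poly F}.

(** The Sylvester matrix of [f] and [g] in the formal degrees [n1] and [n2]; unlike
    the one of the actual degrees, its size does not depend on [f] and [g]. *)
Definition formal_sylvester n1 n2 f g : 'M[F]_(n2 + n1) :=
  col_mx (\matrix_(i < n2) poly_rV ('X^i * f)) (\matrix_(j < n1) poly_rV ('X^j * g)).

Let comb n (v : 'rV[F]_n) f := \sum_(i < n) v 0 i *: ('X^i * f).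

Lemma combE n (v : 'rV[F]_n) f : comb v f = rVpoly v * f.
Proof.
rewrite /comb [rVpoly v]poly_def mulr_suml; apply: eq_bigr => i _.
by rewrite valK -scalerAl.
Qed.

Lemma mul_formal_sylvester n1 n2 f g (v : 'rV[F]_(n2 + n1)) :
  (size f <= n1.+1)%N -> (size g <= n2.+1)%N ->
  rVpoly (v *m formal_sylvester n1 n2 f g) =
  rVpoly (lsubmx v) * f + rVpoly (rsubmx v) * g.
Proof.
move=> sf sg; rewrite -[v in LHS]hsubmxK mul_row_col linearD/=.
have sX n i (h : {poly F}) k : (i < n)%N -> (size h <= k.+1)%N ->
    (size ('X^i * h)%R <= n + k)%N.
  move=> lt le; apply: leq_trans (size_polyMleq _ _) _.
  by rewrite size_polyXn/= -ltnS -addSn -addnS leq_add.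
have E n N (w : 'rV[F]_n) (h : {poly F}) : (forall i : 'I_n, (size ('X^i * h)%R <= N)%N) ->
    rVpoly (w *m \matrix_(i < n) (poly_rV ('X^i * h) : 'rV_N)) = rVpoly w * h.
  move=> sh; rewrite mulmx_sum_row linear_sum -combE; apply: eq_bigr => i _.
  by rewrite linearZ/= rowK poly_rV_K.
rewrite !E//.
- by move=> i; rewrite addnC sX.
- by move=> i; rewrite sX.
Qed.

(** The rows of the matrix are the products of [f] and [g] with monomials, so
    the solution of a linear system with the coefficients of [1] on the right is
    a pair of Bezout coefficients. *)
Lemma formal_sylvester_bezout n1 n2 f g : (0 < n2 + n1)%N ->
  (size f <= n1.+1)%N -> (size g <= n2.+1)%N ->
  \det (formal_sylvester n1 n2 f g) != 0 -> exists a b, a * f + b * g = 1.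
Proof.
move=> n0 sf sg d0.
have Su : formal_sylvester n1 n2 f g \in unitmx by rewrite unitmxE unitfE.
pose v := poly_rV 1 *m invmx (formal_sylvester n1 n2 f g).
exists (rVpoly (lsubmx v)), (rVpoly (rsubmx v)).
rewrite -mul_formal_sylvester// mulmxKV// poly_rV_K// size_poly1//.
Qed.

(** A vector in the kernel gives [a f + b = 0] with [b] of smaller degree than
    [f], so that [a = 0] and [b = 0]. *)
Lemma formal_sylvester_neq0 n1 n2 f : size f = n1.+1 ->
  \det (formal_sylvester n1 n2 f 1) != 0.
Proof.
move=> sf; rewrite -unitfE -unitmxE -row_free_unit; apply: inj_row_free => v v0.
have := mul_formal_sylvester (f := f) (g := 1) v; rewrite v0 linear0 sf size_poly1 mulr1.
move=> /(_ (leqnn _) (ltn0Sn _))/esym/eqP; rewrite addr_eq0 => /eqP fb.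
have f0 : f != 0 by rewrite -size_poly_gt0 sf.
have a0 : rVpoly (lsubmx v) = 0.
  apply/eqP; apply: contraT => a0.
  have : (size (rVpoly (rsubmx v)) <= n1)%N by exact: size_poly.
  rewrite -(size_polyN (rVpoly (rsubmx v))) -fb size_mul// sf addnS/=.
  by rewrite leqNgt -addn1 addnC leq_add2r lt0n size_poly_eq0 a0.
have b0 : rVpoly (rsubmx v) = 0 by apply/eqP; rewrite -oppr_eq0 -fb a0 mul0r.
rewrite -[v]hsubmxK -[lsubmx v]rVpolyK -[rsubmx v]rVpolyK a0 b0 !linear0.
by rewrite row_mx0.
Qed.

End Sylvester.

Section Zeroless.
Variable R : realType.

(** If [W] is unimodular and [W M] constant, then the normalization [W(0)^-1 W]
    sends [M] to [M(0)]. Its determinant is a nonzero constant, and thus has no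
    roots at all. *)
Lemma zeroless_inverse_filter q m (M : 'M[{poly R}]_(m, q)) (B : 'M[{poly R}]_(q, m)) :
  B *m M = 1%:M ->
  exists N : 'M[{poly R}]_m, [/\ eval_mxp N 0 = 1%:M,
    N *m M = const_mxp (eval_mxp M 0), stable_mxp N & eval_mxp N 1 \in unitmx].
Proof.
move=> /unimodular_pid[W Wu WM].
have [c cW c0] : exists2 c, \det W = c%:P & c != 0.
  move: Wu; rewrite unitmxE poly_unitE => /andP[/size_poly1P[c c0 ->] _].
  by exists c.
have W0u x : eval_mxp W x \in unitmx by rewrite unitmxE eval_mxp_det cW hornerC unitfE.
pose W0 := invmx (eval_mxp W 0).
have W00 : W0 \in unitmx by rewrite unitmx_inv.
exists (const_mxp W0 *m W).
have N0 : eval_mxp (const_mxp W0 *m W) 0 = 1%:M by rewrite eval_mxpM eval_mxp_const mulVmx.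
have NM : const_mxp W0 *m W *m M = const_mxp (W0 *m pid_mx q).
  rewrite -mulmxA WM; apply/matrixP => i j; rewrite !mxE rmorph_sum.
  apply: eq_bigr => t _; rewrite !mxE rmorphM/=; congr (_ * _).
  by case: (_ && _).
split=> //.
- by rewrite NM; congr const_mxp; rewrite -(eval_mxp_const (W0 *m _) 0) -NM eval_mxpM N0 mul1mx.
- move=> z; rewrite det_mulmx cW.
  have -> : \det (const_mxp W0) = (\det W0)%:P by rewrite det_map_mx.
  rewrite -polyCM map_polyC hornerC => /eqP; rewrite fmorph_eq0 mulf_eq0 (negbTE c0) orbF.
  by move: W00; rewrite unitmxE unitfE => /negbTE ->.
- by rewrite eval_mxpM eval_mxp_const unitmx_mul W00 W0u.
Qed.

End Zeroless.

(** * Parameters as polynomial functions *)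

Section Params.
Variables (R : realType) (c d q s1 s2 : nat).
Local Notation V := 'rV[R]_(nparam c d q s1 s2).

Lemma mkparam (x : 'M[R]_(c + d, d)) (y : 'M[R]_(q, d)) (D : 'M[R]_(c + d, q))
    (E : 'I_s1.+1 -> 'M[R]_(c + d, q)) (S : 'I_s2 -> 'M[R]_(c + d)) :
  exists p : V, [/\ xi p = x, Defs.eta p = y, Dmx p = D,
    (forall k, Ecoef p k = E k) & (forall k, Scoef p k = S k)].
Proof.
pose Ev := mxvec (\matrix_k mxvec (E k)); pose Sv := mxvec (\matrix_k mxvec (S k)).
exists (row_mx (mxvec x) (row_mx (mxvec y) (row_mx (mxvec D) (row_mx Ev Sv)))).
split.
- by rewrite /xi row_mxKl mxvecK.
- by rewrite /Defs.eta row_mxKr row_mxKl mxvecK.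
- by rewrite /Dmx !row_mxKr row_mxKl mxvecK.
- by move=> k; rewrite /Ecoef !row_mxKr row_mxKl mxvecK rowK mxvecK.
- by move=> k; rewrite /Scoef !row_mxKr mxvecK rowK mxvecK.
Qed.

Lemma mx_polyfun_xi : mx_polyfun (fun p : V => xi p).
Proof.
move=> i j; apply: (@eq_polyfun _ _ (fun p : V => p 0 _)) (polyfun_coord _ _).
by move=> p; rewrite !mxE.
Qed.

Lemma mx_polyfun_eta : mx_polyfun (fun p : V => Defs.eta p).
Proof.
move=> i j; apply: (@eq_polyfun _ _ (fun p : V => p 0 _)) (polyfun_coord _ _).
by move=> p; rewrite !mxE.
Qed.

Lemma mx_polyfun_D : mx_polyfun (fun p : V => Dmx p).
Proof.
move=> i j; apply: (@eq_polyfun _ _ (fun p : V => p 0 _)) (polyfun_coord _ _).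
by move=> p; rewrite !mxE.
Qed.

Lemma mx_polyfun_E k : mx_polyfun (fun p : V => Ecoef p k).
Proof.
move=> i j; apply: (@eq_polyfun _ _ (fun p : V => p 0 _)) (polyfun_coord _ _).
by move=> p; rewrite !mxE.
Qed.

Lemma mx_polyfun_S k : mx_polyfun (fun p : V => Scoef p k).
Proof.
move=> i j; apply: (@eq_polyfun _ _ (fun p : V => p 0 _)) (polyfun_coord _ _).
by move=> p; rewrite !mxE.
Qed.

End Params.

(** * Minors of M and the long-run response *)

Section Generic.
Variables (R : realType) (c d q s1 s2 : nat).
Local Notation V := 'rV[R]_(nparam c d q s1 s2).
Local Notation eta := Defs.eta.
Implicit Type p : V.

Definition xi_bottom p : 'M[R]_d := dsubmx (xi p).

(** Orthogonal to [xi] by Cramer's rule, hence with entries that are polynomial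
    in the parameters. *)
Definition xi_perp p : 'M[R]_(c + d, c) :=
  (row_mx (\det (xi_bottom p))%:M (- (usubmx (xi p) *m \adj (xi_bottom p))))^T.

Definition S_at1 p : 'M[R]_(c + d) := eval_mxp (Spoly p) 1.

(** The derivative [S'(1)]. *)
Definition S_deriv_at1 p : 'M[R]_(c + d) := \sum_(k < s2) k.+1%:R *: Scoef p k.

Lemma S_at1E p : S_at1 p = 1%:M + \sum_(k < s2) Scoef p k.
Proof.
apply/matrixP => i j; rewrite !mxE hornerD hornerMn hornerC !summxE horner_sum.
by congr (_ + _); apply: eq_bigr => k _; rewrite !mxE hornerM hornerXn hornerC expr1n mul1r.
Qed.

Lemma EpolyE p i j : Epoly p i j = \sum_(k < s1.+1) 'X^k * (Ecoef p k i j)%:P.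
Proof. by rewrite summxE; apply: eq_bigr => k _; rewrite !mxE. Qed.

Let addmxE (A : nzRingType) m n (M N : 'M[A]_(m, n)) i j : (M + N) i j = M i j + N i j.
Proof. by rewrite mxE. Qed.

Let scalemxE (A : nzRingType) m n a (M : 'M[A]_(m, n)) i j : (a *: M) i j = a * M i j.
Proof. by rewrite mxE. Qed.

Lemma Mpoly_top p x (i : 'I_c) j : Mpoly p x (lshift d i) j =
  ((x^T *m Dmx p) i j)%:P + (1 - 'X) * \sum_o (x o i)%:P * Epoly p o j.
Proof.
rewrite /Mpoly !addmxE !scalemxE !col_mxEu [(0 : 'M[{poly R}]_(_, _)) _ _]mxE mulr0 addr0.
congr (_ + _ * _); first by rewrite [LHS]mxE.
by rewrite [LHS]mxE; apply: eq_bigr => o _; rewrite !mxE.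
Qed.

Lemma Mpoly_bottom p x (i : 'I_d) j : Mpoly p x (rshift c i) j =
  (((xi p)^T *m xi p *m (eta p)^T) i j)%:P + (1 - 'X) * (((xi p)^T *m Dmx p) i j)%:P +
  (1 - 'X) ^+ 2 * \sum_o (xi p o i)%:P * Epoly p o j.
Proof.
rewrite /Mpoly !addmxE !scalemxE !col_mxEd.
congr (_ + _ * _ + _ * _); [by rewrite [LHS]mxE|by rewrite [LHS]mxE|].
by rewrite [LHS]mxE; apply: eq_bigr => o _; rewrite !mxE.
Qed.

(** A bound for the degree of a row of [M]: the last [d] rows involve
    [(1 - L)^2 E(L)] and the others only [(1 - L) E(L)]. *)
Definition rowdeg (r : 'I_(c + d)) : nat := s1.+1 + (c <= r).

Lemma size_Epoly p i j : (size (Epoly p i j) <= s1.+1)%N.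
Proof.
rewrite EpolyE; apply: leq_trans (size_sum _ _ _) _; apply/bigmax_leqP => k _.
rewrite mulrC mul_polyC (leq_trans (size_scale_leq _ _))// size_polyXn.
exact: ltn_ord.
Qed.

Lemma size_1BX : size (1 - 'X : {poly R}) = 2%N.
Proof. by rewrite -opprB size_polyN -polyC1 size_XsubC. Qed.

Lemma size_Mpoly p x r j : (size (Mpoly p x r j) <= (rowdeg r).+1)%N.
Proof.
have sE (y : 'I_(c + d) -> R) : (size (\sum_o (y o)%:P * Epoly p o j)%R <= s1.+1)%N.
  apply: leq_trans (size_sum _ _ _) _; apply/bigmax_leqP => o _.
  by rewrite mul_polyC (leq_trans (size_scale_leq _ _))// size_Epoly.
have s1X (f : {poly R}) n : (size f <= n)%N -> (size ((1 - 'X) * f)%R <= n.+1)%N.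
  move=> fn; rewrite (leq_trans (size_polyMleq _ _))// size_1BX/=.
  exact: fn.
case: (split_ordP r) => i ->; rewrite /rowdeg.
  have -> : (c <= lshift d i)%N = false by rewrite leqNgt /= ltn_ord.
  rewrite addn0 Mpoly_top (leq_trans (size_polyD _ _))// geq_max.
  by rewrite (leq_trans (size_polyC_leq1 _))// s1X.
have -> : (c <= rshift c i)%N by rewrite leq_addr.
rewrite addn1 Mpoly_bottom (leq_trans (size_polyD _ _))// geq_max.
apply/andP; split; last by rewrite expr2 -mulrA s1X// s1X.
rewrite (leq_trans (size_polyD _ _))// geq_max.
rewrite (leq_trans (size_polyC_leq1 _))//= (leq_trans (s1X _ 1%N _))//.
exact: size_polyC_leq1.
Qed.

Lemma mx_polyfun_xi_bottom : mx_polyfun xi_bottom.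
Proof.
move=> i j; apply: eq_polyfun (@mx_polyfun_xi R c d q s1 s2 (rshift c i) j) => p.
by rewrite [RHS]mxE.
Qed.

Lemma mx_polyfun_xi_perp : mx_polyfun xi_perp.
Proof.
move=> i j; have pb := mx_polyfun_xi_bottom.
case: (split_ordP i) => k ->.
  apply: (@eq_polyfun _ _ (fun p => \det (xi_bottom p) * (j == k)%:R)).
    by move=> p; rewrite [RHS]mxE row_mxEl [RHS]mxE mulr_natr.
  by apply: polyfunM; [exact: polyfun_det|exact: polyfun_cst].
apply: (@eq_polyfun _ _ (fun p => - (usubmx (xi p) *m \adj (xi_bottom p)) j k)).
  by move=> p; rewrite [RHS]mxE row_mxEr [RHS]mxE.
apply: polyfunN; apply: mx_polyfunM; last exact: mx_polyfun_adj.
move=> a b; apply: eq_polyfun (@mx_polyfun_xi R c d q s1 s2 (lshift d a) b) => p.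
by rewrite [RHS]mxE.
Qed.

Lemma mx_polyfun_tr m n (A : V -> 'M[R]_(m, n)) :
  mx_polyfun A -> mx_polyfun (fun p => (A p)^T).
Proof. by move=> pA i j; apply: eq_polyfun (pA j i) => p; rewrite mxE. Qed.

Lemma poly_polyfun_Epoly i j : poly_polyfun (fun p => Epoly p i j).
Proof.
apply: (@eq_poly_polyfun _ _ (fun p => \sum_(k < s1.+1) 'X^k * (Ecoef p k i j)%:P)).
  by move=> p; rewrite EpolyE.
apply: poly_polyfun_sum => k; apply: poly_polyfunM; first exact: poly_polyfun_cst.
exact/poly_polyfunC/mx_polyfun_E.
Qed.

Lemma poly_polyfun_Mpoly r j : poly_polyfun (fun p => Mpoly p (xi_perp p) r j).
Proof.
have pE (x : V -> 'I_(c + d) -> R) : (forall o, polyfun (x ^~ o)) ->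
    poly_polyfun (fun p => \sum_o (x p o)%:P * Epoly p o j).
  move=> px; apply: poly_polyfun_sum => o.
  by apply: poly_polyfunM; [exact: poly_polyfunC|exact: poly_polyfun_Epoly].
have pD := @mx_polyfun_D R c d q s1 s2; have pX := @mx_polyfun_xi R c d q s1 s2.
case: (split_ordP r) => i ->.
  apply: (@eq_poly_polyfun _ _ (fun p => ((((xi_perp p)^T *m Dmx p) i j)%:P +
    (1 - 'X) * \sum_o (xi_perp p o i)%:P * Epoly p o j))).
    by move=> p; rewrite Mpoly_top.
  apply: poly_polyfunD; last first.
    apply: poly_polyfunM; first exact: poly_polyfun_cst.
    by apply: pE => o; exact: mx_polyfun_xi_perp.
  apply: poly_polyfunC; apply: mx_polyfunM => //.
  exact/mx_polyfun_tr/mx_polyfun_xi_perp.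
apply: (@eq_poly_polyfun _ _ (fun p => (((xi p)^T *m xi p *m (eta p)^T) i j)%:P +
  (1 - 'X) * (((xi p)^T *m Dmx p) i j)%:P +
  (1 - 'X) ^+ 2 * \sum_o (xi p o i)%:P * Epoly p o j)).
  by move=> p; rewrite Mpoly_bottom.
apply: poly_polyfunD.
  apply: poly_polyfunD; last first.
    apply: poly_polyfunM; first exact: poly_polyfun_cst.
    apply: poly_polyfunC; apply: mx_polyfunM => //; exact: mx_polyfun_tr.
  apply: poly_polyfunC; apply: mx_polyfunM.
    by apply: mx_polyfunM => //; exact: mx_polyfun_tr.
  exact/mx_polyfun_tr/mx_polyfun_eta.
apply: poly_polyfunM; first exact: poly_polyfun_cst.
by apply: pE => o; exact: pX.
Qed.

Lemma polyfun_sylvester n1 n2 (f g : V -> {poly R}) :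
  poly_polyfun f -> poly_polyfun g ->
  polyfun (fun p => \det (formal_sylvester n1 n2 (f p) (g p))).
Proof.
move=> pf pg; apply: polyfun_det => i j.
have pX n (h : V -> {poly R}) : poly_polyfun h ->
    polyfun (fun p => ('X^n * h p)`_j).
  move=> ph; exact: (poly_polyfunM (@poly_polyfun_cst _ _ 'X^n) ph j).
case: (split_ordP i) => k ->.
  apply: eq_polyfun (pX k f pf) => p.
  by rewrite /formal_sylvester col_mxEu !mxE.
apply: eq_polyfun (pX k g pg) => p.
by rewrite /formal_sylvester col_mxEd !mxE.
Qed.

Definition minor (s : 'I_q -> 'I_(c + d)) p : {poly R} :=
  \det (\matrix_(i, j) Mpoly p (xi_perp p) (s i) j).

Definition minordeg (s : 'I_q -> 'I_(c + d)) := (\sum_i rowdeg (s i))%N.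

Lemma size_minor s p : (size (minor s p) <= (minordeg s).+1)%N.
Proof. by apply: size_det_le => i j; rewrite mxE size_Mpoly. Qed.

Lemma poly_polyfun_minor s : poly_polyfun (minor s).
Proof.
apply: poly_polyfun_det => i j.
by apply: eq_poly_polyfun (poly_polyfun_Mpoly (s i) j) => p; rewrite mxE.
Qed.

(** [det S(1)] times the long-run effect of the noise on the cointegrating
    combinations; the factor turns the inverse of [S(1)] into its adjugate and
    makes the entries polynomial in the parameters. *)
Definition long_run p : 'M[R]_(c, q) := (xi_perp p)^T *m
  (\det (S_at1 p) *: Dmx p + S_deriv_at1 p *m \adj (S_at1 p) *m xi p *m (eta p)^T).

Lemma mx_polyfun_S_at1 : mx_polyfun S_at1.
Proof.
move=> i j; apply: (@eq_polyfun _ _ (fun p => (i == j)%:R + \sum_(k < s2) Scoef p k i j)).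
  by move=> p; rewrite S_at1E !mxE summxE.
apply: polyfunD; first exact: polyfun_cst.
by apply: polyfun_sum => k; exact: mx_polyfun_S.
Qed.

Lemma mx_polyfun_long_run : mx_polyfun long_run.
Proof.
have pS := mx_polyfun_S_at1.
apply: mx_polyfunM; first exact/mx_polyfun_tr/mx_polyfun_xi_perp.
move=> i j; apply: (@eq_polyfun _ _ (fun p => \det (S_at1 p) * Dmx p i j +
  (S_deriv_at1 p *m \adj (S_at1 p) *m xi p *m (eta p)^T) i j)).
  by move=> p; rewrite !mxE.
apply: polyfunD; first by apply: polyfunM; [exact: polyfun_det|exact: mx_polyfun_D].
apply: mx_polyfunM; last exact/mx_polyfun_tr/mx_polyfun_eta.
apply: mx_polyfunM; last exact: mx_polyfun_xi.
apply: mx_polyfunM; last exact: mx_polyfun_adj.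
move=> k l; apply: (@eq_polyfun _ _ (fun p => \sum_(m < s2) m.+1%:R * Scoef p m k l)).
  by move=> p; rewrite [RHS]summxE; apply: eq_bigr => m _; rewrite [RHS]mxE.
apply: polyfun_sum => m; apply: polyfunM; first exact: polyfun_cst.
exact: mx_polyfun_S.
Qed.

End Generic.

(** * Generic parameters *)

Section Witness.
Variables (R : realType) (c d q s1 s2 : nat).
Local Notation V := 'rV[R]_(nparam c d q s1 s2).
Local Notation eta := Defs.eta.
Implicit Type p : V.
Hypothesis q_gt0 : (0 < q)%N.
Hypothesis q_lt_r : (q < c + d)%N.
Hypothesis c_gt0 : (0 < c)%N.

Definition first_rows (i : 'I_q) : 'I_(c + d) := widen_ord (ltnW q_lt_r) i.

Definition next_rows (i : 'I_q) : 'I_(c + d) :=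
  Ordinal (leq_ltn_trans (ltn_ord i) q_lt_r : (i.+1 < c + d)%N).

(** If it is nonzero then the two minors have no common root, so that [M(z)] has
    full column rank at every [z]. Two such sets of rows exist because
    [q < r]. *)
Definition sylvester_minors p : R :=
  \det (formal_sylvester (minordeg s1 first_rows) (minordeg s1 next_rows)
    (minor first_rows p) (minor next_rows p)).

Lemma xi_perp_std p : xi p = col_mx 0 1%:M -> (xi_perp p)^T = row_mx 1%:M 0.
Proof.
move=> xE; rewrite trmxK /xi_bottom xE col_mxKd col_mxKu det1 mul0mx oppr0.
by congr row_mx.
Qed.

(** With [xi = (0, I)'] the entries of [M] are free.  Taking it bidiagonal, with
    powers of [1 - z] of full degree on the diagonal and ones below it, makes one
    minor a power of [1 - z] of full degree and the other equal to one. *)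
Lemma sylvester_minors_neq0 : exists p : V, sylvester_minors p != 0.
Proof.
pose D0 : 'M[R]_(c + d, q) :=
  col_mx (\matrix_(i, j) (i == j.+1 :> nat)%:R) 0.
pose E0 (k : 'I_s1.+1) : 'M[R]_(c + d, q) :=
  \matrix_(i, j) ((i == j :> nat)%:R * ((1 - 'X) ^+ s1 : {poly R})`_k).
pose eta0 : 'M[R]_(q, d) := \matrix_(j, i) (c + i == j.+1)%N%:R.
have [p [px peta pD pE _]] := mkparam (s1 := s1) (s2 := s2)
  (col_mx 0 1%:M : 'M[R]_(c + d, d)) eta0 D0 E0 (fun=> 0).
have sX n : size ((1 - 'X) ^+ n : {poly R}) = n.+1.
  elim: n => [|n IH]; first by rewrite expr0 size_poly1.
  have x0 : 1 - 'X != 0 :> {poly R} by rewrite -size_poly_gt0 size_1BX.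
  by rewrite exprS size_mul ?expf_neq0// size_1BX IH.
have EE r j : Epoly p r j = (r == j :> nat)%:R * (1 - 'X) ^+ s1.
  rewrite EpolyE -[in RHS](coefK ((1 - 'X) ^+ s1)) sX poly_def mulr_sumr.
  apply: eq_bigr => k _; rewrite pE mxE -mul_polyC mulrC rmorphM/= rmorph_nat.
  by rewrite mulrA.
have ME r j : Mpoly p (xi_perp p) r j = (r == j.+1 :> nat)%:R +
    (r == j :> nat)%:R * (1 - 'X) ^+ (rowdeg s1 r).
  case: (split_ordP r) => i ->.
    have -> : rowdeg s1 (lshift d i) = s1.+1.
      by rewrite /rowdeg leqNgt /= ltn_ord addn0.
    rewrite Mpoly_top xi_perp_std// pD mul_row_col mul1mx mul0mx addr0 mxE rmorph_nat.
    congr (_ + _); rewrite (bigD1 (lshift d i))//= big1 => [|o oi].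
      have -> : xi_perp p (lshift d i) i = 1.
        by rewrite -[xi_perp p]trmxK mxE xi_perp_std// row_mxEl mxE eqxx.
      by rewrite addr0 mul1r EE/= mulrCA exprS.
    have -> : xi_perp p o i = 0.
      rewrite -[xi_perp p]trmxK mxE xi_perp_std//; move: oi.
      case: (split_ordP o) => o' -> oi; last by rewrite row_mxEr mxE.
      by rewrite row_mxEl mxE; move: oi; rewrite eq_shift eq_sym => /negbTE ->.
    by rewrite mul0r.
  have -> : rowdeg s1 (rshift c i) = s1.+2.
    by rewrite /rowdeg /= leq_addr addn1.
  rewrite Mpoly_bottom px peta pD tr_col_mx trmx0 trmx1 mul_row_col mul0mx mulmx1 add0r.
  rewrite mul1mx mul_row_col mul0mx mulmx0 addr0 !mxE rmorph_nat rmorph0 mulr0 addr0.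
  congr (_ + _); rewrite (bigD1 (rshift c i))//= big1 => [|o oi].
    by rewrite col_mxEd mxE eqxx mul1r addr0 EE/= mulrCA -exprD.
  case: (split_ordP o) oi => o' -> oi; first by rewrite col_mxEu mxE mul0r.
  rewrite col_mxEd mxE; move: oi; rewrite eq_shift => /negbTE ->.
  by rewrite mul0r.
exists p; rewrite /sylvester_minors.
have -> : minor next_rows p = 1.
  rewrite /minor -det_tr det_trig; last first.
    apply/is_trig_mxP => i j ij; rewrite [LHS]mxE [LHS]mxE ME /= eqSS.
    by rewrite !gtn_eqF ?mul0r ?addr0// ltnW// ltnS.
  apply: big1 => i _; rewrite [LHS]mxE [LHS]mxE ME /= eqxx gtn_eqF// mul0r addr0//.
apply: formal_sylvester_neq0.
rewrite /minor det_trig; last first.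
  apply/is_trig_mxP => i j ij; rewrite [LHS]mxE ME /=.
  by rewrite !ltn_eqF ?mul0r ?addr0// ltnW.
rewrite (eq_bigr (fun i => (1 - 'X) ^+ rowdeg s1 (first_rows i))).
  by rewrite -expr_sum sX.
by move=> i _; rewrite mxE ME /= eqxx ltn_eqF// add0r mul1r.
Qed.

(** For [S = I] and [eta = 0] the long-run effect is [xi_perp' D], and [D] is
    free. *)
Lemma long_run_neq0 : exists p : V,
  \det (xi_bottom p) * long_run p (Ordinal c_gt0) (Ordinal q_gt0) != 0.
Proof.
pose D0 : 'M[R]_(c + d, q) := col_mx (delta_mx (Ordinal c_gt0) (Ordinal q_gt0)) 0.
have [p [px peta pD _ pS]] := mkparam (s1 := s1) (s2 := s2)
  (col_mx 0 1%:M : 'M[R]_(c + d, d)) (0 : 'M[R]_(q, d)) D0 (fun=> 0) (fun=> 0).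
exists p; rewrite /xi_bottom px col_mxKd det1 mul1r /long_run xi_perp_std//.
rewrite S_at1E big1 => [|k _]; last by rewrite pS.
rewrite addr0 det1 scale1r peta trmx0 mulmx0 addr0 pD mul_row_col mul1mx mul0mx addr0.
by rewrite mxE !eqxx oner_eq0.
Qed.

(** Nonzero exactly when the two minors of [M] have a nonzero resultant, the
    bottom block of [xi] is invertible and one given entry of the long-run
    effect is nonzero. *)
Definition good p : R := sylvester_minors p *
  (\det (xi_bottom p) * long_run p (Ordinal c_gt0) (Ordinal q_gt0)).

(** The three conditions may be shown to be possible at different parameters,
    since a product of nonzero polynomial functions is nonzero somewhere. *)
Lemma generically_good (D : set V) (Q : V -> Prop) : open D ->
  (forall p, D p -> good p != 0 -> Q p) -> generically D Q.
Proof.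
move=> oD gQ.
have p1 : polyfun sylvester_minors.
  by apply: polyfun_sylvester; exact: poly_polyfun_minor.
have p2 : polyfun (fun p => \det (xi_bottom p) * long_run p (Ordinal c_gt0) (Ordinal q_gt0)).
  apply: polyfunM; first exact/polyfun_det/mx_polyfun_xi_bottom.
  exact: mx_polyfun_long_run.
have [a a0] := sylvester_minors_neq0; have [b b0] := long_run_neq0.
have [p0 gp0] := polyfun_neq0_common p1 p2 a0 b0.
exact: (generically_polyfun oD (polyfunM p1 p2) gp0 gQ).
Qed.

Section Good.
Variable p : V.
Hypothesis gp : good p != 0.

Let syl0 : sylvester_minors p != 0.
Proof. by move: gp; rewrite /good mulf_eq0 negb_or => /andP[]. Qed.

Lemma good_xi_bottom : \det (xi_bottom p) != 0.
Proof. by move: gp; rewrite /good !mulf_eq0 !negb_or => /and3P[]. Qed.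

Lemma good_long_run : long_run p != 0.
Proof.
have : long_run p (Ordinal c_gt0) (Ordinal q_gt0) != 0.
  by move: gp; rewrite /good !mulf_eq0 !negb_or => /and3P[].
by apply: contra_neq => ->; rewrite mxE.
Qed.

Lemma good_rank_xi : \rank (xi p) = d.
Proof.
apply/eqP; rewrite eqn_leq rank_leq_col /=.
have : row_free (xi_bottom p) by rewrite row_free_unit unitmxE unitfE good_xi_bottom.
move=> /eqP {1}<-.
have -> : xi_bottom p = row_mx 0 1%:M *m xi p.
  by rewrite -[xi p in RHS]vsubmxK mul_row_col mul0mx mul1mx add0r.
exact: mxrankM_maxr.
Qed.

(** Both matrices span the orthogonal complement of the columns of [xi], so that
    it is enough to study [xi_perp]. *)
Lemma good_xi_perp (x : 'M[R]_(c + d, c)) : is_xi_perp p x ->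
  exists2 K, K \in unitmx & x^T = K *m (xi_perp p)^T.
Proof.
move=> [rx x0].
have b0 := good_xi_bottom; have bu : xi_bottom p \in unitmx by rewrite unitmxE unitfE.
pose K := (\det (xi_bottom p))^-1 *: lsubmx x^T.
have xE : x^T = K *m (xi_perp p)^T.
  have : lsubmx x^T *m usubmx (xi p) + rsubmx x^T *m xi_bottom p = 0.
    by rewrite -mul_row_col hsubmxK vsubmxK.
  move/eqP; rewrite addrC addr_eq0 => /eqP E.
  have rE : rsubmx x^T = - (lsubmx x^T *m usubmx (xi p)) *m invmx (xi_bottom p).
    by rewrite -E mulmxK.
  rewrite -[LHS]hsubmxK /xi_perp trmxK mul_mx_row; congr row_mx.
    by rewrite mul_mx_scalar /K scalerA mulfV// scale1r.
  rewrite rE /K mulmxN mulNmx -scalemxAl; congr (- _).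
  by rewrite /invmx bu -scalemxAr mulmxA.
exists K => //; rewrite -row_full_unit -col_leq_rank.
apply: leq_trans (mxrankM_maxl K (xi_perp p)^T).
by rewrite -xE mxrank_tr rx.
Qed.

(** The adjugates of two square blocks of [M] are left inverses up to the
    minors, and Bezout coefficients of the minors combine them into a left
    inverse. *)
Lemma good_left_inverse (x : 'M[R]_(c + d, c)) : is_xi_perp p x ->
  exists B, B *m Mpoly p x = 1%:M.
Proof.
move=> /good_xi_perp[K Ku xE].
have [B BM] : exists B, B *m Mpoly p (xi_perp p) = 1%:M.
  have degs_gt0 : (0 < minordeg s1 next_rows + minordeg s1 first_rows)%N.
    rewrite addn_gt0; apply/orP; right.
    by rewrite /minordeg (bigD1 (Ordinal q_gt0))//= ltn_addr// /rowdeg addSn.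
  have [a [b ab]] := formal_sylvester_bezout degs_gt0
    (size_minor first_rows p) (size_minor next_rows p) syl0.
  pose sel (s : 'I_q -> 'I_(c + d)) : 'M[{poly R}]_(q, c + d) :=
    \matrix_(i, r) (s i == r)%:R.
  have selM s : sel s *m Mpoly p (xi_perp p) = \matrix_(i, j) Mpoly p (xi_perp p) (s i) j.
    apply/matrixP => i j; rewrite [LHS]mxE [RHS]mxE (bigD1 (s i))//= big1 => [|r ri].
      by rewrite [sel s _ _]mxE eqxx mul1r addr0.
    by rewrite [sel s _ _]mxE eq_sym (negbTE ri) mul0r.
  have adjM s : \adj (\matrix_(i, j) Mpoly p (xi_perp p) (s i) j) *m sel s *m
      Mpoly p (xi_perp p) = (minor s p)%:M.
    by rewrite -mulmxA selM mul_adj_mx.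
  exists (a *: (\adj (\matrix_(i, j) Mpoly p (xi_perp p) (first_rows i) j) *m sel first_rows) +
          b *: (\adj (\matrix_(i, j) Mpoly p (xi_perp p) (next_rows i) j) *m sel next_rows)).
  by rewrite mulmxDl -!scalemxAl !adjM !scale_scalar_mx -rmorphD/= ab.
have MK : Mpoly p x = block_mx (const_mxp K) 0 0 1%:M *m Mpoly p (xi_perp p).
  rewrite /Mpoly !mulmxDr -!scalemxAr !mul_block_col !mul0mx !mulmx0 !mul1mx !addr0 !add0r.
  by rewrite xE /const_mxp !map_mxM !mulmxA.
exists (B *m block_mx (const_mxp (invmx K)) 0 0 1%:M).
rewrite MK -mulmxA (mulmxA (block_mx _ _ _ _)) mulmx_block !mul0mx !mulmx0 !mul1mx !addr0 add0r.
rewrite -[const_mxp _ *m _]map_mxM mulVmx// map_mx1.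
by rewrite -scalar_mx_block mul1mx.
Qed.

(** If [(a, b)] is in the left kernel of [zeta], then [a x'] and [b xi'] are
    opposite and orthogonal, hence both zero. *)
Lemma good_zeta_unit (x : 'M[R]_(c + d, c)) : is_xi_perp p x -> zeta p x \in unitmx.
Proof.
move=> [rx x0]; rewrite -row_free_unit; apply: inj_row_free => v.
rewrite -[v]hsubmxK mul_row_col => v0.
have gram n m (A : 'M[R]_(n, m)) (y : 'rV[R]_n) : y *m A *m (y *m A)^T = 0 -> y *m A = 0.
  move: (y *m A) => w w0; apply/rowP => j; rewrite mxE.
  have := congr1 (fun M : 'M[R]_1 => M 0 0) w0; rewrite !mxE => /eqP.
  rewrite psumr_eq0 => [/allP/(_ j (mem_index_enum _))|i _]; rewrite mxE -expr2 ?sqr_ge0//.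
  by rewrite sqrf_eq0 => /eqP.
have rf n m (A : 'M[R]_(m, n)) (y : 'rV[R]_n) : \rank A = n -> y *m A^T = 0 -> y = 0.
  move=> rA yA; have Af : row_free A^T by rewrite /row_free mxrank_tr rA.
  by apply: (row_free_inj Af); rewrite mul0mx.
have xix : (xi p)^T *m x = 0 by rewrite -[LHS]trmxK trmx_mul trmxK x0 trmx0.
have b0 : rsubmx v *m (xi p)^T = 0.
  apply: gram; rewrite trmx_mul trmxK mulmxA.
  have := congr1 (fun M => M *m xi p) v0.
  rewrite mulmxDl mul0mx -(mulmxA _ x^T) x0 mulmx0 add0r => ->.
  by rewrite mul0mx.
move: v0; rewrite b0 addr0 => a0.
by rewrite (rf _ _ _ _ rx a0) (rf _ _ _ _ good_rank_xi b0) row_mx0.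
Qed.

End Good.

End Witness.

(** * Long-run and transitory response of the differenced process *)

Section Model.
Variables (R : realType) (c d q s1 s2 : nat).
Local Notation V := 'rV[R]_(nparam c d q s1 s2).
Local Notation eta := Defs.eta.
Variable p : V.
Local Notation S := (Spoly p).
Local Notation C := (Cpoly p).
Local Notation S1 := (S_at1 p).

Lemma Spoly0 : coef_mxp S 0 = 1%:M.
Proof.
apply/matrixP => i j; rewrite !mxE coefD coefMn coefC summxE coef_sum big1 ?addr0//.
by move=> k _; rewrite !mxE coefMC coefXn mul0r.
Qed.

Lemma Cpoly1 : eval_mxp C 1 = xi p *m (eta p)^T.
Proof.
rewrite !eval_mxpD !eval_mxpZ eval_mxp_const !hornerE subrr expr0n/=.
by rewrite !scale0r !addr0.
Qed.

Hypothesis Sst : stable_mxp S.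

Lemma S1_unit : S1 \in unitmx.
Proof. exact: stable_det1. Qed.

(** Long-run response of [(1 - L) F] to the noise. *)
Definition psi1 : 'M[R]_(c + d, q) := invmx S1 *m (xi p *m (eta p)^T).

(** The Beveridge-Nelson decomposition of [S^-1 C], multiplied by [S] to stay
    among polynomials. *)
Lemma transitory_poly : exists Q : 'M[{poly R}]_(c + d, q),
  C - S *m const_mxp psi1 = (1 - 'X) *: Q.
Proof.
apply: mxp_factor; rewrite eval_mxpD eval_mxpN eval_mxpM eval_mxp_const Cpoly1.
by rewrite mulmxA mulmxV ?S1_unit// mul1mx subrr.
Qed.

Section Transitory.
Variable Q : 'M[{poly R}]_(c + d, q).
Hypothesis QE : C - S *m const_mxp psi1 = (1 - 'X) *: Q.

(** Differentiate the decomposition at one, where the derivative of [C] is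
    [- D]. *)
Lemma transitory_at1 : eval_mxp Q 1 = Dmx p + S_deriv_at1 p *m psi1.
Proof.
apply: oppr_inj; rewrite -deriv_at1_factor -QE.
rewrite opprD deriv_at1D deriv_at1N; congr (_ - _).
  rewrite /Cpoly expr2 -scalerA 2!deriv_at1D !deriv_at1_factor deriv_at1_const.
  by rewrite eval_mxp_const eval_mxpZ !hornerE subrr scale0r oppr0 addr0.
rewrite deriv_at1_mulC; congr (_ *m _).
have d0 : deriv_at1 (0 : 'M[{poly R}]_(c + d)) = 0.
  by apply/matrixP => i j; rewrite !mxE deriv0 horner0.
rewrite deriv_at1D (_ : deriv_at1 1%:M = 0) ?add0r; last first.
  by apply/matrixP => i j; rewrite !mxE derivMn derivC mul0rn horner0.
rewrite (big_morph _ (@deriv_at1D _ _ _) d0); apply: eq_bigr => k _.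
apply/matrixP => i j; rewrite !mxE derivM derivC mulr0 addr0.
by rewrite derivXn/= hornerM hornerC hornerMn hornerXn expr1n.
Qed.

Variable H : nat -> 'M[R]_(c + d, q).
Hypothesis SH : mconv S H =1 coef_mxp Q.

(** Both sides have the same product with [S]. *)
Lemma response_split G k : is_inv_series S G -> series_mulr G C k =
  coef_mxp (const_mxp psi1) k + mconv (1 - 'X)%:M H k.
Proof.
move=> SG; move: k; apply: (mconv_inj Spoly0) => k.
rewrite (inv_seriesP _ SG) mconvDr mconv_coef -mconvM scalar_mxC mconvM (eq_mconv _ SH).
rewrite mconv_coef mul_scalar_mx -QE; move: C (S *m const_mxp psi1) => A B.
by apply/matrixP => i j; rewrite !mxE coefB addrC subrK.
Qed.

Lemma transitory_l1 i j : l1 (fun k => H k i j).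
Proof.
apply: (@l1_stable _ (\det S)).
- have := S1_unit; rewrite unitmxE eval_mxp_det unitfE.
  by apply: contra_neq => ->; rewrite horner0.
- exact: Sst.
- apply: l1_eq (l1_coef ((\adj S *m Q) i j)) => k.
  by rewrite (adj_mconv SH).
Qed.

(** Shows that the cointegrating combinations are filtered by a rational
    function with scalar denominator [det S]. *)
Lemma transitory_pconv (A : 'M[R]_(c, c + d)) i j :
  pconv (\det S) (fun k => (A *m H k) i j) =1
  (fun k => ((const_mxp A *m (\adj S *m Q)) i j)`_k).
Proof.
move=> k; rewrite mxE coef_sum.
rewrite (eq_pconv _ (e := fun k => \sum_o A i o * H k o j)).
  rewrite pconv_sumr; apply: eq_bigr => o _.
  by rewrite pconvZr (adj_mconv SH) !mxE coefCM; congr (_ * _).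
by move=> l; rewrite mxE.
Qed.

End Transitory.

Lemma xi_perp_mul_Cpoly x : is_xi_perp p x ->
  const_mxp x^T *m C = (1 - 'X) *: (const_mxp (x^T *m Dmx p) + (1 - 'X) *: (const_mxp x^T *m Epoly p)).
Proof.
move=> [_ x0]; rewrite !mulmxDr -!const_mxpM mulmxA x0 mul0mx.
rewrite -!scalemxAr -const_mxpM scalerDr scalerA -expr2.
by rewrite (_ : const_mxp 0 = 0) ?add0r//; apply/matrixP => i j; rewrite !mxE.
Qed.

(** [M] is [zeta C] where the factor [1 - L] of the first [c] rows has been
    removed. *)
Lemma MpolyE x : Mpoly p x =
  col_mx (const_mxp (x^T *m Dmx p) + (1 - 'X) *: (const_mxp x^T *m Epoly p))
         (const_mxp (xi p)^T *m C).
Proof.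
rewrite /Mpoly !scale_col_mx !add_col_mx scaler0 addr0; congr col_mx.
by rewrite !mulmxDr -!scalemxAr -!const_mxpM mulmxA.
Qed.

Lemma Mpoly0 x : is_xi_perp p x -> eval_mxp (Mpoly p x) 0 = zeta p x *m eval_mxp C 0.
Proof.
move=> hx; have := congr1 (fun A => eval_mxp A 0) (xi_perp_mul_Cpoly hx).
rewrite eval_mxpM eval_mxp_const eval_mxpZ !hornerE subr0 scale1r => E.
rewrite MpolyE /zeta mul_col_mx E -[(xi p)^T *m _](eval_mxp_const _ 0).
rewrite /eval_mxp map_col_mx; congr col_mx.
by rewrite -/(eval_mxp _ _) eval_mxpM eval_mxp_const -/(eval_mxp _ _) eval_mxp_const.
Qed.

End Model.

(** * Almost sure identities between processes *)

Section AlmostSure.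
Context (disp : measure_display) (T : measurableType disp) (R : realType).
Variable P : probability T R.
Local Notation process := (process T R).
Local Notation ipn := (seminorm (ip P)).
Local Notation L2i := (L2_semi_inner P).

Lemma ip_ae f f' g : L2 P f -> L2 P f' -> L2 P g ->
  (\forall w \ae P, f w = f' w) -> ip P f g = ip P f' g.
Proof.
move=> f2 f'2 g2 ff'; apply/eqP; rewrite -subr_eq0 -(ipBl L2i)// -normr_le0.
rewrite (le_trans (ip_le L2i _ g2))//; first exact: L2B.
by rewrite (ipn_ae f2 f'2 ff') mul0r.
Qed.

Lemma ip_cst1 : ip P (cst 1) (cst 1) = 1.
Proof. by rewrite -(sqr_ipn L2i) ?ipn_cst1 ?expr1n//; exact: L2_cst. Qed.

Lemma L2_shift f a : L2 P f -> L2 P (f + cst a).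
Proof. by move=> f2; apply: L2D => //; exact: L2_cst. Qed.

Lemma ip_shift1 f f' a : L2 P f -> L2 P f' -> (\forall w \ae P, f w = f' w + a) ->
  ip P f (cst 1) = ip P f' (cst 1) + a.
Proof.
move=> f2 f'2 ff'; rewrite (ip_ae f2 (L2_shift a f'2) (L2_cst P 1) ff').
rewrite (_ : cst a = a *: cst 1); last by apply/funext => w; exact/esym/mulr1.
have c1 := L2_cst P 1.
by rewrite ipDl ?ipZl ?ip_cst1 ?mulr1//; exact: L2Z.
Qed.

Lemma cov_shift_ae f f' g g' a b : L2 P f -> L2 P f' -> L2 P g -> L2 P g' ->
  (\forall w \ae P, f w = f' w + a) -> (\forall w \ae P, g w = g' w + b) ->
  covariance P f g = covariance P f' g'.
Proof.
move=> f2 f'2 g2 g'2 ff' gg'; rewrite !covE//; congr (_%:E).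
rewrite (ip_shift1 f2 f'2 ff') (ip_shift1 g2 g'2 gg').
have fa2 := L2_shift a f'2; have gb2 := L2_shift b g'2; have c1 := L2_cst P 1.
rewrite (ip_ae f2 fa2 g2 ff') ipC (ip_ae g2 gb2 fa2 gg').
have ca : forall a : R, cst a = a *: (cst 1 : T -> R).
  by move=> x; apply/funext => w; exact/esym/mulr1.
have L2c x : L2 P (x *: (cst 1 : T -> R)) by exact: L2Z.
rewrite (ca a) (ca b) in fa2 gb2 *.
rewrite ipDl// !(ipDr L2i)// !ipZl// !(ipZr L2i)// ip_cst1.
by rewrite (ipC P g' f') (ipC P (cst 1) f'); ring.
Qed.

Lemma spectral_density_stationary n (X : process n) k Sigma :
  L2_process P X -> mean_process P X k -> spectral_density P X Sigma ->
  weakly_stationary P X.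
Proof.
move=> X2 Xk sX; split=> //; first by exists k.
move=> t s h i j; have [+ _] := sX s (t - s) i j; have [+ _] := sX (s + h) (t - s) i j.
have -> : s + h + (t - s) = t + h by ring.
have -> : s + (t - s) = t by ring.
by move=> -> ->.
Qed.

(** Only countably many times matter, and a countable union of null sets is
    null. *)
Lemma lag_filter_ae m n (A : 'M[{poly R}]_(m, n)) (X Y : process n) :
  (forall t, \forall w \ae P, X t w = Y t w) ->
  forall t, \forall w \ae P, lag_filter A X t w = lag_filter A Y t w.
Proof.
move=> XY t; have [N _ hA] := lag_filter_coef T A.
have : \forall w \ae P, forall k : nat, X (t - k%:Z) w = Y (t - k%:Z) w.
  by apply: ae_foralln => k; exact: XY.
by apply: filterS => w XYw; rewrite !hA; apply: eq_bigr => k _; rewrite XYw.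
Qed.

Lemma lag_filterDr m n (A : 'M[{poly R}]_(m, n)) (X Y : process n) t w :
  lag_filter A (fun t w => X t w + Y t w) t w = lag_filter A X t w + lag_filter A Y t w.
Proof.
have [N _ hA] := lag_filter_coef T A; rewrite !hA -big_split/=.
by apply: eq_bigr => k _; rewrite mulmxDr.
Qed.

Lemma lag_filter_cst m n (A : 'M[{poly R}]_(m, n)) (v : 'cV[R]_n) t w :
  lag_filter A (fun (_ : int) (_ : T) => v) t w = eval_mxp A 1 *m v.
Proof.
apply/matrixP => i j; rewrite !mxE; apply: eq_bigr => l _; rewrite mxE ord1.
rewrite horner_coef mulr_suml; apply: eq_bigr => k _; by rewrite expr1n mulr1 (ord1 j).
Qed.

End AlmostSure.

(** * A combination with a spectral density has no random level *)

Lemma cvg0_const (R : realType) (a : R) : (fun _ : nat => a) n @[n --> \oo] --> 0 -> a = 0.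
Proof. by move=> a0; rewrite -(cvg_lim (@Rhausdorff R) a0) lim_cst. Qed.

Section Gap.
Context (disp : measure_display) (T : measurableType disp) (R : realType).
Variable P : probability T R.
Local Notation process := (process T R).
Local Notation ipn := (seminorm (ip P)).
Local Notation L2i := (L2_semi_inner P).

(** Two processes with the same differences stay at a constant random distance,
    by induction in both directions of time. *)
Lemma diff_process_ae n (X Y : process n) :
  (forall t, \forall w \ae P, diff_process X t w = diff_process Y t w) ->
  forall t, \forall w \ae P, X t w = Y t w + (X 0 w - Y 0 w).
Proof.
move=> XY.
have step (a b x y e : 'cV[R]_n) : a = b + e -> x - a = y - b -> x = y + e.
  by move=> -> /eqP; rewrite subr_eq => /eqP ->; rewrite addrA subrK.
elim/int_ind => [|k IH|k IH].
- by apply: aeW => w; rewrite addrC subrK.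
- have := XY (k.+1%:Z); apply: filterS2 IH => w; rewrite /diff_process.
  have -> : k.+1%:Z - 1 = k%:Z by rewrite intS addrAC subrr add0r.
  exact: step.
- have := XY (- k%:Z); apply: filterS2 IH => w; rewrite /diff_process.
  have -> : - k%:Z - 1 = - k.+1%:Z by rewrite intS opprD addrC.
  by move=> a b; apply: step a _; rewrite -opprB b opprB.
Qed.

Variables (q : nat) (u : process q) (G : 'M[R]_q).
Hypothesis u2 : L2_process P u.
Hypothesis u0 : mean_process P u 0.
Hypothesis uG : forall t s i j,
  covariance P (coordp u t i) (coordp u s j) = ((t == s)%:R * G i j)%:E.

(** By the previous lemma [X] and [Z] differ by a random variable [v] that is
    constant in time. The autocovariances of [X] vanish at infinity by the
    Riemann-Lebesgue lemma, and the products of [Z_n] with a fixed variable by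
    Bessel's inequality. In the limit [E(v^2) = k^2] for every coordinate; as
    [E(v) = k], the variance of [v] is zero. *)
Lemma stationary_gap m (B : nat -> 'M[R]_(m, q)) (X Z : process m) Sigma (k : 'cV[R]_m) :
  (forall i j, l1 (fun n => B n i j)) -> L2_process P Z -> L2_filter P B u Z ->
  L2_process P X -> mean_process P X k ->
  rational_density Sigma -> spectral_density P X Sigma ->
  (forall t, \forall w \ae P, diff_process X t w = diff_process Z t w) ->
  forall t, \forall w \ae P, X t w = Z t w + k.
Proof.
move=> B1 Z2 BZ X2 Xk rS sS XZ t.
have Z0 := L2_filter_mean0 u2 u0 Z2 BZ.
have XZv := diff_process_ae XZ.
suff vk : \forall w \ae P, X 0 w - Z 0 w = k.
  by apply: filterS2 (XZv t) vk => w -> ->.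
suff vki i : \forall w \ae P, (coordp X 0 i - coordp Z 0 i) w = k i ord0.
  have : \forall w \ae P, forall i, (coordp X 0 i - coordp Z 0 i) w = k i ord0.
    by apply: filter_forall => i; exact: vki.
  by apply: filterS => w vw; apply/colP => i; rewrite !mxE -vw.
pose v := coordp X 0 i - coordp Z 0 i.
have v2 : L2 P v by apply: L2B; [exact: X2|exact: Z2].
have X2i s : L2 P (coordp X s i) by exact: X2.
have Z2i s : L2 P (coordp Z s i) by exact: Z2.
have c2 := L2_cst P 1.
have Zv s : L2 P (coordp Z s i + v) by exact: L2D.
have XvE s : \forall w \ae P, coordp X s i w = (coordp Z s i + v) w.
  by apply: filterS (XZv s) => w; rewrite /v /coordp !fctE => ->; rewrite !mxE.
have v1 : ip P v (cst 1) = k i ord0.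
  by rewrite (ipBl L2i)// (mean_ip X2 Xk) (mean_ip Z2 Z0) mxE subr0.
have ipX s n : ip P (coordp X (s + n) i) (coordp X s i) =
    ip P (coordp Z (s + n) i) (coordp Z s i + v) + ip P v (coordp Z s i + v).
  by rewrite (ip_ae _ (Zv _) _ (XvE _))// ipC (ip_ae _ (Zv _) _ (XvE _))// ipC ipDl.
(* The covariance of [X_(n+j)] and [X_n] tends to 0 as [j] grows. *)
have vZ (n : nat) : ip P v (coordp Z n%:Z i) + ip P v v = k i ord0 ^+ 2.
  have cX := spectral_decorrelates n%:Z i rS sS.
  have cZ := filter_decorrelates u2 u0 uG i B1 Z2 BZ (Zv n%:Z).
  have cZn : ip P (coordp Z (n%:Z + j%:Z) i) (coordp Z n%:Z i + v) @[j --> \oo] --> 0.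
    by move: cZ; rewrite -(cvg_shiftn n); under eq_fun do rewrite PoszD addrC.
  have := cvgB cX cZn; rewrite subr0.
  rewrite (_ : _ - _ = cst (ip P v (coordp Z n%:Z i) + ip P v v - k i ord0 ^+ 2)).
    by move=> c0; apply/eqP; rewrite -subr_eq0; apply/eqP/cvg0_const/c0.
  apply/funext => j.
  rewrite -[LHS]/(fine (covariance P (coordp X (n%:Z + j%:Z) i) (coordp X n%:Z i)) -
    ip P (coordp Z (n%:Z + j%:Z) i) (coordp Z n%:Z i + v)) covE//= !(mean_ip X2 Xk) ipX (ipDr L2i _ _ v2)//.
  by ring.
(* Let [n] grow in turn. *)
have vv : ip P v v = k i ord0 ^+ 2.
  have := filter_decorrelates u2 u0 uG i B1 Z2 BZ v2.
  rewrite (_ : (fun n : nat => _) = cst (k i ord0 ^+ 2 - ip P v v)); last first.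
    by apply/funext => n; rewrite -(vZ n) ipC addrK.
  by move=> c0; apply/esym/eqP; rewrite -subr_eq0; apply/eqP/cvg0_const/c0.
pose kc : T -> R := k i ord0 *: cst 1.
have kc2 : L2 P kc by exact: L2Z.
have vk2 := L2B v2 kc2.
suff : ipn (v - kc) = 0.
  move=> /(ipn0_ae vk2); apply: filterS => w vw; apply/eqP; rewrite -subr_eq0; apply/eqP.
  transitivity (v w - kc w); last exact: vw.
  by congr (_ - _); exact/esym/mulr1.
apply/eqP; rewrite -(@eqrXn2 _ 2%N) ?ipn_ge0// expr0n/= (sqr_ipn L2i)//; apply/eqP.
rewrite (ipBl L2i v2 kc2 vk2) !(ipBr L2i v2 kc2)// /kc !(ipZr L2i)// !ipZl//.
by rewrite ip_cst1 (ipC _ (cst 1)) v1 vv; ring.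
Qed.

End Gap.

(** * Solutions determined by the mean of the cointegrating combinations *)

Section RandomWalk.
Context (disp : measure_display) (T : measurableType disp) (R : realType).
Variable P : probability T R.
Variables (q : nat) (u : process T R q).

(** Summed forwards after time 0 and backwards up to it, so that its differences
    are [u] at all integer times. *)
Definition random_walk : process T R q := fun t w =>
  match t with
  | Posz n => \sum_(k < n) u k.+1%:Z w
  | Negz n => - \sum_(k < n.+1) u (- k%:Z) w
  end.

Lemma diff_random_walk : diff_process random_walk = u.
Proof.
apply/funext => -[[|n]|n]; apply/funext => w; rewrite /diff_process.
- by rewrite /= big_ord0 big_ord_recl big_ord0 addr0 sub0r opprK oppr0.
- rewrite (_ : n.+1%:Z - 1 = n%:Z); last by rewrite intS addrAC subrr add0r.
  by rewrite /= big_ord_recr/= addrAC subrr add0r.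
- rewrite (_ : Negz n - 1 = Negz n.+1); last by rewrite !NegzE (intS n.+1) opprD addrC.
  by rewrite /= [in X in _ - X]big_ord_recr/= opprK addrA addNr add0r NegzE.
Qed.

Lemma L2_random_walk : L2_process P u -> L2_process P random_walk.
Proof.
move=> u2 t i; have L2s n (v : nat -> int) : L2 P (\sum_(k < n) coordp u (v k) i).
  by apply: L2_sum => k; exact: u2.
case: t => n.
  rewrite (_ : coordp _ _ _ = \sum_(k < n) coordp u k.+1%:Z i); first exact: (L2s n (fun k => k.+1%:Z)).
  by apply/funext => w; rewrite /coordp/= summxE fct_sumE.
rewrite (_ : coordp _ _ _ = - \sum_(k < n.+1) coordp u (- k%:Z) i); first exact/L2N/(L2s n.+1 (fun k => - k%:Z)).
apply/funext => w; rewrite /coordp/= mxE summxE -[RHS]/(- ((\sum_(k < n.+1) (fun w => u (- k%:Z) w i ord0)) w)).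
by rewrite fct_sumE.
Qed.

End RandomWalk.

Section Model.
Context (disp : measure_display) (T : measurableType disp) (R : realType).
Variable P : probability T R.
Local Notation process := (process T R).
Local Notation L2i := (L2_semi_inner P).
Local Notation eta := Defs.eta.
Variables (q : nat) (u : process q) (G : 'M[R]_q).
Hypothesis u2 : L2_process P u.
Hypothesis u0 : mean_process P u 0.
Hypothesis G_unit : G \in unitmx.
Hypothesis uG : forall t s i j,
  covariance P (coordp u t i) (coordp u s j) = ((t == s)%:R * G i j)%:E.
Variables (c d s1 s2 : nat) (p : 'rV[R]_(nparam c d q s1 s2)).
Local Notation S := (Spoly p).
Local Notation S1 := (S_at1 p).
Hypothesis Sst : stable_mxp S.
Variable x : 'M[R]_(c + d, c).
Hypothesis hx : is_xi_perp p x.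

Local Notation beta := (betamx p x).

Lemma beta_trE : beta^T = x^T *m S1.
Proof. by rewrite trmx_mul trmxK. Qed.

(** The long-run response does not reach the cointegrating combinations. *)
Lemma beta_psi1 : beta^T *m psi1 p = 0.
Proof.
by rewrite beta_trE mulmxA mulmxK ?S1_unit// mulmxA hx.2 mul0mx.
Qed.

Lemma stable_circle (y : R) : (map_poly (real_complex R) (\det S)).[cis y] != 0.
Proof.
apply/eqP => /Sst; rewrite (_ : `|cis y| = real_complex R (ComplexField.Normc.normc (cis y)))//.
by rewrite normc_cis rmorph1 ltxx.
Qed.

Variables (Q : 'M[{poly R}]_(c + d, q)) (H : nat -> 'M[R]_(c + d, q)).
Hypothesis QE : Cpoly p - S *m const_mxp (psi1 p) = (1 - 'X) *: Q.
Hypothesis SH : mconv S H =1 coef_mxp Q.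
Variable Y : process (c + d).
Hypothesis Y2 : L2_process P Y.
Hypothesis HY : L2_filter P H u Y.

Definition gap_coef k : 'M[R]_(c, q) := beta^T *m H k.

(** The deviation of the cointegrating combinations from their mean. *)
Definition gap : process c := mul_process beta^T Y.

(** The numerator of the transfer function of [gap], over the denominator
    [det S]. *)
Definition gap_num : 'M[{poly R}]_(c, q) := const_mxp beta^T *m (\adj S *m Q).

Definition gap_density := filter_density G (\det S) gap_num.

Lemma L2_gap : L2_process P gap.
Proof. exact: L2_mul_process. Qed.

Lemma gap_filter : L2_filter P gap_coef u gap.
Proof. exact: L2_filter_mul. Qed.

Lemma gap_l1 i j : l1 (fun k => gap_coef k i j).
Proof. exact: l1_mconv_const (transitory_l1 Sst SH). Qed.

Lemma gap_density_rational : rational_density gap_density.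
Proof. exact/filter_density_rational/stable_circle. Qed.

Lemma gap_spectral_density : spectral_density P gap gap_density.
Proof.
apply: (filter_spectral_density u2 u0 uG gap_l1 _ stable_circle L2_gap gap_filter).
exact: transitory_pconv.
Qed.

Lemma stationary_near_gap (X : process c) k : L2_process P X ->
  (forall t, \forall w \ae P, X t w = gap t w + k) ->
  [/\ mean_process P X k, spectral_density P X gap_density & weakly_stationary P X].
Proof.
move=> X2 XZ; have Z2 := L2_gap.
have XZi t i : \forall w \ae P, coordp X t i w = coordp gap t i w + k i ord0.
  by apply: filterS (XZ t) => w; rewrite /coordp => ->; rewrite mxE.
have Xk : mean_process P X k.
  move=> t i; rewrite (ip1E (X2 t i)) (ip_shift1 (X2 _ _) (Z2 _ _) (XZi t i)).
  have := L2_filter_mean0 u2 u0 Z2 gap_filter => /(mean_ip Z2) ->.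
  by rewrite mxE add0r.
have sX : spectral_density P X gap_density.
  move=> t h i j; rewrite (cov_shift_ae (X2 _ _) (Z2 _ _) (X2 _ _) (Z2 _ _) (XZi _ i) (XZi _ j)).
  exact: gap_spectral_density.
by split=> //; exact: spectral_density_stationary Xk sX.
Qed.

Hypothesis zu : zeta p x \in unitmx.

Lemma L2_diff_process n (X : process n) : L2_process P X -> L2_process P (diff_process X).
Proof.
move=> X2 t i; rewrite (_ : coordp _ _ _ = coordp X t i - coordp X (t - 1) i).
  by apply: L2B; exact: X2.
by apply/funext => w; rewrite !fctE /coordp !mxE.
Qed.

(** Accumulate the long-run response, add the transitory one and a constant
    [w0]: the differences are right whatever [w0] is, [beta] annihilates the
    random walk, and [beta' w0 = k] for a suitable [w0]. *)
Lemma determined_exists k : exists F, determined P u p x k F.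
Proof.
have [Ginv SG] : exists Ginv, is_inv_series S Ginv.
  by have [Ginv SG] := mconv_solve (fun k => (k == 0%N)%:R%:M : 'M[R]__) (Spoly0 p); exists Ginv.
(* The preimage of [(k, 0)] under [zeta S(1)], whose first block is [beta']. *)
pose w0 := invmx S1 *m (invmx (zeta p x) *m col_mx k 0).
pose F : process (c + d) := fun t w => psi1 p *m random_walk u t w + Y t w + w0.
have bw0 : beta^T *m w0 = k.
  rewrite beta_trE mulmxA mulmxK ?S1_unit//.
  have := mulVmx zu; have : zeta p x *m (invmx (zeta p x) *m col_mx k 0) = col_mx k 0.
    by rewrite mulKVmx.
  by rewrite {1}/zeta mul_col_mx => /eq_col_mx[->].
have bF t w : mul_process beta^T F t w = gap t w + k.
  by rewrite /mul_process !mulmxDr mulmxA beta_psi1 mul0mx add0r bw0.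
have F2 : L2_process P F.
  move=> t i; rewrite (_ : coordp F t i =
      coordp (mul_process (psi1 p) (random_walk u)) t i + coordp Y t i + cst (w0 i ord0)).
    apply: L2_shift; apply: L2D; last exact: Y2.
    exact/L2_mul_process/L2_random_walk.
  by apply/funext => w; rewrite !fctE /coordp !mxE.
have dF : L2_filter P (series_mulr Ginv (Cpoly p)) u (diff_process F).
  have [U2 Uf] := L2_filter_coef (const_mxp (psi1 p)) u2.
  have [V2 Vf] := L2_filter_lag (1 - 'X)%:M u2 Y2 HY.
  apply: L2_filter_ext (L2_filterD u2 U2 V2 Uf Vf).
    by move=> n; rewrite (response_split QE SH).
  apply/funext => t; apply/funext => w.
  rewrite lag_filter_const lag_filter_diff -{1}(diff_random_walk u) /diff_process /F.
  by rewrite mulmxBr [in RHS]opprD [RHS]addrACA subrr addr0 opprD [RHS]addrACA.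
have bF2 : L2_process P (mul_process beta^T F) by exact: L2_mul_process.
have [|bFk sF stF] := stationary_near_gap bF2 (k := k).
  by move=> t; apply: aeW => w; exact: bF.
exists F; split=> //; first by split=> //; exists Ginv.
by split=> //; exists gap_density => //; exact: gap_density_rational.
Qed.

Lemma diff_gap_coef Ginv k : is_inv_series S Ginv ->
  mconv (1 - 'X)%:M gap_coef k = beta^T *m series_mulr Ginv (Cpoly p) k.
Proof.
move=> SG; apply/esym; rewrite (response_split QE SH)// mulmxDr.
rewrite -mconv_const mconv_coef -const_mxpM beta_psi1.
rewrite (_ : coef_mxp (const_mxp 0) k = 0) ?add0r; last first.
  by apply/matrixP => i j; rewrite !mxE coefC if_same.
rewrite -mconv_const -mconvM scalar_mxC mconvM.
by apply: eq_mconv => n; rewrite mconv_const.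
Qed.

(** Both sides are the noise filtered by [beta' S^-1 C]. *)
Lemma diff_solution F t : solution P u p F -> \forall w \ae P,
  diff_process (mul_process beta^T F) t w = diff_process gap t w.
Proof.
move=> [F2 [Ginv SG dF]].
have D2 := L2_diff_process F2.
have [V2 Vf] := L2_filter_lag (1 - 'X)%:M u2 L2_gap gap_filter.
have W2 := L2_mul_process beta^T D2; have Wf := L2_filter_mul beta^T u2 D2 dF.
have e : diff_process (mul_process beta^T F) t = mul_process beta^T (diff_process F) t.
  by apply/funext => w; rewrite /diff_process /mul_process mulmxBr.
rewrite e -(lag_filter_diff gap); apply: (L2_filter_uniq u2 W2 V2 Wf).
by apply: L2_filter_ext Vf => // k; exact: diff_gap_coef.
Qed.

Lemma determined_gap k F t : determined P u p x k F ->
  \forall w \ae P, mul_process beta^T F t w = gap t w + k.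
Proof.
move=> [sF [wF [Sigma rS sS]] kF]; have [[F2 _] _] := (sF, tt).
apply: (stationary_gap u2 u0 uG gap_l1 L2_gap gap_filter _ kF rS sS).
  exact: L2_mul_process.
by move=> s; exact: diff_solution.
Qed.

End Model.

(** * The error correction representation *)

Section Algebra.
Variables (R : realType) (c d q s1 s2 : nat) (p : 'rV[R]_(nparam c d q s1 s2)).
Variables (x : 'M[R]_(c + d, c)) (N : 'M[{poly R}]_(c + d)).
Local Notation A := (Apoly p x N).
Local Notation beta := (betamx p x).
Hypothesis zu : zeta p x \in unitmx.

Lemma eval_mxp_block_lag y :
  eval_mxp (block_mx 1%:M 0 0 (1 - 'X)%:M : 'M[{poly R}]_(c + d)) y =
  block_mx 1%:M 0 0 (1 - y)%:M.
Proof.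
have e1 : eval_mxp (1%:M : 'M[{poly R}]_c) y = 1%:M.
  by apply/matrixP => i j; rewrite !mxE hornerMn hornerC.
have e2 : eval_mxp ((1 - 'X)%:M : 'M[{poly R}]_d) y = (1 - y)%:M.
  by apply/matrixP => i j; rewrite !mxE hornerMn !hornerE.
have e0 m n : eval_mxp (0 : 'M[{poly R}]_(m, n)) y = 0.
  by apply/matrixP => i j; rewrite !mxE horner0.
by rewrite /eval_mxp map_block_mx -!/(eval_mxp _ _) e1 e2 !e0.
Qed.

Lemma Apoly0 : eval_mxp N 0 = 1%:M -> eval_mxp A 0 = 1%:M.
Proof.
move=> N0; rewrite /Apoly !eval_mxpM !eval_mxp_const N0 eval_mxp_block_lag subr0.
by rewrite -scalar_mx_block mulmx1 mulmx1 mulVmx// mul1mx -coef_mxp_eval0 Spoly0.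
Qed.

Lemma Apoly1 : eval_mxp A 1 = alphamx p x N *m beta^T.
Proof.
rewrite /Apoly !eval_mxpM !eval_mxp_const eval_mxp_block_lag subrr beta_trE.
rewrite /alphamx -!mulmxA; congr (_ *m (_ *m _)); rewrite !mulmxA; congr (_ *m _).
by rewrite mul_block_col mul_col_mx !mul1mx !mul0mx mul_scalar_mx scale0r !addr0.
Qed.

Lemma rank_alpha : eval_mxp N 1 \in unitmx -> \rank (alphamx p x N) = c.
Proof.
move=> N1; rewrite /alphamx eqmxMfull; last first.
  by rewrite row_full_unit unitmx_mul unitmx_inv zu.
by rewrite rank_col_mx0 mxrank1.
Qed.

Lemma rank_beta : eval_mxp (Spoly p) 1 \in unitmx -> is_xi_perp p x -> \rank beta = c.
Proof. by move=> S1 [rx _]; rewrite /betamx eqmxMfull// row_full_unit unitmx_tr. Qed.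

Lemma Astar_exists n (B : 'M[{poly R}]_n) :
  exists Bs, (1 - 'X) *: Bs = B - 'X *: const_mxp (eval_mxp B 1).
Proof.
have [|Bs BsE] := @mxp_factor _ _ _ (B - 'X *: const_mxp (eval_mxp B 1)).
  by rewrite eval_mxpD eval_mxpN eval_mxpZ eval_mxp_const hornerX scale1r subrr.
by exists Bs.
Qed.

Lemma Apoly_stack : A = const_mxp (invmx (zeta p x)) *m (N *m
  col_mx (const_mxp x^T *m Spoly p) ((1 - 'X) *: (const_mxp (xi p)^T *m Spoly p))).
Proof.
rewrite /Apoly -!mulmxA; congr (_ *m (_ *m _)).
have -> : const_mxp (zeta p x) = col_mx (const_mxp x^T) (const_mxp (xi p)^T).
  exact: map_col_mx.
rewrite [_ *m Spoly p in LHS]mul_col_mx mul_block_col.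
by rewrite !mul0mx add0r addr0 mul1mx mul_scalar_mx.
Qed.

End Algebra.

Section LagExtra.
Context (disp : measure_display) (T : measurableType disp) (R : realType).

Lemma lag_filter_col m1 m2 n (A : 'M[{poly R}]_(m1, n)) (B : 'M[{poly R}]_(m2, n))
    (X : process T R n) t w :
  lag_filter (col_mx A B) X t w = col_mx (lag_filter A X t w) (lag_filter B X t w).
Proof.
apply/colP => i; case: (split_ordP i) => j ->; rewrite ?col_mxEu ?col_mxEd !mxE;
by apply: eq_bigr => l _; rewrite ?col_mxEu ?col_mxEd.
Qed.

Lemma lag_filterZdiff m n (A : 'M[{poly R}]_(m, n)) (X : process T R n) :
  lag_filter ((1 - 'X) *: A) X = lag_filter A (diff_process X).
Proof. by rewrite -mul_mx_scalar lag_filterM lag_filter_diff. Qed.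

Lemma lag_filter_error_correction m n (A As : 'M[{poly R}]_(m, n)) (A1 : 'M[R]_(m, n))
    (X : process T R n) t w :
  (1 - 'X) *: As = A - 'X *: const_mxp A1 ->
  lag_filter A X t w = lag_filter As (diff_process X) t w + A1 *m X (t - 1) w.
Proof.
move=> /esym/eqP; rewrite subr_eq => /eqP ->; rewrite lag_filterD lag_filterZdiff.
by rewrite -mul_mx_scalar lag_filterM lag_filter_const lag_filter_X.
Qed.

End LagExtra.

Section ErrorCorrection.
Context (disp : measure_display) (T : measurableType disp) (R : realType).
Variable P : probability T R.
Local Notation process := (process T R).
Local Notation eta := Defs.eta.
Variables (q : nat) (u : process q) (G : 'M[R]_q).
Hypothesis u2 : L2_process P u.
Hypothesis u0 : mean_process P u 0.
Hypothesis uG : forall t s i j,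
  covariance P (coordp u t i) (coordp u s j) = ((t == s)%:R * G i j)%:E.
Variables (c d s1 s2 : nat) (p : 'rV[R]_(nparam c d q s1 s2)).
Local Notation S := (Spoly p).
Local Notation S1 := (S_at1 p).
Hypothesis Sst : stable_mxp S.
Variable x : 'M[R]_(c + d, c).
Hypothesis hx : is_xi_perp p x.
Local Notation beta := (betamx p x).
Variables (Q : 'M[{poly R}]_(c + d, q)) (H : nat -> 'M[R]_(c + d, q)).
Hypothesis QE : Cpoly p - S *m const_mxp (psi1 p) = (1 - 'X) *: Q.
Hypothesis SH : mconv S H =1 coef_mxp Q.
Variable Y : process (c + d).
Hypothesis Y2 : L2_process P Y.
Hypothesis HY : L2_filter P H u Y.
Hypothesis zu : zeta p x \in unitmx.
Variable N : 'M[{poly R}]_(c + d).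
Hypothesis NM : N *m Mpoly p x = const_mxp (eval_mxp (Mpoly p x) 0).

(** Apply [xi' S] to the difference equation. *)
Lemma solution_bottom F t : solution P u p F -> \forall w \ae P,
  lag_filter ((1 - 'X) *: (const_mxp (xi p)^T *m S)) F t w =
  lag_filter (const_mxp (xi p)^T *m Cpoly p) u t w.
Proof.
move=> [F2 [Ginv SG dF]]; rewrite lag_filterZdiff.
have [V2 Vf] := L2_filter_lag (const_mxp (xi p)^T *m S) u2 (L2_diff_process F2) dF.
have [W2 Wf] := L2_filter_coef (const_mxp (xi p)^T *m Cpoly p) u2.
apply: (L2_filter_uniq u2 V2 W2 Vf); apply: L2_filter_ext Wf => // n.
by rewrite mconvM (eq_mconv _ (inv_seriesP (Cpoly p) SG)) mconv_coef.
Qed.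

(** Write [S = S(1) + (1 - L) St]. Then [x' S F] is the sum of [beta' F], which
    is [k] plus a filter of the noise, and of a filter of [(1 - L) F]. The total
    filter of the noise is found by multiplying it by [1 - L], which gives
    [x' C], and dividing again. *)
Lemma determined_top k F t : determined P u p x k F -> \forall w \ae P,
  lag_filter (const_mxp x^T *m S) F t w = k +
  lag_filter (const_mxp (x^T *m Dmx p) + (1 - 'X) *: (const_mxp x^T *m Epoly p)) u t w.
Proof.
move=> dF; set J := _ + _ *: _.
have [[F2 [Ginv SG diffF]] _ _] := dF.
have [St StE] : exists St, S = const_mxp S1 + (1 - 'X) *: St.
  have [|St StE] := @mxp_factor _ _ _ (S - const_mxp S1).
    by rewrite eval_mxpD eval_mxpN eval_mxp_const subrr.
  by exists St; rewrite -StE addrC subrK.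
have xS : const_mxp x^T *m S = const_mxp beta^T + (1 - 'X) *: (const_mxp x^T *m St).
  by rewrite {1}StE mulmxDr -const_mxpM -scalemxAr beta_trE.
have Z2 := L2_gap p x Y2; have Zf := gap_filter u2 p x Y2 HY.
have [V2 Vf] := L2_filter_lag (const_mxp x^T *m St) u2 (L2_diff_process F2) diffF.
have [W2 Wf] := L2_filter_coef J u2.
have U2 : L2_process P (fun t w =>
    gap p x Y t w + lag_filter (const_mxp x^T *m St) (diff_process F) t w).
  move=> s i; rewrite (_ : coordp _ s i = coordp (gap p x Y) s i +
      coordp (lag_filter (const_mxp x^T *m St) (diff_process F)) s i).
    by apply: L2D; [exact: Z2|exact: V2].
  by apply/funext => w; rewrite !fctE /coordp !mxE.
have JE : (fun n => gap_coef p x H n +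
    mconv (const_mxp x^T *m St) (series_mulr Ginv (Cpoly p)) n) =1 coef_mxp J.
  apply: (@mconv_inj _ _ _ (1 - 'X)%:M) => [|n].
    by apply/matrixP => i j; rewrite !mxE coefMn coefB coefC coefX subr0.
  rewrite mconvDr (diff_gap_coef Sst hx QE SH n SG) -mconv_const -mconvM -mconvDl.
  rewrite mul_scalar_mx -xS mconvM (eq_mconv _ (inv_seriesP (Cpoly p) SG)).
  by rewrite !mconv_coef xi_perp_mul_Cpoly// mul_scalar_mx.
have Uf := L2_filter_ext JE erefl (L2_filterD u2 Z2 V2 Zf Vf).
have := L2_filter_uniq u2 U2 W2 Uf Wf t.
apply: filterS2 (determined_gap u2 u0 uG Sst hx QE SH Y2 HY t dF) => w gk UW.
by rewrite xS lag_filterD lag_filter_const lag_filterZdiff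
  -[beta^T *m F t w]/(mul_process beta^T F t w) gk -UW addrAC addrC.
Qed.

(** The two previous lemmas make [(k, 0)' + M(L) u] out of [F], by [zeta S] with
    a difference in the last [d] rows; [N] then reduces [M(L) u] to [M(0) u]. *)
Lemma determined_error_correction k F t : determined P u p x k F -> \forall w \ae P,
  lag_filter (Apoly p x N) F t w = hvec p x N k + eval_mxp (Cpoly p) 0 *m u t w.
Proof.
move=> dF; have [sF _ _] := dF.
pose X := lag_filter (col_mx (const_mxp x^T *m S) ((1 - 'X) *: (const_mxp (xi p)^T *m S))) F.
have XE s : \forall w \ae P, X s w = col_mx k 0 + lag_filter (Mpoly p x) u s w.
  apply: filterS2 (determined_top s dF) (solution_bottom s sF) => w e1 e2.
  by rewrite /X lag_filter_col e1 e2 MpolyE lag_filter_col add_col_mx add0r.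
apply: filterS (lag_filter_ae N XE t) => w E.
rewrite Apoly_stack !lag_filterM lag_filter_const E lag_filterDr lag_filter_cst.
rewrite -lag_filterM NM lag_filter_const Mpoly0// mulmxDr /hvec !mulmxA; congr (_ + _).
by rewrite mulVmx// mul1mx.
Qed.

End ErrorCorrection.

Section Final.
Variables (R : realType) (c d q s1 s2 : nat) (p : 'rV[R]_(nparam c d q s1 s2)).
Hypothesis Sst : stable_mxp (Spoly p).
Variable x : 'M[R]_(c + d, c).
Variable Q : 'M[{poly R}]_(c + d, q).
Hypothesis QE : Cpoly p - Spoly p *m const_mxp (psi1 p) = (1 - 'X) *: Q.

(** The numerator of the spectrum at frequency zero, in terms of the parameters
    and for any choice of the orthogonal complement of [xi]. *)
Lemma gap_num_at1 K : x^T = K *m (xi_perp p)^T ->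
  eval_mxp (gap_num p x Q) 1 = K *m long_run p.
Proof.
move=> xE; rewrite /gap_num !eval_mxpM eval_mxp_const eval_mxp_adj beta_trE.
rewrite (transitory_at1 QE) /long_run (mulmxA K) -xE -!mulmxA; congr (_ *m _).
rewrite (mulmxA (S_at1 p)) mul_mx_adj mul_scalar_mx scalerDr; congr (_ + _).
rewrite scalemxAr; congr (_ *m _); rewrite /psi1 scalemxAl; congr (_ *m _).
have Su := S1_unit Sst; rewrite /invmx Su scalerA mulrV ?scale1r//.
Qed.
End Final.

Theorem proposition3 (disp : measure_display) (T : measurableType disp)
    (R : realType) (P : probability T R) (c d q s1 s2 : nat)
    (q_gt0 : (0 < q)%N) (q_lt_r : (q < c + d)%N)
    (c_lt_r : (c < c + d)%N) (rBq_le_c : (c + d - q <= c)%N)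
    (u : process T R q) (u_wn : white_noise P u)
    (Pi : set 'rV[R]_(nparam c d q s1 s2)) (Pi_open : open Pi)
    (Pi_stable : forall p, Pi p -> stable_mxp (Spoly p))
    (k : 'cV[R]_c) :
  generically Pi (fun p =>
    \rank (xi p) = d /\
    forall xip : 'M[R]_(c + d, c), is_xi_perp p xip ->
    let beta := betamx p xip in
    [/\ exists F : process T R (c + d), determined P u p xip k F,
        exists N Astar : 'M[{poly R}]_(c + d),
          let A := Apoly p xip N in
          let alpha := alphamx p xip N in
          [/\ eval_mxp N 0 = 1%:M,
              N *m Mpoly p xip = const_mxp (eval_mxp (Mpoly p xip) 0)
            & stable_mxp N] /\
          [/\ (1 - 'X) *: Astar = A - 'X *: const_mxp (eval_mxp A 1),
              eval_mxp A 0 = 1%:M,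
              \rank alpha = c,
              \rank beta = c
            & eval_mxp A 1 = alpha *m beta^T] /\
          (forall F : process T R (c + d), determined P u p xip k F ->
           forall t : int, \forall w \ae P,
             lag_filter A F t w
               = lag_filter Astar (diff_process F) t w
                 + alpha *m mul_process beta^T F (t - 1) w /\
             lag_filter A F t w
               = hvec p xip N k + eval_mxp (Cpoly p) 0 *m u t w)
      & forall F : process T R (c + d), determined P u p xip k F ->
          I0 P (mul_process beta^T F)]).
Proof.
have c_gt0 : (0 < c)%N.
  by rewrite (leq_trans _ rBq_le_c)// subn_gt0.
have [u2 u0 [G Gu uG]] := u_wn.
apply: (generically_good (q_gt0 := q_gt0) (q_lt_r := q_lt_r) (c_gt0 := c_gt0)) => // p /Pi_stable Sst gp.
split; first exact: good_rank_xi gp.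
move=> x hx beta; have zu := good_zeta_unit gp hx.
have [Q QE] := transitory_poly Sst.
have [H SH] := mconv_solve (coef_mxp Q) (Spoly0 p).
have [K uK] := white_noise_bounded u2 u0 uG.
have [Y Y2 HY] := L2_filter_exists u2 uK (transitory_l1 Sst SH).
split.
- exact: (determined_exists u2 u0 uG Sst hx QE SH Y2 HY zu).
- have [B BM] := good_left_inverse gp hx.
  have [N [N0 NM Nst N1]] := zeroless_inverse_filter BM.
  have [As AsE] := Astar_exists (Apoly p x N).
  have A1 := Apoly1 p x N.
  exists N, As; split=> //; split.
    split=> //; [exact: Apoly0|exact: rank_alpha|exact: rank_beta (S1_unit Sst) hx].
  move=> F dF t.
  apply: filterS (determined_error_correction u2 u0 uG Sst hx QE SH Y2 HY zu NM t dF).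
  move=> w E; split=> //.
  by rewrite (lag_filter_error_correction F t w AsE) A1 -mulmxA.
- move=> F dF; have [[F2 _] _ _] := dF.
  have bF2 : L2_process P (mul_process beta^T F) by exact: L2_mul_process.
  have bF t := determined_gap u2 u0 uG Sst hx QE SH Y2 HY t dF.
  have [_ sF wF] := stationary_near_gap u2 u0 uG Sst SH Y2 HY bF2 bF.
  split=> //; exists (gap_density G p x Q); split=> //.
    exact: gap_density_rational.
  apply: (filter_density_neq0 u2 u0 Gu uG (stable_circle Sst)).
  have [L Lu xE] := good_xi_perp gp hx.
  rewrite (gap_num_at1 Sst QE xE); apply: contra_neq (good_long_run gp) => L0.
  by rewrite -(mulKmx Lu (long_run p)) L0 mulmx0.
Qed.
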